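(* Let $\mathcal{R}:\mathbb{D}\to\mathbb{R}_+$ be bounded, compactly supported and radial. Then $$\mathrm{Var}_{\mathbb{P}}(g_X^{\mathcal{R}}(z;F_{\mathbb{D}}))=\frac{1}{2(1-|z|^2)^2}\int_{\mathbb{D}}\int_{\mathbb{D}}\frac{|\mathcal{R}(x)-\mathcal{R}(y)|^2}{(1-|xy|^2)^5}\cdot I_z(x,y)\,dA(x)\,dA(y)$$ for any $z\in\mathbb{D}$, where $I_z(x,y)$ is given by the formula $$I_z(x,y)=1+(3+8|z|^2)|xy|^2+(3|z|^4+8|z|^2)|xy|^4+|z|^4|xy|^6.$$
   Context: $\mathbb{D}$ is the open unit disk in $\mathbb{C}$, $dA$ is Lebesgue measure on $\mathbb{D}$ normalized so that $A(\mathbb{D})=1$, and $K_{\mathbb{D}}(z,w)=(1-z\bar w)^{-2}$ is the Bergman kernel. $A^2(\mathbb{D})$ is the Hilbert space of holomorphic $f:\mathbb{D}\to\mathbb{C}$ with $\|f\|^2=\int_{\mathbb{D}}|f|^2dA<\infty$. $\mathbb{P}=\mathbb{P}_{K_{\mathbb{D}}}$ is the determinantal point process induced by $K_{\mathbb{D}}$: the unique simple point process (Borel probability measure on the space of locally finite configurations $X$ on $\mathbb{D}$) whose $n$-th correlation function with respect to $dA$ is $\det(K_{\mathbb{D}}(x_i,x_j))_{1\le i,j\le n}$ for all $n\ge1$. $F_{\mathbb{D}}:\mathbb{D}\to A^2(\mathbb{D})$ is defined by $F_{\mathbb{D}}(w)=K_{\mathbb{D}}(\cdot,w)$, and $g_X^{\mathcal{R}}(z;F_{\mathbb{D}})=\sum_{x\in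 X}\mathcal{R}(\varphi_z(x))F_{\mathbb{D}}(x)\in A^2(\mathbb{D})$ with $\varphi_z(x)=\frac{z-x}{1-\bar z x}$. For a Hilbert-space valued random vector $Y$, $\mathrm{Var}(Y)=\mathbb{E}\|Y-\mathbb{E}Y\|^2$. *)

(* Defs.v *)
From HB Require Import structures.
From mathcomp Require Import all_boot all_order all_algebra.
From mathcomp Require Import complex.
From mathcomp Require Import all_classical all_reals all_analysis.
From mathcomp Require Import measurable_realfun.

Set Implicit Arguments.
Unset Strict Implicit.
Unset Printing Implicit Defensive.

Import Order.TTheory GRing.Theory Num.Theory.
Import numFieldNormedType.Exports.

Local Open Scope classical_set_scope.
Local Open Scope ring_scope.

(* R-valued modulus; `|z| on R[i] is complex-valued. *)
Notation normc := ComplexField.Normc.normc.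

(* R[i] carries no topology in the library: topological notions below are those
   of R[i]^o, i.e. of R[i] normed over itself, so that derivable means
   complex differentiable. *)

Section ComplexPlane.
Variable R : realType.

Definition complex_of_pair (p : R * R) : R[i] := Complex p.1 p.2.

(* Borel sets of R[i], transported from R * R. *)
Definition complex_measurable : set (set R[i]) :=
  [set A | measurable (complex_of_pair @^-1` A)].

Lemma complex_measurable0 : complex_measurable set0.
Proof. by rewrite /complex_measurable /= preimage_set0. Qed.

Lemma complex_measurableC A :
  complex_measurable A -> complex_measurable (~` A).
Proof. by rewrite /complex_measurable /= preimage_setC; exact: measurableC. Qed.

Lemma complex_measurable_bigcup (F : (set R[i])^nat) :
  (forall k, complex_measurable (F k)) -> complex_measurable (\bigcup_k F k).
Proof.
move=> mF; rewrite /complex_measurable /= preimage_bigcup.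
by apply: bigcup_measurable => k _; exact: mF.
Qed.

HB.instance Definition _ := isPointed.Build R[i] 0.
HB.instance Definition _ := @isMeasurable.Build default_measure_display R[i]
  complex_measurable complex_measurable0 complex_measurableC
  complex_measurable_bigcup.

Lemma measurable_complex_of_pair : measurable_fun setT complex_of_pair.
Proof. by move=> _ A mA; rewrite setTI. Qed.

Lemma invr_pi_ge0 : 0 <= pi^-1 :> R.
Proof. by rewrite invr_ge0 pi_ge0. Qed.

(* Lebesgue measure on the complex plane. *)
Definition area : set R[i] -> \bar R :=
  pushforward (lebesgue_measure \x lebesgue_measure)%E complex_of_pair.

Lemma area0 : area set0 = 0%E.
Proof. by rewrite /area /pushforward preimage_set0 measure0. Qed.

Lemma area_ge0 A : (0 <= area A)%E.
Proof. by rewrite /area /pushforward measure_ge0. Qed.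

Lemma area_semi_sigma_additive : semi_sigma_additive area.
Proof.
apply: (@measure_semi_sigma_additive _ _ _ (pushforward _ _)).
exact: measurable_complex_of_pair.
Qed.

HB.instance Definition _ := isMeasure.Build _ _ _ area
  area0 area_ge0 area_semi_sigma_additive.

(* The unit disk has mass 1. *)
Definition dA : set R[i] -> \bar R := mscale (NngNum invr_pi_ge0) area.

HB.instance Definition _ := Measure.on dA.

Definition disk : set R[i] := [set z | normc z < 1].

End ComplexPlane.

Arguments dA {R}.
Arguments disk {R}.

Section Configurations.
Variable R : realType.

Definition locally_finite (X : set R[i]) :=
  forall K : set R[i]^o, compact K -> K `<=` disk -> finite_set (X `&` K).

(* Locally finite subsets of the disk: all configurations are simple. *)
Record config := Config {
  points :> set R[i];
  points_disk : points `<=` disk;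
  points_locally_finite : locally_finite points }.

Lemma locally_finite0 : locally_finite set0.
Proof. by move=> K _ _; rewrite set0I; exact: finite_set0. Qed.

HB.instance Definition _ := gen_eqMixin config.
HB.instance Definition _ := gen_choiceMixin config.
HB.instance Definition _ :=
  isPointed.Build config (Config (@sub0set _ disk) locally_finite0).

(* Continuous functions with compact support in the disk, extended by 0. *)
Definition test_fun := {f : R[i]^o -> R | continuous f /\
  exists K : set R[i]^o, [/\ compact K, K `<=` disk &
    forall x, f x != 0 -> K x]}.

Definition linear_statistics (X : config) :
    prod_topology (fun _ : test_fun => R) :=
  fun f => \sum_(x \in points X) sval f x.

(* The vague topology on configurations. *)
Definition vague_open : set (set config) :=
  @open (initial_topology linear_statistics).

(* Configurations with the Borel sigma-algebra of the vague topology. *)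
Definition configuration := g_sigma_algebraType vague_open.

End Configurations.

Section DeterminantalProcess.
Variable R : realType.

(* Integration over the n-th power of the disk; for f nonnegative and
   measurable this is the integral against the product measure (Tonelli). *)
Fixpoint iter_integral (n : nat) : (n.-tuple R[i] -> \bar R) -> \bar R :=
  match n with
  | 0%N => fun f => f [tuple]
  | m.+1 => fun f =>
      (\int[dA]_(x in disk) iter_integral (fun t => f [tuple of x :: t]))%E
  end.

Definition distinct_tuples (n : nat) (X : set R[i]) : set (n.-tuple R[i]) :=
  [set t : n.-tuple R[i] | uniq t /\ forall i : 'I_n, X (tnth t i)].

Arguments distinct_tuples n X : clear implicits.

Definition correlation_function (P : probability (configuration R) R)
    (n : nat) (rho : n.-tuple R[i] -> R) :=
  forall f : n.-tuple R[i] -> \bar R,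
    measurable_fun [set: n.-tuple R[i]] f -> (forall t, 0 <= f t)%E ->
    (\int[P]_X (\esum_(t in distinct_tuples n (points X)) f t) =
     iter_integral (fun t => f t * (rho t)%:E))%E.

(* For a Hermitian kernel the determinant is real. *)
Definition determinantal (P : probability (configuration R) R)
    (K : R[i] -> R[i] -> R[i]) :=
  forall n : nat, (0 < n)%N -> correlation_function P
    (fun t : n.-tuple R[i] =>
       complex.Re (\det (\matrix_(i, j) K (tnth t i) (tnth t j)))).

End DeterminantalProcess.

Section BergmanSpace.
Variable R : realType.
Implicit Types f g h : R[i] -> R[i].

(* Functions are defined on all of R[i], but only their values on the disk
   matter: elements of the Bergman space are classes modulo equality there. *)
Definition sqnorm f : \bar R :=
  (\int[dA]_(z in disk) (normc (f z) ^+ 2)%:E)%E.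

Definition bergman_space : set (R[i] -> R[i]) :=
  [set f | (forall z, disk z -> derivable (f : R[i]^o -> R[i]^o) z 1) /\
           (sqnorm f < +oo)%E].

Definition inner f g : R[i] :=
  Complex (\int[dA]_(z in disk) complex.Re (f z * conjc (g z)))
          (\int[dA]_(z in disk) complex.Im (f z * conjc (g z))).

Definition bergman_kernel (z w : R[i]) : R[i] := (1 - z * conjc w) ^- 2.

Definition bergman_F (w : R[i]) : R[i] -> R[i] := fun z => bergman_kernel z w.

Section Expectation.
Variable P : probability (configuration R) R.
Variable Y : configuration R -> R[i] -> R[i].

Definition complex_integrable (u : configuration R -> R[i]) :=
  P.-integrable setT (fun X => (complex.Re (u X))%:E) /\
  P.-integrable setT (fun X => (complex.Im (u X))%:E).

Definition complex_expectation (u : configuration R -> R[i]) : R[i] :=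
  Complex (\int[P]_X complex.Re (u X)) (\int[P]_X complex.Im (u X)).

(* m is the expectation of the Bergman-space-valued random vector Y, in the
   sense that E<Y, h> = <m, h> for every h; m is unique up to equality on the
   disk. *)
Definition is_mean (m : R[i] -> R[i]) :=
  bergman_space m /\
  forall h, bergman_space h ->
    complex_integrable (fun X => inner (Y X) h) /\
    complex_expectation (fun X => inner (Y X) h) = inner m h.

Definition hilbert_mean : R[i] -> R[i] := xget 0 [set m | is_mean m].

Definition hilbert_variance : \bar R := (\int[P]_X sqnorm (Y X - hilbert_mean)%R)%E.

End Expectation.

Definition mobius (z x : R[i]) : R[i] := (z - x) / (1 - conjc z * x).

Definition g_sum (w : R[i] -> R) (F : R[i] -> R[i] -> R[i]) (z : R[i])
    (X : configuration R) : R[i] -> R[i] :=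
  \sum_(x \in points X) (fun zeta => (w (mobius z x))%:C%C * F x zeta).

Definition I_factor (z x y : R[i]) : R :=
  let a := normc z ^+ 2 in
  let s := normc (x * y) ^+ 2 in
  1 + (3 + 8 * a) * s + (3 * a ^+ 2 + 8 * a) * s ^+ 2 + a ^+ 2 * s ^+ 3.

End BergmanSpace.

(* Main.v *)
From HB Require Import structures.
Require Import Defs.
From mathcomp Require Import all_boot all_order all_algebra.
From mathcomp Require Import complex.
From mathcomp Require Import all_classical all_reals all_analysis.
From mathcomp Require Import measurable_realfun.
From mathcomp Require Import ring lra.

Import Order.TTheory GRing.Theory Num.Theory.
Import numFieldNormedType.Exports.

(** The reproducing property makes the variance a matter of double integrals.
    Write phi for the Moebius map of z, which is an involution, w for the
    weight, f = w o phi, K for the kernel and c for the integral of w(y) K(y,y).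
    For h in the Bergman space, the inner product of the random vector with h
    is the linear statistic of f conj(h). Its expectation is the integral of
    f conj(h) K(x,x), by the first correlation function; the measure
    K(x,x) dA(x) is invariant under phi and w is radial, so the mean value
    property gives c conj(h(z)) (mean_formula). Hence the mean is c K(.,z)
    (is_mean_kernel).

    The squared distance to the mean is a finite double sum of real parts of
    kernels (sqnorm_kcomb). The first two correlation functions give
    (variance_moments)
      Var = int f(x)^2 K(x,x)^2 - int int f(x) f(y) Re K(x,y) |K(x,y)|^2.
    Substituting phi in both variables turns f into w, and the kernels into
    (1 - |z|^2)^-2 times an explicit Hermitian kernel Q(x,y) (pulled_kernel).
    As a function of y, Q(x,y) is holomorphic times the conjugate of K(y,x), so
    the reproducing property shows that the integral of Re Q(x,y) in y is
    precisely the density left by the first term (pulled_kernel_mean). So the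
    first term is the double integral of w(x)^2 Re Q(x,y), and by symmetry
      Var = (1/2) (1 - |z|^2)^-2 int int (w(x) - w(y))^2 Re Q(x,y).

    It remains to replace Re Q by its averages over rotations, as w is radial.
    Averaging over joint rotations of x and y by fourth roots of unity leaves a
    function of p = y conj(x) (pulled_kernel_average), a polynomial in p times
    (1 - p)^-4 (1 - conj p)^-2. For the rotations of y alone, put u = 1/(1 - p)
    and t = 1/(1 - |p|^2). Then u conj(u) = t (u + conj(u) - 1), which reduces
    mixed powers of u and conj(u) to pure ones, with coefficients that are
    polynomials in t; the pure powers have circle mean 1 (resolvent_mean). The
    resulting function of |x y|^2 is I_z(x,y) / (1 - |x y|^2)^5
    (averaged_mean).

    Three tools are built on the way. Area is transported by Moebius maps
    because these are composed of affine maps and the inversion, each reduced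
    to substitutions on the line. Mean values of holomorphic functions follow
    from Goursat's bisection, in logarithmic coordinates where circles become
    segments. Sums over the points of a configuration are measurable because
    this holds for continuous test functions, by definition of the vague
    topology, and extends to Borel functions by a pi-lambda argument
    (measurable_lsum, measurable_inner). *)

Local Open Scope classical_set_scope.
Local Open Scope ring_scope.

(** * One-dimensional changes of variables *)

Section density.
Context d1 d2 (X : measurableType d1) (Y : measurableType d2) (R : realType).
Variables (mu : {measure set X -> \bar R}) (phi : X -> Y) (J : X -> R).
Hypothesis mphi : measurable_fun setT phi.
Hypotheses (J0 : forall x, 0 <= J x) (mJ : measurable_fun setT J).

Definition density_pushforward (A : set Y) : \bar R :=
  (\int[mu]_(x in phi @^-1` A) (J x)%:E)%E.

Let mphiI A : measurable A -> measurable (phi @^-1` A).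
Proof. by move=> mA; rewrite -[X in measurable X]setTI; exact: mphi. Qed.

Let density0 : density_pushforward set0 = 0%E.
Proof. by rewrite /density_pushforward preimage_set0 integral_set0. Qed.

Let density_ge0 A : (0 <= density_pushforward A)%E.
Proof. by apply: integral_ge0 => x _; rewrite lee_fin. Qed.

Let density_semi_sigma_additive : semi_sigma_additive density_pushforward.
Proof.
move=> F mF tF mUF; rewrite /density_pushforward preimage_bigcup.
rewrite ge0_integral_bigcup//; last 3 first.
- exact/measurable_EFinP/measurable_funTS.
- by move=> x _; rewrite lee_fin.
- move: tF => /trivIsetP tF; apply/trivIsetP => i j _ _ ij.
  by rewrite -preimage_setI tF// preimage_set0.
- by apply: is_cvg_ereal_nneg_natsum_cond => n _ _; exact: density_ge0.
- by move=> k; apply: mphiI; exact: mF.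
Qed.

HB.instance Definition _ := isMeasure.Build _ _ _ density_pushforward
  density0 density_ge0 density_semi_sigma_additive.

Import HBNNSimple.

(** By monotone approximation with simple functions. *)
Lemma ge0_integral_density_pushforward (g : Y -> \bar R) :
  measurable_fun setT g -> (forall y, (0 <= g y)%E) ->
  (\int[density_pushforward]_y g y = \int[mu]_x (g (phi x) * (J x)%:E))%E.
Proof.
move=> mg g0; pose g_ := nnsfun_approx measurableT mg.
have cg y : ((g_ n y)%:E @[n --> \oo] --> g y)%E.
  by apply: cvg_nnsfun_approx.
have ndg y : {homo (fun n => (g_ n y)%:E) : m n / (m <= n)%N >-> (m <= n)%E}.
  by move=> m n mn; rewrite lee_fin; exact/lefP/nd_nnsfun_approx.
transitivity (limn (fun n => \int[density_pushforward]_y (g_ n y)%:E)%E).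
  rewrite -monotone_convergence//.
  - by apply: eq_integral => y _; apply/esym/cvg_lim => //; exact: cg.
  - by move=> n; exact/measurable_EFinP/measurable_funP.
  - by move=> n y _; rewrite lee_fin.
rewrite [X in limn X](_ : _ =
    (fun n => \int[mu]_x ((g_ n (phi x))%:E * (J x)%:E))%E).
  rewrite -monotone_convergence//.
  - apply: eq_integral => x _; apply/cvg_lim => //.
    by apply: cvgeZr => //; exact: cg.
  - by move=> n; apply: emeasurable_funM; exact/measurable_EFinP/measurableT_comp.
  - by move=> n x _; rewrite mule_ge0// lee_fin.
  - by move=> x _ m n mn; rewrite lee_wpmul2r ?lee_fin//; exact/lefP/nd_nnsfun_approx.
apply/funext => n.
have mI r : measurable (g_ n @^-1` [set r]) by [].
under [LHS]eq_integral do rewrite fimfunE -fsumEFin//.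
rewrite ge0_integral_fsum//; last 2 first.
  - by move=> y; exact/measurable_EFinP/measurable_funM.
  - by move=> y x _; rewrite nnfun_muleindic_ge0.
under [RHS]eq_integral => x _.
  rewrite fimfunE -fsumEFin// ge0_mule_fsuml; last first.
    by move=> r; rewrite nnfun_muleindic_ge0.
  over.
rewrite ge0_integral_fsum//; last 2 first.
  - move=> r; apply: emeasurable_funM; apply/measurable_EFinP => //.
    apply: measurable_funM => //.
    exact: (measurableT_comp (measurable_indic (mI r)) mphi).
  - by move=> r x _; apply: mule_ge0; [exact: (nnfun_muleindic_ge0 (g_ n) r (phi x))|rewrite lee_fin].
apply: eq_fsbigr => r _; rewrite integralZl_indic_nnsfun// integral_indic// setIT.
have [r0|r0] := ltP r 0.
  rewrite preimage_nnfun0// measure0 mule0 integral0_eq// => x _.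
  by rewrite indic0 mulr0 mul0e.
under eq_integral do rewrite EFinM -muleA.
rewrite ge0_integralZl//; last 2 first.
  - apply: emeasurable_funM; apply/measurable_EFinP => //.
    exact: (measurableT_comp (measurable_indic (mI r)) mphi).
  - by move=> x _; rewrite mule_ge0// lee_fin.
congr (_ * _)%E.
rewrite -[LHS]/(\int[mu]_(x in phi @^-1` (g_ n @^-1` [set r])) (J x)%:E)%E.
rewrite [LHS]integral_mkcond.
apply: eq_integral => x _; rewrite patchE indicE.
have -> : (x \in phi @^-1` (g_ n @^-1` [set r])) = (phi x \in g_ n @^-1` [set r]).
  by apply/idP/idP; rewrite !inE.
by case: ifPn; rewrite ?mul1e ?mul0e.
Unshelve. all: by end_near. Qed.

End density.

Section line_substitution.
Context {R : realType}.
Notation mu := (@lebesgue_measure R).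
Implicit Type g : R -> \bar R.

(** By uniqueness of Lebesgue measure, both sides need only be compared on
    half-open intervals. *)
Lemma ge0_integral_affine g (a b : R) : a != 0 ->
  measurable_fun setT g -> (forall x, (0 <= g x)%E) ->
  (\int[mu]_x (g (a * x + b)%R * `|a|%:E) = \int[mu]_x g x)%E.
Proof.
move=> a0 mg g0.
have mphi : measurable_fun [set: measurableTypeR R]
    ((fun x => a * x + b) : measurableTypeR R -> measurableTypeR R).
  by apply: measurable_funD => //; exact: measurable_funM.
rewrite -(@ge0_integral_density_pushforward _ _ _ _ _ mu _ (cst `|a|) mphi)//.
apply: eq_measure_integral => A mA _; apply/esym.
apply: lebesgue_measure_unique mA => /=.
move=> _ [[c d]] _ <-.
rewrite /density_pushforward/= integral_cst//; last first.
  by rewrite -[X in measurable X]setTI; exact: mphi.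
have [ap|an|a00] := ltgtP 0 a; last by rewrite -a00 eqxx in a0.
- have -> : (fun x : R => a * x + b) @^-1` `]c, d]%classic
      = `](c - b) / a, (d - b) / a]%classic.
    apply/seteqP; split => x /=; rewrite !in_itv/= ltr_pdivrMr// ler_pdivlMr//
      ltrBlDr lerBrDr mulrC//.
  rewrite [LHS]lebesgue_measure_itv [X in (_ * X)%E]lebesgue_measure_itv/= !lte_fin ltr_pM2r ?invr_gt0// ltrD2r.
  case: ifPn => _; last by rewrite mule0.
  by rewrite gtr0_norm// -!EFinD -EFinM; congr _%:E; field.
- have -> : (fun x : R => a * x + b) @^-1` `]c, d]%classic
      = `[(d - b) / a, (c - b) / a[%classic.
    apply/seteqP; split => x /=; rewrite !in_itv/= ler_ndivrMr// ltr_ndivlMr//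
      ltrBlDr lerBrDr mulrC andbC//.
  rewrite [LHS]lebesgue_measure_itv [X in (_ * X)%E]lebesgue_measure_itv/= !lte_fin ltr_nM2r ?invr_lt0// ltrD2r.
  case: ifPn => _; last by rewrite mule0.
  by rewrite ltr0_norm// -!EFinD -EFinM; congr _%:E; field.
Qed.

Lemma measurable_funV d (T : measurableType d) (D : set T) (f : T -> R) :
  measurable_fun D f -> measurable_fun D (fun x => (f x)^-1).
Proof.
move=> mf; have mV : measurable_fun [set: R] (@GRing.inv R).
  rewrite -(setvU [set 0 : R]).
  apply/(measurable_funU (GRing.inv : R -> R)) => //.
    exact: measurableC.
  split; last exact: measurable_fun_set1.
  apply: open_continuous_measurable_fun.
    by apply: closed_openC; exact: closed_eq.
  move=> x; rewrite inE/= => x0; apply: inv_continuous.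
  by apply/eqP.
by apply: (measurableT_comp mV).
Qed.

Let inversion_pos (b : R) : 0 < b ->
  (\int[mu]_(x in `[b^-1%R, +oo[) (x ^- 2)%:E = b%:E)%E.
Proof.
move=> b0; have bV0 : 0 < b^-1 by rewrite invr_gt0.
have P (x : R) : b^-1 <= x -> 0 < x by exact: lt_le_trans.
rewrite (@ge0_continuous_FTC2y _ _ (fun x => - x^-1) _ 0).
- by rewrite sub0e -EFinN opprK invrK.
- by move=> x /P x0; rewrite invr_ge0 exprn_ge0// ltW.
- apply: continuous_in_subspaceT => x; rewrite inE/= in_itv/= andbT => /P x0.
  apply: cvgV; first by rewrite expf_neq0// gt_eqF.
  exact: exprn_continuous.
- rewrite -oppr0; apply: cvgN; apply/gtr0_cvgV0.
    by near=> x; near: x; exact: nbhs_pinfty_gt.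
  exact: cvg_id.
- move=> x bx; have x0 : 0 < x by apply: P; exact: ltW.
  apply: derivableN; apply: derivableV => //; by rewrite gt_eqF.
- apply: cvg_at_right_filter; apply: cvgN; apply: inv_continuous.
  by rewrite gt_eqF.
- move=> x; rewrite in_itv/= andbT => bx; have x0 : 0 < x by apply: P; exact: ltW.
  rewrite derive1E deriveN; last by apply: derivableV => //; rewrite gt_eqF.
  rewrite deriveV//; last by rewrite gt_eqF.
  by rewrite derive_id scaleNr opprK /GRing.scale/= mulr1.
Unshelve. all: by end_near. Qed.

(** The inversion, extended by the identity to a map of the whole line so that
    Lebesgue measure is its image with density J and uniqueness applies. *)
Let phi (x : R) : R := if 0 < x then x^-1 else x.
Let J (x : R) : R := if 0 < x then x ^- 2 else 1.

Let mphi : measurable_fun [set: measurableTypeR R] (phi : measurableTypeR R -> measurableTypeR R).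
Proof.
apply: measurable_fun_ifT; first exact: measurable_fun_ltr.
  exact: measurable_funV.
exact: measurable_id.
Qed.

Let mJ : measurable_fun [set: measurableTypeR R] (J : measurableTypeR R -> R).
Proof.
apply: measurable_fun_ifT; first exact: measurable_fun_ltr.
  by apply: measurable_funV; exact: measurable_funX.
exact: measurable_cst.
Qed.

Let J0 x : 0 <= J x.
Proof. by rewrite /J; case: ifP => // x0; rewrite invr_ge0 exprn_ge0// ltW. Qed.

Let phi_gt0 x : (0 < phi x) = (0 < x).
Proof. by rewrite /phi; case: ifP => // x0; rewrite invr_gt0. Qed.

Let inversion_pos0 (b : R) : 0 < b ->
  (\int[mu]_(x in phi @^-1` `]0%R, b]) (J x)%:E = b%:E)%E.
Proof.
move=> b0; rewrite -[RHS]inversion_pos//.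
have -> : phi @^-1` `]0, b]%classic = `[b^-1, +oo[%classic.
  apply/seteqP; split => x /=; rewrite !in_itv/= andbT phi_gt0.
    by move=> /andP[x0]; rewrite /phi x0 => xb; rewrite invf_ple.
  move=> bx; have x0 : 0 < x by rewrite (lt_le_trans _ bx)// invr_gt0.
  by rewrite x0/= /phi x0 invf_ple.
apply: eq_integral => x; rewrite inE/= in_itv/= andbT => bx.
by rewrite /J (lt_le_trans _ bx)// invr_gt0.
Qed.

Let inversion_neg (a b : R) : b <= 0 ->
  (\int[mu]_(x in phi @^-1` `]a, b]) (J x)%:E = mu `]a, b])%E.
Proof.
move=> b0; have -> : phi @^-1` `]a, b]%classic = `]a, b]%classic.
  apply/seteqP; split => x /=; rewrite !in_itv/= => /andP[ax xb].
    have : ~~ (0 < x) by rewrite -phi_gt0 -leNgt (le_trans xb).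
    by move: ax xb; rewrite /phi => + + /negbTE x0; rewrite x0 => -> ->.
  by rewrite /phi (ltNge 0 x) (le_trans xb b0)/= ax.
under eq_integral => x.
  rewrite inE/= in_itv/= => /andP[_ xb]; rewrite /J ltNge (le_trans xb b0)/=.
  over.
by rewrite integral_cst// mul1e.
Qed.

Lemma ge0_integral_inversion_pos g :
  measurable_fun setT g -> (forall x, (0 <= g x)%E) ->
  (\int[mu]_(x in `]0%R, +oo[) (g (x^-1)%R * (x ^- 2)%:E)
   = \int[mu]_(x in `]0%R, +oo[) g x)%E.
Proof.
move=> mg g0.
have mgr : measurable_fun setT (g \_ `]0%R, +oo[%classic).
  by apply/(measurable_restrictT g) => //; exact: measurable_funTS.
have gr0 x : (0 <= (g \_ `]0%R, +oo[%classic) x)%E by rewrite patchE; case: ifP.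
rewrite [RHS]integral_mkcond [LHS]integral_mkcond.
transitivity (\int[mu]_x ((g \_ `]0%R, +oo[%classic) (phi x) * (J x)%:E))%E.
  apply: eq_integral => x _.
  have : (phi x \in `]0, +oo[%classic) = (x \in `]0, +oo[%classic).
    by apply/idP/idP; rewrite !inE/= !in_itv/= !andbT phi_gt0.
  rewrite !patchE => ->; case: ifPn; rewrite ?mul0e// inE/= in_itv/= andbT => x0.
  by rewrite /phi /J x0.
rewrite -(@ge0_integral_density_pushforward _ _ _ _ _ mu _ J mphi J0 mJ)//.
apply: eq_measure_integral => A mA _; apply/esym.
apply: lebesgue_measure_unique mA => /= _ [[a b]] _ <-.
rewrite /density_pushforward /=.
have [ba|ab] := leP b a.
  by rewrite set_itv_ge ?bnd_simp -?leNgt// preimage_set0 integral_set0 measure0.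
have [b0|b0] := leP b 0; first by rewrite inversion_neg.

have U c d e : c <= d -> d < e ->
  (\int[mu]_(x in phi @^-1` `]c, e]) (J x)%:E =
  \int[mu]_(x in phi @^-1` `]c, d]) (J x)%:E +
  \int[mu]_(x in phi @^-1` `]d, e]) (J x)%:E)%E.
  move=> cd de; rewrite -ge0_integral_setU//.
  - rewrite -preimage_setU -itv_bndbnd_setU// ?bnd_simp//; exact/ltW.
  - by rewrite -[X in measurable X]setTI; exact: mphi.
  - by rewrite -[X in measurable X]setTI; exact: mphi.
  - exact/measurable_EFinP/measurable_funTS.
  - by move=> x _; rewrite lee_fin.
  - rewrite disj_set2E -preimage_setI; apply/eqP.
    rewrite (_ : _ `&` _ = set0) ?preimage_set0//; rewrite -subset0 => x /=.
    by rewrite !in_itv/= => -[/andP[_ xd] /andP[]]; rewrite ltNge xd.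
rewrite lebesgue_measure_itv/= lte_fin ab.
have [a0|a0] := leP a 0.
  rewrite (U a 0 b)// inversion_neg// inversion_pos0// lebesgue_measure_itv/=.
  by rewrite lte_fin; case: ltgtP a0 => // [a0 _|-> _]; rewrite ?add0e ?sub0r -?EFinD;
    congr _%:E; ring.
have := U 0 a b (ltW a0) ab; rewrite !inversion_pos0// => ->.
by rewrite addeAC subee// add0e.
Qed.

Lemma ge0_integral_inversion g :
  measurable_fun setT g -> (forall x, (0 <= g x)%E) ->
  (\int[mu]_x (g (x^-1)%R * (x ^- 2)%:E) = \int[mu]_x g x)%E.
Proof.
move=> mg g0.
have split0 h : measurable_fun setT h -> (forall x, (0 <= h x)%E) ->
  (\int[mu]_x h x = \int[mu]_(x in `]0%R, +oo[) h x +
                    \int[mu]_(x in `]0%R, +oo[) h (- x)%R)%E.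
  move=> mh h0.
  have -> : [set: R] = `]-oo, 0%R]%classic `|` `]0%R, +oo[%classic.
    by rewrite -(setvU `]0%R, +oo[%classic) setCitvr.
  rewrite ge0_integral_setU//=; first last.
  - apply/disj_setPS => x /=; rewrite !in_itv/= andbT => -[x0].
    by rewrite ltNge x0.
  - exact: measurable_funTS.
  rewrite addeC; congr (_ + _)%E.
  have mhN : measurable_fun setT (fun x : R => h (- x)).
    by apply: (measurableT_comp mh); exact: measurable_funN.
  rewrite (@integral_itv_obnd_cbnd _ _ _ (fun x => h (- x))); last exact: measurable_funTS.
  rewrite (@ge0_integration_by_substitution0 R (fun x => h (- x)))//.
  by apply: eq_integral => x _; rewrite opprK.
have mg1 : measurable_fun setT (fun x : R => g (x^-1)%R * (x ^- 2)%:E)%E.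
  apply: emeasurable_funM; first by apply: (measurableT_comp mg); exact: measurable_funV.
  by apply/measurable_EFinP; apply: measurable_funV; exact: measurable_funX.
rewrite split0//; last by move=> x; rewrite mule_ge0// lee_fin invr_ge0 sqr_ge0.
rewrite [RHS]split0//; congr (_ + _)%E; first exact: ge0_integral_inversion_pos.
rewrite -[RHS]ge0_integral_inversion_pos//; last first.
  by apply: (measurableT_comp mg); exact: measurable_funN.
by apply: eq_integral => x _; rewrite invrN sqrrN.
Qed.

End line_substitution.

(** * Complex modulus and measurability *)

Set Implicit Arguments.
Unset Strict Implicit.
Unset Printing Implicit Defensive.

Notation Re := (@complex.Re _).
Notation Im := (@complex.Im _).

Section complex_basics.
Context {R : realType}.
Implicit Types z : R[i].

Lemma normc_sq z : normc z ^+ 2 = Re z ^+ 2 + Im z ^+ 2.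
Proof. by case: z => a b /=; rewrite sqr_sqrtr// addr_ge0 ?sqr_ge0. Qed.

Lemma normc_ge0 z : 0 <= normc z.
Proof. by case: z => a b /=; exact: sqrtr_ge0. Qed.

Lemma normc_eq0 z : (normc z == 0) = (z == 0).
Proof.
apply/eqP/eqP => [/ComplexField.Normc.eq0_normc//|->].
by rewrite ComplexField.Normc.normc0.
Qed.

Lemma normc_gt0 z : (0 < normc z) = (z != 0).
Proof. by rewrite lt_neqAle normc_ge0 andbT eq_sym normc_eq0. Qed.

Lemma normc_conj z : normc (conjc z) = normc z.
Proof. by case: z => a b /=; rewrite sqrrN. Qed.

Lemma normc_real (a : R) : normc (a%:C)%C = `|a|.
Proof. by rewrite /= expr0n addr0 sqrtr_sqr. Qed.

Lemma normcM z1 z2 : normc (z1 * z2) = normc z1 * normc z2.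
Proof. exact: ComplexField.Normc.normcM. Qed.

Lemma normcV z : normc z^-1 = (normc z)^-1.
Proof. exact: ComplexField.Normc.normcV. Qed.

Lemma normcX z n : normc (z ^+ n) = normc z ^+ n.
Proof.
elim: n => [|n IH]; first by rewrite !expr0 ComplexField.Normc.normc1.
by rewrite !exprS normcM IH.
Qed.

Lemma normc1 : normc (1 : R[i]) = 1.
Proof. exact: ComplexField.Normc.normc1. Qed.

Lemma Re_le_normc z : `|Re z| <= normc z.
Proof.
rewrite -(ler_pXn2r (n := 2)) ?nnegrE ?normc_ge0//.
by rewrite real_normK ?num_real// normc_sq lerDl sqr_ge0.
Qed.

Lemma Im_le_normc z : `|Im z| <= normc z.
Proof.
rewrite -(ler_pXn2r (n := 2)) ?nnegrE ?normc_ge0//.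
by rewrite real_normK ?num_real// normc_sq lerDr sqr_ge0.
Qed.

Lemma normc_le_ReIm z : normc z <= `|Re z| + `|Im z|.
Proof.
rewrite -(ler_pXn2r (n := 2)) ?nnegrE ?normc_ge0 ?addr_ge0//.
rewrite normc_sq sqrrD !real_normK ?num_real//.
by rewrite addrAC lerDl mulrn_wge0// mulr_ge0.
Qed.

Lemma mulc_conj z : z * conjc z = ((normc z ^+ 2)%:C)%C.
Proof.
by rewrite normc_sq; case: z => a b /=; apply/eqP; rewrite eq_complex /=;
  apply/andP; split; apply/eqP; ring.
Qed.

Lemma conjc_mul z1 z2 : conjc (z1 * z2) = conjc z1 * conjc z2.
Proof. exact: rmorphM. Qed.

Lemma ReE_mul z1 z2 : Re (z1 * z2) = Re z1 * Re z2 - Im z1 * Im z2.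
Proof. by case: z1; case: z2. Qed.

Lemma ImE_mul z1 z2 : Im (z1 * z2) = Re z1 * Im z2 + Im z1 * Re z2.
Proof. by case: z1; case: z2. Qed.

Lemma ReE_add z1 z2 : Re (z1 + z2) = Re z1 + Re z2.
Proof. by case: z1; case: z2. Qed.

Lemma ImE_add z1 z2 : Im (z1 + z2) = Im z1 + Im z2.
Proof. by case: z1; case: z2. Qed.

Lemma ReE_inv z : Re z^-1 = Re z / (Re z ^+ 2 + Im z ^+ 2).
Proof. by case: z. Qed.

Lemma ImE_inv z : Im z^-1 = - (Im z / (Re z ^+ 2 + Im z ^+ 2)).
Proof. by case: z. Qed.

End complex_basics.

Section complex_measurability.
Context {R : realType} {d : measure_display} {T : measurableType d}.
Implicit Types (D : set T) (f g : T -> R[i]).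

Lemma measurable_Re : measurable_fun [set: R[i]] (@complex.Re R).
Proof.
move=> _ A mA; rewrite setTI /measurable/= /complex_measurable/=.
by rewrite (_ : _ @^-1` _ = fst @^-1` A)// -[X in measurable X]setTI; exact: measurable_fst.
Qed.

Lemma measurable_Im : measurable_fun [set: R[i]] (@complex.Im R).
Proof.
move=> _ A mA; rewrite setTI /measurable/= /complex_measurable/=.
by rewrite (_ : _ @^-1` _ = snd @^-1` A)// -[X in measurable X]setTI; exact: measurable_snd.
Qed.

Lemma measurable_fun_Re D f : measurable_fun D f ->
  measurable_fun D (fun x => Re (f x)).
Proof. by move=> mf; exact: (measurableT_comp measurable_Re mf). Qed.

Lemma measurable_fun_Im D f : measurable_fun D f ->
  measurable_fun D (fun x => Im (f x)).
Proof. by move=> mf; exact: (measurableT_comp measurable_Im mf). Qed.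

Lemma measurable_fun_ReIm D f : measurable_fun D (fun x => Re (f x)) ->
  measurable_fun D (fun x => Im (f x)) -> measurable_fun D f.
Proof.
move=> mr mi mD; have : measurable_fun D (fun x => (Re (f x), Im (f x))).
  have gen E : measurable E -> measurable_fun E (fun x => Re (f x)) ->
      measurable_fun E (fun x => Im (f x)) ->
      measurable_fun E (fun x => (Re (f x), Im (f x))).
    move=> mE mr' mi'.
    apply/(measurable_restrictT (fun x => (Re (f x), Im (f x))) mE).
    rewrite (_ : _ \_ _ = (fun x => (((fun x => Re (f x)) \_ E) x,
                                   ((fun x => Im (f x)) \_ E) x))); last first.
      by apply/funext => x; rewrite !patchE; case: ifP.
    by apply: measurable_fun_pair; apply/(measurable_restrictT _ mE).
  exact: gen.
move=> mp A mA; have := mp mD _ mA.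
congr measurable; apply/seteqP; split => x /= [Dx]; rewrite /complex_of_pair/=;
  by case: (f x).
Qed.

Lemma measurable_funcD D f g : measurable_fun D f -> measurable_fun D g ->
  measurable_fun D (fun x => f x + g x).
Proof.
move=> mf mg; apply: measurable_fun_ReIm.
  under eq_fun do rewrite ReE_add.
  by apply: measurable_funD; exact: measurable_fun_Re.
under eq_fun do rewrite ImE_add.
by apply: measurable_funD; exact: measurable_fun_Im.
Qed.

Lemma measurable_funcM D f g : measurable_fun D f -> measurable_fun D g ->
  measurable_fun D (fun x => f x * g x).
Proof.
move=> mf mg; apply: measurable_fun_ReIm.
  under eq_fun do rewrite ReE_mul.
  by apply: measurable_funB; apply: measurable_funM;
    (exact: measurable_fun_Re || exact: measurable_fun_Im).
under eq_fun do rewrite ImE_mul.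
by apply: measurable_funD; apply: measurable_funM;
  (exact: measurable_fun_Re || exact: measurable_fun_Im).
Qed.

Lemma measurable_funcN D f : measurable_fun D f ->
  measurable_fun D (fun x => - f x).
Proof.
move=> mf; under eq_fun do rewrite -mulN1r.
by apply: measurable_funcM => //; exact: measurable_cst.
Qed.

Lemma measurable_funcB D f g : measurable_fun D f -> measurable_fun D g ->
  measurable_fun D (fun x => f x - g x).
Proof. by move=> mf mg; apply: measurable_funcD => //; exact: measurable_funcN. Qed.

Lemma measurable_funcV D f : measurable_fun D f ->
  measurable_fun D (fun x => (f x)^-1).
Proof.
move=> mf; have mr := measurable_fun_Re mf; have mi := measurable_fun_Im mf.
have m2 : measurable_fun D (fun x => (Re (f x) ^+ 2 + Im (f x) ^+ 2)^-1).
  by apply: measurable_funV; apply: measurable_funD; exact: measurable_funX.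
apply: measurable_fun_ReIm.
  by under eq_fun do rewrite ReE_inv; exact: measurable_funM.
under eq_fun do rewrite ImE_inv.
by apply: measurable_funN; exact: measurable_funM.
Qed.

Lemma measurable_funcX D f n : measurable_fun D f ->
  measurable_fun D (fun x => f x ^+ n).
Proof.
move=> mf; elim: n => [|n IH].
  by under eq_fun do rewrite expr0; exact: measurable_cst.
by under eq_fun do rewrite exprS; exact: measurable_funcM.
Qed.

Lemma measurable_fun_conjc D f : measurable_fun D f ->
  measurable_fun D (fun x => conjc (f x)).
Proof.
move=> mf; apply: measurable_fun_ReIm.
  rewrite (_ : (fun _ => _) = (fun x => Re (f x))); first exact: measurable_fun_Re.
  by apply/funext => x; case: (f x).
rewrite (_ : (fun _ => _) = (fun x => - Im (f x))).
  by apply: measurable_funN; exact: measurable_fun_Im.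
by apply/funext => x; case: (f x).
Qed.

Lemma measurable_fun_normc D f : measurable_fun D f ->
  measurable_fun D (fun x => normc (f x)).
Proof.
move=> mf; rewrite (_ : (fun _ => _) =
  (fun x => Num.sqrt (Re (f x) ^+ 2 + Im (f x) ^+ 2))); last first.
  by apply/funext => x; case: (f x).
have mS : measurable_fun [set: R] (@Num.sqrt R).
  by apply: continuous_measurable_fun; exact: sqrt_continuous.
apply: (measurableT_comp mS); apply: measurable_funD; apply: measurable_funX.
  exact: measurable_fun_Re.
exact: measurable_fun_Im.
Qed.

Lemma measurable_fun_realC D (f : T -> R) : measurable_fun D f ->
  measurable_fun D (fun x => ((f x)%:C)%C).
Proof.
by move=> mf; apply: measurable_fun_ReIm => //=; exact: measurable_cst.
Qed.

Lemma measurable_fun_Complex D (f g : T -> R) : measurable_fun D f ->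
  measurable_fun D g -> measurable_fun D (fun x => Complex (f x) (g x)).
Proof. by move=> mf mg; apply: measurable_fun_ReIm. Qed.

End complex_measurability.

(** Closes measurability goals for functions built from measurable ones by
    real and complex arithmetic. *)
Ltac meas_lambda :=
match goal with
| |- _ => solve [assumption]
| |- measurable_fun _ (fun x => complex.Re _) => apply: measurable_fun_Re
| |- measurable_fun _ (fun x => complex.Im _) => apply: measurable_fun_Im
| |- measurable_fun _ (fun x => conjc _) => apply: measurable_fun_conjc
| |- measurable_fun _ (fun x => normc _) => apply: measurable_fun_normc
| |- measurable_fun _ (fun x => real_complex_def _ _) => apply: measurable_fun_realC
| |- measurable_fun _ (fun x => Complex _ _) => apply: measurable_fun_Complex
| |- measurable_fun _ (fun x => (_ + - _)%R) =>
  first [apply: measurable_funcB | apply: measurable_funB]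
| |- measurable_fun _ (fun x => (_ + _)%R) =>
  first [apply: measurable_funcD | apply: measurable_funD]
| |- measurable_fun _ (fun x => (- _)%R) =>
  first [apply: measurable_funcN | apply: measurable_funN]
| |- measurable_fun _ (fun x => (_ * _)%R) =>
  first [apply: measurable_funcM | apply: measurable_funM]
| |- measurable_fun _ (fun x => (_ ^-1)%R) =>
  first [apply: measurable_funcV | apply: measurable_funV]
| |- measurable_fun _ (fun x => (_ ^+ _)%R) =>
  first [apply: measurable_funcX | apply: measurable_funX]
| |- measurable_fun _ (fun x => `| _ |%R) =>
  apply: (measurableT_comp (@normr_measurable _ _))
| |- measurable_fun _ (fun x => fst x) => exact: measurable_fst
| |- measurable_fun _ (fun x => snd x) => exact: measurable_snd
| |- _ => solve [exact: measurable_cst | exact: measurable_id]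
end.

Ltac meas_step :=
  lazymatch goal with
  | |- measurable_fun _ (fun x => x) => exact: measurable_id
  | |- measurable_fun _ (fun x => _) => meas_lambda
  | |- measurable_fun ?D ?f =>
    first [ solve [assumption | exact: measurable_fst | exact: measurable_snd
                  | exact: measurable_id | exact: measurable_cst]
          | change (measurable_fun D (fun x => f x)); cbv beta; meas_lambda ]
  end.
Ltac meas := repeat meas_step.

(** * Planar changes of variables *)

Section planar_substitution.
Context {R : realType}.
Notation mu := (@lebesgue_measure R).
Notation area := (@area R).
Implicit Types (g : R[i] -> \bar R) (G : R -> R -> \bar R) (T : R[i] -> R[i]).

Lemma measurable_fun_Complex2 g : measurable_fun setT g ->
  measurable_fun [set: R * R] (fun p => g (Complex p.1 p.2)).
Proof. by move=> mg; apply: (measurableT_comp mg); meas. Qed.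

Lemma ge0_integral_area g : measurable_fun setT g -> (forall x, (0 <= g x)%E) ->
  (\int[area]_z g z = \int[mu]_x \int[mu]_y g (Complex x y))%E.
Proof.
move=> mg g0.
have mcp : measurable_fun [set: measurableTypeR R * measurableTypeR R]
  (@complex_of_pair R) := @measurable_complex_of_pair R.
have E := @ge0_integral_pushforward _ _ _ _ _ _ mcp (mu \x mu)%E setT g.
etransitivity; first by apply: E.
rewrite preimage_setT.
apply: (@fubini_tonelli1 _ _ _ _ _ mu mu (g \o @complex_of_pair R)) => //.
by move=> p; exact: g0.
Qed.

Lemma lebesgue_tonelli G : measurable_fun [set: R * R] (fun p => G p.1 p.2) ->
  (forall x y, (0 <= G x y)%E) ->
  (\int[mu]_x \int[mu]_y G x y = \int[mu]_y \int[mu]_x G x y)%E.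
Proof.
by move=> mG G0; exact: (@fubini_tonelli _ _ _ _ _ mu mu (fun p => G p.1 p.2)).
Qed.

Lemma measurable_lebesgue_section G : measurable_fun [set: R * R] (fun p => G p.1 p.2) ->
  (forall x y, (0 <= G x y)%E) -> measurable_fun setT (fun x => \int[mu]_y G x y)%E.
Proof.
move=> mG G0.
exact: (@measurable_fun_fubini_tonelli_F _ _ _ _ _ mu (fun p => G p.1 p.2) mG (fun p => G0 p.1 p.2)).
Qed.

Lemma integral_eq_off (r : R) (g h : R -> \bar R) :
  measurable_fun setT g -> measurable_fun setT h ->
  (forall x, x != r -> g x = h x) -> (\int[mu]_x g x = \int[mu]_x h x)%E.
Proof.
move=> mg mh gh.
have mr : measurable ([set: R] `\ r) by apply: measurableD.
rewrite -(integral_setD1 mr); last exact: measurable_funTS.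
rewrite -[RHS](integral_setD1 mr); last exact: measurable_funTS.
by apply: eq_integral => x; rewrite inE/= => -[_ /eqP]; exact: gh.
Qed.

(** The Jacobian enters as a density: points where it vanishes may be mapped
    anywhere, which absorbs the singularities of T and lets such maps compose. *)
Definition area_substitution T (J : R[i] -> R) :=
  [/\ measurable_fun setT T, measurable_fun setT J, (forall x, 0 <= J x) &
   forall g, measurable_fun setT g -> (forall x, (0 <= g x)%E) ->
    (\int[area]_x (g (T x) * (J x)%:E) = \int[area]_x g x)%E].

Lemma area_substitution_comp T1 J1 T2 J2 :
  area_substitution T1 J1 -> area_substitution T2 J2 ->
  area_substitution (T1 \o T2) (fun x => J1 (T2 x) * J2 x).
Proof.
move=> [mT1 mJ1 J10 H1] [mT2 mJ2 J20 H2].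
have mJ12 : measurable_fun setT (fun x => J1 (T2 x)) by exact: (measurableT_comp mJ1 mT2).
split.
- exact: measurableT_comp.
- by meas.
- by move=> x; rewrite mulr_ge0.
move=> g mg g0; rewrite -[RHS]H1// -[RHS]H2.
- by apply: eq_integral => x _; rewrite EFinM muleA.
- apply: emeasurable_funM; first exact: (measurableT_comp mg).
  exact/measurable_EFinP.
- by move=> x; rewrite mule_ge0// lee_fin.
Qed.

Lemma area_translation (b : R[i]) : area_substitution (fun x => x + b) (cst 1).
Proof.
split => //; first by meas.
move=> g mg g0.
have mgb : measurable_fun [set: R[i]] (fun x => g (x + b)%R) by apply: (measurableT_comp mg); meas.
under eq_integral do rewrite mule1.
rewrite (ge0_integral_area mg g0) (ge0_integral_area mgb (fun x => g0 _)).
pose h x := (\int[mu]_y g (Complex x y))%E.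
have mh : measurable_fun setT h.
  apply: (@measurable_lebesgue_section (fun a b => g (Complex a b))).
    exact: (measurable_fun_Complex2 mg).
  by move=> *; exact: g0.
rewrite -(@ge0_integral_affine _ h 1 (Re b))//; last first.
  by move=> x; apply: integral_ge0 => y _.
apply: eq_integral => x _; rewrite normr1 mule1 mul1r /h.
rewrite -(@ge0_integral_affine _ (fun y => g (Complex (x + Re b)%R y)) 1 (Im b))//; last first.
  by apply: (measurableT_comp mg); meas.
apply: eq_integral => y _; rewrite normr1 mule1 mul1r; congr (g _).
by case: (b).
Qed.

(** Multiplication by al + i be is a product of two shears: each step is an
    affine substitution in one real coordinate. When al = 0 the coordinates
    are exchanged instead. *)
Lemma area_multiplication (a : R[i]) : a != 0 ->
  area_substitution (fun x => a * x) (cst (normc a ^+ 2)).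
Proof.
move=> a0; split => //; first by meas.
  by move=> x; rewrite sqr_ge0.
move=> g mg g0.
have mga : measurable_fun setT (fun x => g (a * x)%R * (normc a ^+ 2)%:E)%E.
  apply: emeasurable_funM; first by apply: (measurableT_comp mg); meas.
  exact: measurable_cst.
have n0 : 0 < normc a ^+ 2 by rewrite exprn_gt0// normc_gt0.
rewrite (ge0_integral_area mga); last by move=> x; rewrite mule_ge0// lee_fin ltW.
rewrite (ge0_integral_area mg g0).
have [N NE0] : exists N, N = normc a ^+ 2 by exists (normc a ^+ 2).
have nE : N = Re a ^+ 2 + Im a ^+ 2 by rewrite NE0 normc_sq.
rewrite -NE0 /= in n0 mga *; move: nE {NE0 a0}; case: a mga => al be mga /= nE.
have mN (G : R * R -> R[i]) : measurable_fun setT G -> measurable_fun setT (fun p => g (G p)).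
  by move=> mG; exact: (measurableT_comp mg).
have mN1 (G : R -> R[i]) : measurable_fun setT G -> measurable_fun setT (fun p => g (G p)).
  by move=> mG; exact: (measurableT_comp mg).
have [al0|al0] := eqVneq al 0.
  have be0 : be != 0.
    by apply: contraTN n0 => /eqP be0; rewrite nE al0 be0 expr0n/= addr0 ltxx.
  have NE : N = `|be| * `|be| by rewrite nE al0 expr0n/= add0r -expr2 real_normK ?num_real.
  transitivity (\int[mu]_x \int[mu]_u (g (Complex u (be * x)%R) * `|be|%:E))%E.
    apply: eq_integral => x _.
    rewrite -(@ge0_integral_affine _ (fun u => g (Complex u (be * x)%R) * `|be|%:E)%E (- be) 0) ?oppr_eq0//.
    - apply: eq_integral => y _; rewrite normrN -muleA -EFinM -NE.
      by congr (g _ * _)%E; apply/eqP; rewrite eq_complex/= al0; apply/andP; split; apply/eqP; ring.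
    - by apply: emeasurable_funM => //; apply: mN1; meas.
    - by move=> y; rewrite mule_ge0.
  rewrite lebesgue_tonelli; last 2 first.
  - by apply: emeasurable_funM => //; apply: mN; meas.
  - by move=> x y; rewrite mule_ge0.
  apply: eq_integral => u _.
  rewrite -(@ge0_integral_affine _ (fun v => g (Complex u v)) be 0)//.
    by apply: eq_integral => y _; rewrite addr0.
  by apply: mN1; meas.
have ka0 : N / al != 0 by exact: (mulf_neq0 (lt0r_neq0 n0) (invr_neq0 al0)).
transitivity (\int[mu]_y \int[mu]_x (g (Complex (al * x - be * y)%R (be * x + al * y)%R) * N%:E))%E.
  rewrite lebesgue_tonelli.
  - apply: eq_integral => y _; apply: eq_integral => x _; congr (g _ * _)%E.
    by apply/eqP; rewrite eq_complex/=; apply/andP; split; apply/eqP; ring.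
  - by apply: emeasurable_funM => //; apply: mN; meas.
  - by move=> x y; rewrite mule_ge0// lee_fin ltW.
transitivity (\int[mu]_y \int[mu]_u (g (Complex u (be / al * u + N / al * y)%R) * `|N / al|%:E))%E.
  apply: eq_integral => y _.
  rewrite -(@ge0_integral_affine _ (fun u => g (Complex u (be / al * u + N / al * y)%R) * `|N / al|%:E)%E al (- be * y))//.
  - apply: eq_integral => x _; rewrite -muleA -EFinM -normrM divfK// (gtr0_norm n0).
    congr (g _ * _)%E.
    by apply/eqP; rewrite eq_complex/=; apply/andP; split; apply/eqP; rewrite ?nE; field.
  - by apply: emeasurable_funM => //; apply: mN1; meas.
  - by move=> x; rewrite mule_ge0.
rewrite lebesgue_tonelli; last 2 first.
- by apply: emeasurable_funM => //; apply: mN; meas.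
- by move=> x y; rewrite mule_ge0.
apply: eq_integral => u _.
rewrite -(@ge0_integral_affine _ (fun v => g (Complex u v)) (N / al) (be / al * u))//.
  by apply: eq_integral => y _; rewrite addrC.
by apply: mN1; meas.
Qed.

(** In the coordinates (x, m) of the point x (1 + i m), the inversion sends
    (x, m) to (1 / (x (1 + m^2)), - m), a one-dimensional inversion followed
    by a dilation for each slope m. *)
Lemma area_inversion :
  area_substitution (fun x => x^-1) (fun x => normc x ^- 4).
Proof.
split; [by meas|by meas|by move=> x; rewrite invr_ge0 exprn_ge0// normc_ge0|].
move=> g mg g0.
have mg1 : measurable_fun [set: R[i]] (fun x => g (x^-1)%R * (normc x ^- 4)%:E)%E.
  apply: emeasurable_funM; first by apply: (measurableT_comp mg); meas.
  by apply/measurable_EFinP; meas.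
have mN (G : R * R -> R[i]) : measurable_fun setT G -> measurable_fun setT (fun p => g (G p)).
  by move=> mG; exact: (measurableT_comp mg).
have mN1 (G : R -> R[i]) : measurable_fun setT G -> measurable_fun setT (fun p => g (G p)).
  by move=> mG; exact: (measurableT_comp mg).
rewrite (ge0_integral_area mg1); last first.
  by move=> x; rewrite mule_ge0// lee_fin invr_ge0 exprn_ge0// normc_ge0.
rewrite (ge0_integral_area mg g0).
have D0 (m : R) : 0 < 1 + m ^+ 2 by rewrite ltr_pwDl// sqr_ge0.
pose K x m : \bar R := (g (Complex ((1 + m ^+ 2)^-1 * x^-1)%R (- m * ((1 + m ^+ 2)^-1 * x^-1))%R)
   * (((1 + m ^+ 2)^-1 ^+ 2 * `|x^-1|) * x ^- 2)%:E)%E.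
have mK : measurable_fun setT (fun p => K p.1 p.2).
  by apply: emeasurable_funM; [apply: mN; meas|apply/measurable_EFinP; meas].
have K0 x m : (0 <= K x m)%E.
  rewrite mule_ge0// lee_fin; apply: mulr_ge0; last by rewrite invr_ge0 sqr_ge0.
  by rewrite mulr_ge0// sqr_ge0.
transitivity (\int[mu]_x \int[mu]_m K x m)%E.
  apply: (@integral_eq_off 0).
  - apply: (@measurable_fun_fubini_tonelli_F _ _ _ _ _ mu (fun p => g ((Complex p.1 p.2)^-1)%R * (normc (Complex p.1 p.2) ^- 4)%:E)%E) => //.
    by move=> p; rewrite mule_ge0// lee_fin invr_ge0 exprn_ge0// normc_ge0.
  - exact: (@measurable_fun_fubini_tonelli_F _ _ _ _ _ mu (fun p => K p.1 p.2)).
  move=> x x0.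
  rewrite -(@ge0_integral_affine _ (fun y => g ((Complex x y)^-1)%R * (normc (Complex x y) ^- 4)%:E)%E x 0)//; last 2 first.
  - by apply: emeasurable_funM; [apply: mN1; meas|apply/measurable_EFinP; meas].
  - by move=> y; rewrite mule_ge0// lee_fin invr_ge0 exprn_ge0// normc_ge0.
  apply: eq_integral => m _; rewrite -muleA -EFinM /K addr0.
  have n2 : normc (Complex x (x * m)) ^+ 2 = x ^+ 2 * (1 + m ^+ 2).
    by rewrite normc_sq/=; ring.
  have n3 : x ^+ 2 + (x * m) ^+ 2 = x ^+ 2 * (1 + m ^+ 2) by ring.
  have m1 := lt0r_neq0 (D0 m).
  congr (g _ * _%:E)%E.
    apply/eqP; rewrite eq_complex/=; apply/andP; split; apply/eqP.
      by rewrite n3; field; rewrite ?m1 ?x0.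
    by rewrite n3; field; rewrite ?m1 ?x0.
  rewrite (exprM _ 2 2) n2 -[in LHS](real_normK (num_real x)) -[in RHS](real_normK (num_real x)) normrV ?unitfE//.
  by field; rewrite ?m1 ?normr_eq0 ?x0.
rewrite (lebesgue_tonelli mK K0).
transitivity (\int[mu]_m \int[mu]_v (g (Complex v (- m * v)%R) * `|v|%:E))%E.
  apply: eq_integral => m _; have m1 := lt0r_neq0 (D0 m).
  pose h u := (g (Complex ((1 + m ^+ 2)^-1 * u)%R (- m * ((1 + m ^+ 2)^-1 * u))%R)
   * (((1 + m ^+ 2)^-1 ^+ 2 * `|u|))%:E)%E.
  have mh : measurable_fun setT h.
    by apply: emeasurable_funM; [apply: mN1; meas|apply/measurable_EFinP; meas].
  have h0 u : (0 <= h u)%E by rewrite mule_ge0// lee_fin mulr_ge0// exprn_ge0// invr_ge0 ltW.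
  transitivity (\int[mu]_u h u)%E.
    rewrite -[RHS]ge0_integral_inversion//; apply: eq_integral => x _.
    by rewrite /K /h -muleA -EFinM.
  rewrite -(@ge0_integral_affine _ (fun v => g (Complex v (- m * v)%R) * `|v|%:E)%E (1 + m ^+ 2)^-1 0) ?invr_eq0//.
  - apply: eq_integral => u _; rewrite /h addr0 -muleA -EFinM normrM; congr (_ * _%:E)%E.
    by rewrite gtr0_norm ?invr_gt0//; ring.
  - by apply: emeasurable_funM; [apply: mN1; meas|apply/measurable_EFinP; meas].
  - by move=> v; rewrite mule_ge0.
rewrite lebesgue_tonelli; last 2 first.
- by apply: emeasurable_funM; [apply: mN; meas|apply/measurable_EFinP; meas].
- by move=> *; rewrite mule_ge0.
apply: (@integral_eq_off 0).
- apply: (@measurable_lebesgue_section (fun a b => g (Complex a (- b * a)%R) * `|a|%:E)%E).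
    by apply: emeasurable_funM; [apply: mN; meas|apply/measurable_EFinP; meas].
  by move=> a b; rewrite mule_ge0.
- apply: (@measurable_lebesgue_section (fun a b => g (Complex a b))).
    by apply: mN; meas.
  by move=> *; exact: g0.
move=> v v0.
rewrite -(@ge0_integral_affine _ (fun y => g (Complex v y)) (- v) 0) ?oppr_eq0//; last first.
  by apply: mN1; meas.
by apply: eq_integral => m _; rewrite normrN; congr (g (Complex _ _) * _)%E; ring.
Qed.

End planar_substitution.

(** * The normalized area measure of the disk *)

Section disk_measure.
Context {R : realType}.
Notation mu := (@lebesgue_measure R).
Notation D := (@disk R).

Lemma measurable_disk : measurable D.
Proof.
have mn : measurable_fun [set: R[i]] (fun z : R[i] => normc z) by meas.
have := mn measurableT `]-oo, 1[%classic (measurable_itv _).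
rewrite setTI; congr measurable; apply/seteqP; split => x /=; by rewrite in_itv.
Qed.

Lemma integral_abs_unit :
  (\int[mu]_u (if u ^+ 2 < 1 then `|u| else 0)%:E = 1%:E)%E.
Proof.
pose h (u : R) : R := if u ^+ 2 < 1 then `|u| else 0.
have mh : measurable_fun setT h.
  apply: measurable_fun_ifT; [|by meas|exact: measurable_cst].
  by apply: measurable_fun_ltr; [meas|exact: measurable_cst].
have h0 u : 0 <= h u by rewrite /h; case: ifP.
have hpos : (\int[mu]_(u in `[0%R, +oo[) (h u)%:E = (2^-1)%:E)%E.
  rewrite (_ : (2^-1)%:E = (1 ^+ 2 / 2)%:E - (0 ^+ 2 / 2)%:E)%E; last first.
    by rewrite -EFinB; congr _%:E; ring.
  rewrite -(@continuous_FTC2 _ id (fun x => x ^+ 2 / 2))//; last 3 first.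
  - by apply: continuous_subspaceT => x; exact: cvg_id.
  - have c (x : R) : (fun x : R => x ^+ 2 / 2) y @[y --> x] --> x ^+ 2 / 2.
      by apply: cvgMr_tmp; exact: exprn_continuous.
    split.
    + by move=> x _; apply: derivableM => //; exact: exprn_derivable.
    + by apply: cvg_at_right_filter; exact: c.
    + by apply: cvg_at_left_filter; exact: c.
  - move=> x _; rewrite derive1E deriveMr; last exact: exprn_derivable.
    by rewrite exp_derive/= expr1 /GRing.scale/= mulr1 mulrCA mulrA; field.
  rewrite [LHS]integral_mkcond [RHS]integral_mkcond.
  apply: (@integral_eq_off _ 1).
  - apply/(measurable_restrictT (fun x => (h x)%:E)) => //.
    by apply: measurable_funTS; exact/measurable_EFinP.
  - by apply/(measurable_restrictT (@EFin R)).
  move=> x x1.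
  rewrite !patchE !mem_setE !in_itv/= andbT.
  have [x0|x0]//= := leP 0 x; rewrite /h.
  rewrite expr_lt1//; case: ltgtP x1 => //= x1 _; by rewrite ger0_norm.
transitivity (\int[mu]_u (h u)%:E)%E => //.
have -> : [set: R] = `[0%R, +oo[%classic `|` `]-oo, 0%R[%classic.
  by rewrite -(setvU `[0%R, +oo[%classic) setCitvr setUC setUC.
rewrite ge0_integral_setU//=; last 3 first.
- exact/measurable_EFinP/measurable_funTS.
- by move=> x _; rewrite lee_fin.
- by apply/disj_setPS => x /=; rewrite !in_itv/= andbT => -[x0]; rewrite ltNge x0.
rewrite hpos (integral_itv_bndo_bndc); last exact/measurable_EFinP/measurable_funTS.
rewrite -[X in (_ + X)%E](_ : \int[mu]_(u in `[0%R, +oo[) (h u)%:E = _)%E.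
  by rewrite hpos -EFinD; congr _%:E; field.
rewrite ge0_integration_by_substitution0//; last exact/measurable_EFinP.
by apply: eq_integral => x _; rewrite /h sqrrN normrN.
Qed.

(** With the same slope coordinates, the abscissa integrates to 1 / (1 + m^2),
    and the integral of the latter over the line is pi. *)
Lemma area_disk : @area R disk = pi%:E.
Proof.
have mD := measurable_disk.
transitivity (\int[@area R]_z (\1_D z)%:E)%E.
  by rewrite integral_indic// setIT.
rewrite ge0_integral_area//; last exact/measurable_EFinP/measurable_indic.
have D0 (m : R) : 0 < 1 + m ^+ 2 by rewrite ltr_pwDl// sqr_ge0.
have DE (x y : R) : \1_D (Complex x y) = if x ^+ 2 + y ^+ 2 < 1 then 1 else 0 :> R.
  have -> : \1_D (Complex x y) = ((Complex x y) \in D)%:R :> R by rewrite indicE.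
  have -> : (Complex x y \in D) = (x ^+ 2 + y ^+ 2 < 1).
    have sq (u : R) : (Num.sqrt u < 1) = (u < 1) by rewrite -[in LHS]sqrtr1 ltr_sqrt.
    by apply/idP/idP; rewrite inE /disk/= sq.
  by case: ifP.
have mDC : measurable_fun setT (fun p : R * R => (\1_D (Complex p.1 p.2) : R)%:E).
  apply/measurable_EFinP; apply: (measurableT_comp (measurable_indic mD)); meas.
pose c (m : R) : R := (Num.sqrt (1 + m ^+ 2))^-1.
have c0 m : 0 < c m by rewrite invr_gt0 sqrtr_gt0.
have c2 m : c m ^+ 2 = (1 + m ^+ 2)^-1 by rewrite exprVn sqr_sqrtr// ltW.
pose K (x m : R) : R := if x ^+ 2 * (1 + m ^+ 2) < 1 then `|x| else 0.
have mK : measurable_fun setT (fun p : R * R => (K p.1 p.2)%:E).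
  apply/measurable_EFinP; apply: measurable_fun_ifT; [|by meas|exact: measurable_cst].
  by apply: measurable_fun_ltr; [meas|exact: measurable_cst].
have K0 x m : 0 <= K x m by rewrite /K; case: ifP.
transitivity (\int[mu]_x \int[mu]_m (K x m)%:E)%E.
  apply: (@integral_eq_off _ 0).
  - by apply: measurable_lebesgue_section => // x y; rewrite lee_fin.
  - by apply: measurable_lebesgue_section => // x y; rewrite lee_fin.
  move=> x x0.
  rewrite -(@ge0_integral_affine _ (fun y => (\1_D (Complex x y) : R)%:E) x 0)//; last first.
    apply/measurable_EFinP; apply: (measurableT_comp (measurable_indic mD)); meas.
  apply: eq_integral => m _; rewrite addr0 DE /K -EFinM; congr _%:E.
  rewrite exprMn -{1}[x ^+ 2]mulr1 -mulrDr; case: ifP; by rewrite ?mul1r ?mul0r.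
rewrite (lebesgue_tonelli mK); last by move=> *; rewrite lee_fin.
transitivity (\int[mu]_m ((oneDsqr m)^-1)%:E)%E.
  apply: eq_integral => m _.
  have mKm : measurable_fun setT (fun x : R => (K x m)%:E).
    apply/measurable_EFinP; apply: measurable_fun_ifT; [|by meas|exact: measurable_cst].
    by apply: measurable_fun_ltr; [meas|exact: measurable_cst].
  have Km0 x : (0 <= (K x m)%:E)%E by rewrite lee_fin.
  rewrite -(@ge0_integral_affine _ _ (c m) 0 _ mKm Km0) ?gt_eqF//.
  transitivity (\int[mu]_u ((oneDsqr m)^-1%:E * (if u ^+ 2 < 1 then `|u| else 0)%:E))%E.
    apply: eq_integral => u _; rewrite -!EFinM; congr _%:E.
    rewrite addr0 /K exprMn c2 mulrAC mulVf ?gt_eqF// mul1r normrM (gtr0_norm (c0 m)).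
    rewrite /oneDsqr -c2 expr2; case: ifP; rewrite ?mul0r ?mulr0// => _; ring.
  rewrite ge0_integralZl//.
  - by rewrite integral_abs_unit mule1.
  - apply/measurable_EFinP; apply: measurable_fun_ifT; [|by meas|exact: measurable_cst].
    by apply: measurable_fun_ltr; [meas|exact: measurable_cst].
  - by move=> u _; rewrite lee_fin; case: ifP.
rewrite (@ge0_symfun_integralT _ (fun m => (oneDsqr m)^-1)); last 3 first.
- by move=> x; rewrite invr_ge0 ltW// /oneDsqr.
- exact: continuous_oneDsqrV.
- by move=> x /=; rewrite /oneDsqr sqrrN.
rewrite (_ : [set x | _] = `[0, +oo[%classic); last first.
  by apply/seteqP; split => x /=; rewrite in_itv/= andbT.
by rewrite integral0y_oneDsqr -EFinM; congr _%:E; field.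
Qed.

Lemma dA_disk : @dA R disk = 1%E.
Proof.
rewrite /dA /mscale/= area_disk -EFinM mulVf// gt_eqF//; exact: pi_gt0.
Qed.

Lemma ge0_integral_dA (g : R[i] -> \bar R) : measurable_fun D g ->
  (forall x, D x -> 0 <= g x)%E ->
  (\int[dA]_(x in D) g x = (pi^-1)%:E * \int[@area R]_x (g \_ D) x)%E.
Proof.
move=> mg g0; rewrite /dA ge0_integral_mscale//; last exact: measurable_disk.
by rewrite [in LHS]integral_mkcond.
Qed.

(** A substitution that preserves the disk up to the null set of J. *)
Lemma ge0_integral_disk_substitution T J (g : R[i] -> \bar R) :
  area_substitution T J -> (forall x, J x != 0 -> D (T x) <-> D x) ->
  measurable_fun D g -> (forall x, D x -> 0 <= g x)%E ->
  (\int[dA]_(x in D) (g (T x) * (J x)%:E) = \int[dA]_(x in D) g x)%E.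
Proof.
move=> [mT mJ J0 H] HD mg g0.
have mgD : measurable_fun setT (g \_ D).
  by apply/(measurable_restrictT g) => //; exact: measurable_disk.
have gD0 x : (0 <= (g \_ D) x)%E.
  by rewrite patchE; case: ifPn => //; rewrite inE => /g0.
have E : (fun x => g (T x) * (J x)%:E)%E \_ D = (fun x => (g \_ D) (T x) * (J x)%:E)%E.
  apply/funext => x; rewrite !patchE.
  have [J1|J1] := eqVneq (J x) 0; first by rewrite J1 !mule0; case: ifP.
  have -> : (T x \in D) = (x \in D).
    by apply/idP/idP; rewrite !inE => /HD; exact.
  by case: ifP => _; rewrite ?mul0e.
have mE : measurable_fun setT ((fun x => g (T x) * (J x)%:E)%E \_ D).
  rewrite E; apply: emeasurable_funM; first exact: (measurableT_comp mgD).
  exact/measurable_EFinP.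
rewrite ge0_integral_dA ?[in RHS]ge0_integral_dA//.
- by rewrite E H.
- apply/(measurable_restrictT (fun x => g (T x) * (J x)%:E)%E) => //.
  exact: measurable_disk.
- move=> x Dx; have [J1|J1] := eqVneq (J x) 0; first by rewrite J1 mule0.
  by rewrite mule_ge0 ?lee_fin// g0//; apply/HD.
Qed.

Lemma integrable_disk_substitution T J (f : R[i] -> R) :
  area_substitution T J -> (forall x, J x != 0 -> D (T x) <-> D x) ->
  dA.-integrable D (EFin \o f) ->
  dA.-integrable D (fun x => (f (T x) * J x)%:E) /\
  \int[dA]_(x in D) (f (T x) * J x) = \int[dA]_(x in D) f x.
Proof.
move=> HT HD /integrableP[mf fi]; have [mT mJ J0 _] := HT.
have mD := @measurable_disk.
have mfD := (measurable_restrictT f mD).1 ((measurable_EFinP _ _).1 mf).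
have mfTJ : measurable_fun D (fun x => f (T x) * J x).
  apply/(measurable_restrictT _ mD).
  rewrite (_ : _ \_ D = (fun x => (f \_ D) (T x) * J x)).
    by apply: measurable_funM => //; exact: (measurableT_comp mfD).
  apply/funext => x; rewrite !patchE.
  have [J1|J1] := eqVneq (J x) 0; first by rewrite J1 !mulr0; case: ifP.
  have -> : (T x \in D) = (x \in D).
    by apply/idP/idP; rewrite !inE => /HD; exact.
  by case: ifP => _; rewrite ?mul0r.
have iTJ : dA.-integrable D (fun x => (f (T x) * J x)%:E).
  apply/integrableP; split; first exact/measurable_EFinP.
  rewrite (_ : (\int[dA]_(x in D) _)%E = (\int[dA]_(x in D) `|(EFin \o f) x|)%E)//.
  rewrite -(@ge0_integral_disk_substitution T J (fun x => `|(EFin \o f) x|)%E)//.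
  - apply: eq_integral => x _ /=; rewrite -EFinM normrM (ger0_norm (J0 x))//.
  - by apply: measurableT_comp.
split=> //; rewrite /Rintegral; congr fine.
rewrite integralE [RHS]integralE; congr (_ - _)%E.
- rewrite -[RHS](@ge0_integral_disk_substitution T J)//.
  + apply: eq_integral => x _; rewrite !funeposE -EFin_max /= -EFin_max -EFinM.
    by rewrite maxr_pMl// mul0r.
  + exact: measurable_funepos.
- rewrite -[RHS](@ge0_integral_disk_substitution T J)//.
  + apply: eq_integral => x _; rewrite !funenegE -EFin_max /= -EFin_max -EFinM.
    by rewrite maxr_pMl// mul0r mulNr.
  + exact: measurable_funeneg.
Qed.

End disk_measure.

(** * Moebius maps *)

Section mobius.
Context {R : realType}.
Implicit Types z x u : R[i].

Lemma normcB_ge (u v : R[i]) : normc u - normc v <= normc (u - v).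
Proof.
by rewrite lerBlDr -[X in normc X <= _](subrK v) le_normcD.
Qed.

Lemma normc1B_ge u : 1 - normc u <= normc (1 - u).
Proof. by rewrite -[X in X - _](normc1 (R := R)) normcB_ge. Qed.

Lemma sub1_neq0 u : normc u < 1 -> 1 - u != 0.
Proof. by move=> u1; rewrite -normc_gt0 (lt_le_trans _ (normc1B_ge u))// subr_gt0. Qed.

Lemma normcM_lt1 x z : disk x -> disk z -> normc (x * z) < 1.
Proof.
rewrite /disk/= normcM => x1 z1.
by rewrite mulr_ilt1// ?normc_ge0.
Qed.

Lemma disk_conj x : disk x -> disk (conjc x).
Proof. by rewrite /disk/= normc_conj. Qed.

Lemma disk_denom x z : disk x -> disk z -> 1 - conjc z * x != 0.
Proof. by move=> x1 z1; apply/sub1_neq0/normcM_lt1 => //; exact: disk_conj. Qed.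

Lemma one_sub_sq_gt0 z : disk z -> 0 < 1 - normc z ^+ 2.
Proof. by move=> z1; rewrite subr_gt0 expr_lt1// normc_ge0. Qed.

Lemma one_sub_sq_gt0E z : (0 < 1 - normc z ^+ 2) = (normc z < 1).
Proof. by rewrite subr_gt0 expr_lt1// normc_ge0. Qed.

(** The Schwarz-Pick identity. *)
Lemma mobius_norm z x : 1 - conjc z * x != 0 ->
  1 - normc (mobius z x) ^+ 2 =
  (1 - normc z ^+ 2) * (1 - normc x ^+ 2) / normc (1 - conjc z * x) ^+ 2.
Proof.
rewrite -normc_gt0 => d0.
rewrite /mobius normcM normcV exprMn exprVn.
apply: (mulIf (lt0r_neq0 (exprn_gt0 2 d0))).
rewrite mulrBl !mulfVK ?mul1r ?gt_eqF ?exprn_gt0//.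
by case: z {d0} => a b; case: x => c d; rewrite !normc_sq/=; ring.
Qed.

Lemma disk_mobius z x : disk z -> 1 - conjc z * x != 0 ->
  disk (mobius z x) <-> disk x.
Proof.
move=> z1 d0; rewrite /disk/= -!one_sub_sq_gt0E mobius_norm//.
rewrite pmulr_lgt0 ?invr_gt0 ?exprn_gt0 ?normc_gt0//.
by rewrite pmulr_rgt0// one_sub_sq_gt0.
Qed.

Lemma mobiusK z x : disk z -> disk x -> mobius z (mobius z x) = x.
Proof.
move=> z1 x1; have d0 := disk_denom x1 z1; have dz := disk_denom z1 z1.
have e : 1 - conjc z * mobius z x = (1 - conjc z * z) / (1 - conjc z * x).
  by rewrite /mobius; field.
rewrite {1}/mobius e /mobius; field; by rewrite d0 dz.
Qed.

Lemma mobius0 z : mobius z 0 = z.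
Proof. by rewrite /mobius mulr0 !subr0 divr1. Qed.

Lemma measurable_mobius z : measurable_fun setT (mobius z).
Proof. by rewrite /mobius; meas. Qed.

Definition mobius_jacobian z x : R :=
  (1 - normc z ^+ 2) ^+ 2 / normc (1 - conjc z * x) ^+ 4.

Lemma area_substitution_eq (T T' : R[i] -> R[i]) (J J' : R[i] -> R) :
  area_substitution T J -> measurable_fun setT T' -> J =1 J' ->
  (forall x, J x != 0 -> T' x = T x) -> area_substitution T' J'.
Proof.
move=> [mT mJ J0 H] mT' /funext <- TT'; split => // g mg g0.
rewrite -[RHS]H//; apply: eq_integral => x _.
by have [->|J1] := eqVneq (J x) 0; rewrite ?mule0// TT'.
Qed.

(** A Moebius map is a composition of affine maps and the inversion, except for
    z = 0, where it is x -> - x. *)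
Lemma area_substitution_mobius z : disk z ->
  area_substitution (mobius z) (mobius_jacobian z).
Proof.
move=> z1; have k0 := one_sub_sq_gt0 z1.
have [->|z0] := eqVneq z 0.
  apply: (@area_substitution_eq (fun x => -1 * x) _ (cst (normc (-1 : R[i]) ^+ 2))).
  - by apply: area_multiplication; rewrite oppr_eq0 oner_eq0.
  - exact: measurable_mobius.
  - move=> x; rewrite /mobius_jacobian conjc0 mul0r subr0 normc1.
    by rewrite normcN normc1 !expr1n ComplexField.Normc.normc0 expr0n/= subr0 expr1n divr1.
  - by move=> x _; rewrite /mobius conjc0 mul0r sub0r subr0 divr1 mulN1r.
have zc0 : conjc z != 0 by rewrite conjc_eq0.
have kc0 : 1 - z * conjc z != 0 :> R[i].
  by rewrite mulrC; apply: disk_denom.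
have c0 : - ((1 - z * conjc z) / conjc z) != 0.
  by rewrite oppr_eq0 mulf_neq0// invr_eq0.
have zcN0 : - conjc z != 0 by rewrite oppr_eq0.
have := area_substitution_comp (area_substitution_comp (area_substitution_comp
  (area_substitution_comp (area_translation (conjc z)^-1) (area_multiplication c0))
  area_inversion) (area_translation 1)) (area_multiplication zcN0).
move/area_substitution_eq; apply; first exact: measurable_mobius.
  move=> x /=; rewrite /mobius_jacobian !normcN normcM normcV normc_conj.
  rewrite mulc_conj mul1r !mulr1 (addrC _ 1) mulNr.
  have -> : normc (1 - ((normc z ^+ 2)%:C)%C) = 1 - normc z ^+ 2.
    rewrite (_ : 1 - _ = ((1 - normc z ^+ 2)%:C)%C); last by rewrite rmorphB.
    by rewrite normc_real gtr0_norm.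
  have nz0 : normc z != 0 by rewrite normc_eq0.
  have [->|d0] := eqVneq (normc (1 - conjc z * x)) 0; first by rewrite expr0n/= invr0 !(mulr0, mul0r).
  by field; rewrite nz0 d0.
move=> x /=; rewrite mulNr => J0.
have d0 : 1 - conjc z * x != 0.
  apply: contraNN J0 => /eqP d0.
  by rewrite (addrC _ 1) d0 ComplexField.Normc.normc0 expr0n/= invr0 !(mulr0, mul0r).
by rewrite /mobius (addrC _ 1); field; rewrite zc0 d0.
Qed.

Lemma mobius_jacobian_neq0 z x : mobius_jacobian z x != 0 -> 1 - conjc z * x != 0.
Proof.
apply: contraNN => /eqP d0; rewrite /mobius_jacobian d0.
by rewrite ComplexField.Normc.normc0 expr0n/= invr0 mulr0.
Qed.

Lemma integrable_mobius z (f : R[i] -> R) : disk z ->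
  dA.-integrable disk (EFin \o f) ->
  dA.-integrable disk (fun x => (f (mobius z x) * mobius_jacobian z x)%:E) /\
  \int[dA]_(x in disk) (f (mobius z x) * mobius_jacobian z x)
  = \int[dA]_(x in disk) f x.
Proof.
move=> z1; apply: integrable_disk_substitution.
  exact: area_substitution_mobius.
by move=> x /mobius_jacobian_neq0; exact: disk_mobius.
Qed.

Lemma integrable_rotation (e : R[i]) (f : R[i] -> R) : normc e = 1 ->
  dA.-integrable disk (EFin \o f) ->
  dA.-integrable disk (fun x => (f (e * x))%:E) /\
  \int[dA]_(x in disk) f (e * x) = \int[dA]_(x in disk) f x.
Proof.
move=> e1 fi; have e0 : e != 0 by rewrite -normc_eq0 e1 oner_eq0.
have HD x : cst (normc e ^+ 2) x != 0 -> disk (e * x) <-> disk x.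
  by move=> _; rewrite /disk/= normcM e1 mul1r.
have [i1 <-] := integrable_disk_substitution (area_multiplication e0) HD fi.
rewrite /= e1 expr1n in i1 *; split.
  by move: i1; apply: eq_integrable; [exact: measurable_disk|move=> x _; rewrite mulr1].
by apply: eq_Rintegral => x _; rewrite mulr1.
Qed.

End mobius.

(** * Goursat's theorem *)

Lemma derivable_expansion (K : numFieldType) (f : K^o -> K^o) (x : K) :
  derivable f x 1 -> forall e : K, 0 < e -> exists2 d : K, 0 < d &
  forall y : K, `|y - x| < d -> `|f y - f x - 'D_1 f x * (y - x)| <= e * `|y - x|.
Proof.
move=> df e e0; have /cvgrPdist_le/(_ e e0) : (fun k => k^-1 *: (f (k *: 1 + x) - f x)) k @[k --> 0^'] --> 'D_1 f x.
  exact: df.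
rewrite near_withinE => /nbhs_ballP[d /= d0 H]; exists d => // y yx.
have [->|yx0] := eqVneq y x; first by rewrite !subrr mulr0 subr0 normr0 mulr0.
have k0 : y - x != 0 by rewrite subr_eq0.
have := H (y - x); rewrite /ball/= sub0r normrN => /(_ yx k0).
rewrite /GRing.scale/= mulr1 subrK => He.
rewrite -ler_pdivrMr ?normr_gt0// -normfV -normrM mulrBl mulfK// distrC.
by rewrite (mulrC (f y - f x)).
Qed.

Section goursat.
Context {R : realType}.
Notation mu := (@lebesgue_measure R).

(** Joint differentiability subject to the Cauchy-Riemann equations; al + i be
    is the complex derivative. *)
Definition cauchy_riemann (u v : R -> R -> R) (s t : R) :=
  exists al be : R, forall e, 0 < e -> exists2 d, 0 < d & forall s' t',
    `|s' - s| < d -> `|t' - t| < d ->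
    `|u s' t' - u s t - (al * (s' - s) - be * (t' - t))| <= e * (`|s' - s| + `|t' - t|) /\
    `|v s' t' - v s t - (be * (s' - s) + al * (t' - t))| <= e * (`|s' - s| + `|t' - t|).

Definition itv_integral (f : R -> R) (a b : R) : R := \int[mu]_(x in `[a, b]) f x.

Definition itv_integrable (f : R -> R) (a b : R) := mu.-integrable `[a, b] (EFin \o f).

Lemma continuous_itv_integrable f a b : {within `[a, b], continuous f} ->
  itv_integrable f a b.
Proof. by move=> cf; apply: continuous_compact_integrable; first exact: segment_compact. Qed.

Lemma itv_integrableS f a b c d : a <= c -> d <= b -> itv_integrable f a b ->
  itv_integrable f c d.
Proof.
move=> ac db; apply: integrableS => //.
by apply: subset_itv; rewrite bnd_simp.
Qed.

Lemma itv_integrableB f g a b : itv_integrable f a b -> itv_integrable g a b ->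
  itv_integrable (fun x => f x - g x) a b.
Proof.
move=> fi gi; have mI : measurable (`[a, b]%classic : set (measurableTypeR R)) by exact: measurable_itv.
have := integrableB mI fi gi.
by apply: eq_integrable => // x _ /=; rewrite EFinB.
Qed.

Lemma itv_integral_split f a m b : itv_integrable f a b -> a <= m -> m <= b ->
  itv_integral f a b = itv_integral f a m + itv_integral f m b.
Proof.
move=> ii am mb.
rewrite /itv_integral -[X in _ + X](@Rintegral_itv_obnd_cbnd _ _ _ f); last first.
  apply: integrableS ii => //; apply: subset_itv; rewrite bnd_simp//.
have := @Rintegral_itvB _ f (BLeft a) (BRight b) m ii.
rewrite !bnd_simp => /(_ am mb) <-.
by rewrite addrC subrK.
Qed.

Lemma itv_integral_approx f a b (k e : R) : itv_integrable f a b -> a <= b ->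
  (forall x, a <= x <= b -> `|f x - k| <= e) ->
  `|itv_integral f a b - k * (b - a)| <= e * (b - a).
Proof.
move=> cf ab H.
have mab : (mu `[a, b] = (b - a)%:E)%E.
  rewrite lebesgue_measure_itv/= lte_fin; case: ltP ab => // ba ab.
  have -> : a = b by apply/le_anti; rewrite ab ba.
  by rewrite subrr.
have ic c : itv_integrable (cst c) a b.
  by apply: continuous_itv_integrable; apply: continuous_subspaceT => x; exact: cvg_cst.
have Ic c : \int[mu]_(x in `[a, b]) (cst c x) = c * (b - a).
  by rewrite Rintegral_cst//= mab.
have iB : mu.-integrable `[a, b] (EFin \o (fun x => f x - cst k x)).
  exact: itv_integrableB.
rewrite /itv_integral -Ic -RintegralB//; last exact: ic.
apply: (le_trans (le_normr_Rintegral _ iB)) => //.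
rewrite -Ic; apply: le_Rintegral => //.
- exact: integrable_norm iB.
- exact: ic.
Qed.

Section rectangle.
Variables u v : R -> R -> R.
Variables (a0 b0 c0 d0 : R).
Hypotheses (ab0 : a0 <= b0) (cd0 : c0 <= d0).
Hypothesis iu : forall s, a0 <= s <= b0 -> itv_integrable (u s) c0 d0.
Hypothesis iv : forall t, c0 <= t <= d0 -> itv_integrable (v ^~ t) a0 b0.
Hypothesis CR : forall s t, a0 <= s <= b0 -> c0 <= t <= d0 -> cauchy_riemann u v s t.

Let inside a b c d := [/\ a0 <= a, a <= b & b <= b0] /\ [/\ c0 <= c, c <= d & d <= d0].

(** The imaginary part of the contour integral of u + i v around a
    rectangle. *)
Let J a b c d := itv_integral (u b) c d - itv_integral (u a) c d
  - (itv_integral (v ^~ d) a b - itv_integral (v ^~ c) a b).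

Let iuS a b c d s : inside a b c d -> a <= s <= b -> itv_integrable (u s) c d.
Proof.
move=> [[h1 h2 h3] [h4 h5 h6]] /andP[as_ sb]; apply: itv_integrableS h4 h6 (iu _).
by rewrite (le_trans h1)// (le_trans sb).
Qed.

Let ivS a b c d t : inside a b c d -> c <= t <= d -> itv_integrable (v ^~ t) a b.
Proof.
move=> [[h1 h2 h3] [h4 h5 h6]] /andP[ct td]; apply: itv_integrableS h1 h3 (iv _).
by rewrite (le_trans h4)// (le_trans td).
Qed.

Let J_split a m b c n d : inside a b c d -> a <= m -> m <= b -> c <= n -> n <= d ->
  J a b c d = J a m c n + J m b c n + J a m n d + J m b n d.
Proof.
move=> i am mb cn nd; rewrite /J.
have cd := le_trans cn nd; have ab := le_trans am mb.
have iub := iuS i (s := b); have iua := iuS i (s := a).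
have ivd := ivS i (t := d); have ivc := ivS i (t := c).
rewrite (itv_integral_split (f := u b) _ cn nd) ?iub ?lexx ?ab//.
rewrite (itv_integral_split (f := u a) _ cn nd) ?iua ?lexx ?ab//.
rewrite (itv_integral_split (f := v ^~ d) _ am mb) ?ivd ?lexx ?cd//.
rewrite (itv_integral_split (f := v ^~ c) _ am mb) ?ivc ?lexx ?cd//.
ring.
Qed.

(** The affine part of u + i v has no circulation, so near a point of
    differentiability only the error term is left, of the order of the area. *)
Let J_small s t : cauchy_riemann u v s t -> forall e, 0 < e -> exists2 dl, 0 < dl &
  forall a b c d L, inside a b c d -> a <= s <= b -> c <= t <= d -> b - a <= L -> d - c <= L -> L < dl ->
  `|J a b c d| <= e * L ^+ 2.
Proof.
(* 8 = 2 coordinates * 2 opposite sides * 2 pairs of sides *)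
move=> [al [be H]] e e0; have e8 : 0 < e / 8 by rewrite divr_gt0.
have [dl dl0 {}H] := H _ e8; exists dl => // a b c d L ins /andP[as_ sb] /andP[ct td] ba dc Ldl.
have L0 : 0 <= L by apply: le_trans ba; rewrite subr_ge0 (le_trans as_).
have near_s x : a <= x <= b -> `|x - s| <= L.
  by move=> /andP[ax xb]; rewrite ler_norml; apply/andP; split; lra.
have near_t x : c <= x <= d -> `|x - t| <= L.
  by move=> /andP[cx xd]; rewrite ler_norml; apply/andP; split; lra.
have aa : a <= a <= b by rewrite lexx (le_trans as_).
have bb : a <= b <= b by rewrite lexx (le_trans as_).
have cc : c <= c <= d by rewrite lexx (le_trans ct).
have dd : c <= d <= d by rewrite lexx (le_trans ct).
have bound x y : a <= x <= b -> c <= y <= d ->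
   `|u x y - u s t - (al * (x - s) - be * (y - t))| <= e / 4 * L /\
   `|v x y - v s t - (be * (x - s) + al * (y - t))| <= e / 4 * L.
  move=> /near_s xs /near_t yt.
  have [H1 H2] := H x y (le_lt_trans xs Ldl) (le_lt_trans yt Ldl).
  have E : e / 8 * (`|x - s| + `|y - t|) <= e / 4 * L.
    have -> : e / 4 * L = e / 8 * (L + L) by field.
    by rewrite ler_pM2l// lerD.
  by split; [exact: le_trans H1 E|exact: le_trans H2 E].
have B1 : `|itv_integral (u b) c d - itv_integral (u a) c d - al * (b - a) * (d - c)|
    <= e / 2 * L * (d - c).
  have ib : itv_integrable (u b) c d by apply: iuS ins _.
  have ia : itv_integrable (u a) c d by apply: iuS ins _.
  rewrite /itv_integral -RintegralB//.
  apply: itv_integral_approx; [exact: itv_integrableB ib ia| lra |].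
  move=> y cyd; have [b1 _] := bound b y bb cyd; have [a1 _] := bound a y aa cyd.
  move: b1 a1; rewrite !ler_norml => /andP[? ?] /andP[? ?]; apply/andP; split; lra.
have B2 : `|itv_integral (v ^~ d) a b - itv_integral (v ^~ c) a b - al * (d - c) * (b - a)|
    <= e / 2 * L * (b - a).
  have ib : itv_integrable (v ^~ d) a b by apply: ivS ins _.
  have ia : itv_integrable (v ^~ c) a b by apply: ivS ins _.
  rewrite /itv_integral -RintegralB//.
  apply: itv_integral_approx; [exact: itv_integrableB ib ia| lra |].
  move=> y cyd; have [_ b1] := bound y d cyd dd; have [_ a1] := bound y c cyd cc.
  move: b1 a1; rewrite !ler_norml => /andP[? ?] /andP[? ?]; apply/andP; split; lra.
have eL : 0 <= e / 2 * L by rewrite mulr_ge0// divr_ge0// ltW.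
have C1 : e / 2 * L * (d - c) <= e / 2 * L * L by rewrite ler_wpM2l.
have C2 : e / 2 * L * (b - a) <= e / 2 * L * L by rewrite ler_wpM2l.
rewrite /J; move: B1 B2; rewrite !ler_norml => /andP[? ?] /andP[? ?].
have E : e * L ^+ 2 = e / 2 * L * L + e / 2 * L * L by field.
by rewrite E; apply/andP; split; lra.
Qed.

Let w n : R := (b0 - a0) / 2 ^+ n.
Let l n : R := (d0 - c0) / 2 ^+ n.
Let Q n (p : R * R) := J p.1 (p.1 + w n) p.2 (p.2 + l n).

Let w_ge0 n : 0 <= w n.
Proof. by rewrite divr_ge0 ?subr_ge0// exprn_ge0. Qed.
Let l_ge0 n : 0 <= l n.
Proof. by rewrite divr_ge0 ?subr_ge0// exprn_ge0. Qed.
Let wS n : w n = w n.+1 + w n.+1.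
Proof. by rewrite /w exprS; field; rewrite expf_neq0. Qed.
Let lS n : l n = l n.+1 + l n.+1.
Proof. by rewrite /l exprS; field; rewrite expf_neq0. Qed.

(** Some quarter of the rectangle carries at least a quarter of the
    circulation. *)
Let quarter n (p : R * R) : R * R :=
  let q1 := p in let q2 := (p.1 + w n.+1, p.2) in
  let q3 := (p.1, p.2 + l n.+1) in let q4 := (p.1 + w n.+1, p.2 + l n.+1) in
  if `|Q n p| <= 4 * `|Q n.+1 q1| then q1 else
  if `|Q n p| <= 4 * `|Q n.+1 q2| then q2 else
  if `|Q n p| <= 4 * `|Q n.+1 q3| then q3 else q4.

Let insideQ n (p : R * R) := inside p.1 (p.1 + w n) p.2 (p.2 + l n).

Let quarterP n p : insideQ n p -> [/\ `|Q n p| <= 4 * `|Q n.+1 (quarter n p)|,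
  p.1 <= (quarter n p).1 <= p.1 + w n.+1 & p.2 <= (quarter n p).2 <= p.2 + l n.+1].
Proof.
move=> ins; have := w_ge0 n.+1; have := l_ge0 n.+1 => l0 w0.
rewrite /quarter; case: ifPn => [h1|]; first by rewrite h1 !lexx !lerDl w0 l0.
rewrite -ltNge => h1; case: ifPn => [h2|]; first by rewrite h2/= !lexx !lerDl w0 l0.
rewrite -ltNge => h2; case: ifPn => [h3|]; first by rewrite h3/= !lexx !lerDl w0 l0.
rewrite -ltNge => h3 /=; rewrite !lexx !lerDl w0 l0; split => //.
have E : Q n p = Q n.+1 p + Q n.+1 (p.1 + w n.+1, p.2) + Q n.+1 (p.1, p.2 + l n.+1)
   + Q n.+1 (p.1 + w n.+1, p.2 + l n.+1).
  rewrite /Q (@J_split _ (p.1 + w n.+1) _ _ (p.2 + l n.+1)) ?lerDl//.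
  - by rewrite /= -!addrA -wS -lS.
  - by rewrite lerD2l (wS n) lerDl.
  - by rewrite lerD2l (lS n) lerDl.
have := ler_normD (Q n.+1 p + Q n.+1 (p.1 + w n.+1, p.2) + Q n.+1 (p.1, p.2 + l n.+1))
  (Q n.+1 (p.1 + w n.+1, p.2 + l n.+1)).
have := ler_normD (Q n.+1 p + Q n.+1 (p.1 + w n.+1, p.2)) (Q n.+1 (p.1, p.2 + l n.+1)).
have := ler_normD (Q n.+1 p) (Q n.+1 (p.1 + w n.+1, p.2)).
rewrite -E; lra.
Qed.

Let P n : R * R := iteri n quarter (a0, c0).

Let insideP n : insideQ n (P n).
Proof.
elim: n => [|n IH].
  by rewrite /insideQ /P /= /w /l expr0 !divr1 !(addrC _ (_ - _)) !subrK; split.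
have [_ /andP[q1 q2] /andP[q3 q4]] := quarterP IH.
move: q1 q2 q3 q4; rewrite -[quarter _ _]/(P n.+1) => q1 q2 q3 q4.
move: IH => [[h1 h2 h3] [h4 h5 h6]].
have := wS n; have := lS n; have := w_ge0 n.+1; have := l_ge0 n.+1.
by rewrite /insideQ /inside; split; split; lra.
Qed.

Let P_mono n m : [/\ (P n).1 <= (P (n + m)%N).1, (P (n + m)%N).1 + w (n + m)%N <= (P n).1 + w n,
  (P n).2 <= (P (n + m)%N).2 & (P (n + m)%N).2 + l (n + m)%N <= (P n).2 + l n].
Proof.
elim: m => [|m [h1 h2 h3 h4]]; first by rewrite addn0.
rewrite addnS; have [_ /andP[q1 q2] /andP[q3 q4]] := quarterP (insideP (n + m)).
move: q1 q2 q3 q4; rewrite -[quarter _ _]/(P (n + m).+1) => q1 q2 q3 q4.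
have := wS (n + m); have := lS (n + m); split; lra.
Qed.

Let nested (f : nat -> R) (g : nat -> R) : (forall n m, f n <= g m) ->
  exists x, forall n, f n <= x <= g n.
Proof.
move=> fg; exists (sup (range f)) => n.
have hs : has_sup (range f).
  split; first by exists (f 0%N); exists 0%N.
  by exists (g 0%N) => _ [k _ <-].
apply/andP; split.
  by apply: (ub_le_sup hs.2); exists n.
by apply: (ge_sup hs.1) => _ [k _ <-].
Qed.

Let P_cross n m : (P n).1 <= (P m).1 + w m /\ (P n).2 <= (P m).2 + l m.
Proof.
have [h1 _ h3 _] := P_mono n m; have [_ h2 _ h4] := P_mono m n.
rewrite (addnC m n) in h2 h4.
have := w_ge0 (n + m); have := l_ge0 (n + m); split; lra.
Qed.

(** Goursat's bisection: the nested rectangles shrink to a point of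
    differentiability, where the circulation is too small for a nonzero total. *)
Lemma goursat : J a0 b0 c0 d0 = 0.
Proof.
have [s sP] := nested (fun n m => (P_cross n m).1).
have [t tP] := nested (fun n m => (P_cross n m).2).
have w0 : w 0 = b0 - a0 by rewrite /w expr0 divr1.
have l0 : l 0 = d0 - c0 by rewrite /l expr0 divr1.
have sin : a0 <= s <= b0 by have := sP 0%N; rewrite w0 /=; lra.
have tin : c0 <= t <= d0 by have := tP 0%N; rewrite l0 /=; lra.
pose L := (b0 - a0) + (d0 - c0).
have L0 : 0 <= L by rewrite addr_ge0 ?subr_ge0.
have grow n : `|J a0 b0 c0 d0| <= 4 ^+ n * `|Q n (P n)|.
  elim: n => [|n IH].
    rewrite expr0 mul1r /Q w0 l0 /=.
    by rewrite !(addrC _ (_ - _)) !subrK.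
  apply: (le_trans IH); rewrite exprSr -mulrA ler_wpM2l ?exprn_ge0//.
  by have [] := quarterP (insideP n).
apply/eqP; rewrite -normr_le0; apply/ler_addgt0Pl => e e0; rewrite addr0.
have e' : 0 < e / (L ^+ 2 + 1) by rewrite divr_gt0// ltr_wpDl ?sqr_ge0.
have [dl dl0 H] := J_small (CR sin tin) e'.
have [n Hn] : exists n, L / 2 ^+ n < dl.
  exists (Num.bound (L / dl)); rewrite ltr_pdivrMr ?exprn_gt0//.
  rewrite -ltr_pdivrMl// mulrC.
  apply: (lt_le_trans (archi_boundP (divr_ge0 L0 (ltW dl0)))).
  by rewrite -natrX ler_nat ltnW// ltn_expl.
apply: (le_trans (grow n)).
have p2 : 0 < 2 ^+ n :> R by rewrite exprn_gt0.
have {}HJ := H _ _ _ _ (L / 2 ^+ n) (insideP n) (sP n) (tP n).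
have : `|Q n (P n)| <= e / (L ^+ 2 + 1) * (L / 2 ^+ n) ^+ 2.
  apply: HJ => //.
  - by rewrite addrAC subrr add0r /w ler_pM2r ?invr_gt0// lerDl subr_ge0.
  - by rewrite addrAC subrr add0r /l ler_pM2r ?invr_gt0// lerDr subr_ge0.
move=> HQ; apply: (@le_trans _ _ (4 ^+ n * (e / (L ^+ 2 + 1) * (L / 2 ^+ n) ^+ 2))).
  by rewrite ler_wpM2l// exprn_ge0.
have -> : 4 ^+ n = (2 ^+ n) ^+ 2 :> R by rewrite -exprM mulnC exprM; congr (_ ^+ n); ring.
have -> : (2 ^+ n) ^+ 2 * (e / (L ^+ 2 + 1) * (L / 2 ^+ n) ^+ 2) = e * L ^+ 2 / (L ^+ 2 + 1).
  by field; rewrite !gt_eqF// ltr_wpDl ?sqr_ge0.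
rewrite ler_pdivrMr ?ltr_wpDl ?sqr_ge0// mulrDr mulr1 lerDl ltW//.
Qed.

End rectangle.

(** * Circle means *)

Definition cis (t : R) : R[i] := Complex (cos t) (sin t).
Definition cexp (s t : R) : R[i] := Complex (expR s * cos t) (expR s * sin t).

Lemma normc_cis t : normc (cis t) = 1.
Proof. by rewrite /cis /= cos2Dsin2 sqrtr1. Qed.

Lemma cexpE s t : cexp s t = ((expR s)%:C)%C * cis t.
Proof. by apply/eqP; rewrite eq_complex/=; apply/andP; split; apply/eqP; ring. Qed.

Lemma normc_cexp s t : normc (cexp s t) = expR s.
Proof. by rewrite cexpE normcM normc_real normc_cis mulr1 ger0_norm// expR_ge0. Qed.

Lemma cexpD s t s' t' : cexp (s + s') (t + t') = cexp s t * cexp s' t'.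
Proof.
apply/eqP; rewrite eq_complex/= !cosD !sinD !expRD; apply/andP; split; apply/eqP; ring.
Qed.

Lemma cexp_periodic s t : cexp s (t + pi *+ 2) = cexp s t.
Proof. by rewrite /cexp mulr2n addrA !cosDpi !sinDpi !opprK. Qed.

Lemma real_expansion (f : R -> R) (x l : R) : is_derive (x : R^o) (1 : R^o) (f : R^o -> R^o) l ->
  forall e, 0 < e -> exists2 d, 0 < d & forall y, `|y - x| < d ->
   `|f y - f x - l * (y - x)| <= e * `|y - x|.
Proof.
move=> [df <-] e e0; have [d d0 H] := derivable_expansion df e0.
by exists d.
Qed.

Lemma cexp_expansion e : 0 < e -> exists2 d, 0 < d & forall s t,
  `|s| < d -> `|t| < d -> normc (cexp s t - 1 - Complex s t) <= e * (`|s| + `|t|).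
Proof.
move=> e0; have [e1 [e10 e1a e1b]] : exists e1 : R, [/\ 0 < e1, e1 <= 1 & e1 <= e / 8].
  exists (Num.min 1 (e / 8)); split; first by rewrite lt_min ltr01 divr_gt0.
    by rewrite ge_min lexx.
  by rewrite ge_min lexx orbT.
have [d1 d10 H1] := real_expansion (is_derive_expR 0) e10.
have [d2 d20 H2] := real_expansion (is_derive_sin 0) e10.
have [d3 d30 H3] := real_expansion (is_derive_cos 0) e10.
exists (Num.min e1 (Num.min d1 (Num.min d2 d3))).
  by rewrite !lt_min e10 d10 d20 d30.
move=> s t; rewrite !lt_min => /and4P[se s1 _ _] /and4P[te _ t2 t3].
have := H1 s; have := H2 t; have := H3 t; rewrite !subr0 => /(_ t3) + /(_ t2) + /(_ s1).
rewrite cos0 sin0 expR0 oppr0 mul0r !subr0 addr0 !mul1r => C S E.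
set c := cos t - 1 in C; set q := sin t - t in S; set p := expR s - 1 - s in E.
apply: (le_trans (normc_le_ReIm _)) => /=.
have -> : expR s * cos t - 1 - s = p + (p + s) * c + c by rewrite /p /c; ring.
have -> : expR s * sin t - 0 - t = q + (p + s) * (q + t) by rewrite /p /q; ring.
have ns := normr_ge0 s; have nt := normr_ge0 t.
have P1 : `|p + s| <= 2 * `|s|.
  apply: (le_trans (ler_normD _ _)); have : e1 * `|s| <= 1 * `|s| by rewrite ler_wpM2r.
  lra.
have Q1 : `|q + t| <= 2 * `|t|.
  apply: (le_trans (ler_normD _ _)); have : e1 * `|t| <= 1 * `|t| by rewrite ler_wpM2r.
  lra.
have M1 : `|(p + s) * c| <= 2 * (e1 * `|t|).
  rewrite normrM; apply: ler_pM => //; apply: (le_trans P1); lra.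
have M2 : `|(p + s) * (q + t)| <= 4 * (e1 * `|t|).
  rewrite normrM; have -> : 4 * (e1 * `|t|) = (2 * e1) * (2 * `|t|) by ring.
  apply: ler_pM => //; apply: (le_trans P1); lra.
have F1 : `|p + (p + s) * c + c| <= `|p| + `|(p + s) * c| + `|c|.
  by apply: (le_trans (ler_normD _ _)); rewrite lerD2r ler_normD.
have F2 := ler_normD q ((p + s) * (q + t)).
have G1 : e1 * `|s| <= e / 8 * `|s| by rewrite ler_wpM2r.
have G2 : e1 * `|t| <= e / 8 * `|t| by rewrite ler_wpM2r.
have eS : 0 <= e * `|s| by rewrite mulr_ge0// ltW.
lra.
Qed.

(** Stated with real radii and the real modulus, in which all estimates below
    are made. *)
Definition cdiff (h : R[i] -> R[i]) x := exists l : R[i], forall e : R, 0 < e ->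
  exists2 d, 0 < d & forall y, normc (y - x) < d ->
   normc (h y - h x - l * (y - x)) <= e * normc (y - x).

Lemma derivable_cdiff (h : R[i] -> R[i]) x :
  derivable (h : R[i]^o -> R[i]^o) x 1 -> cdiff h x.
Proof.
move=> dh; exists ('D_1 (h : R[i]^o -> R[i]^o) x) => e e0.
have eC : 0 < (e%:C)%C :> R[i] by rewrite ltcR.
have [d d0 H] := derivable_expansion dh eC.
have dE : d = ((Re d)%:C)%C by rewrite RRe_real// gtr0_real.
rewrite dE ltcR in d0; exists (Re d) => // y yx.
have := H y; rewrite dE => /(_ _); rewrite -lecR rmorphM; apply.
by rewrite ltcR.
Qed.

Lemma cdiff_continuous h x : cdiff h x -> forall e, 0 < e ->
  exists2 d, 0 < d & forall y, normc (y - x) < d -> normc (h y - h x) <= e.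
Proof.
move=> [l H] e e0; have [d d0 {}H] := H 1 ltr01.
have l0 : 0 < normc l + 1 by rewrite ltr_wpDl// normc_ge0.
exists (Num.min d (e / (normc l + 1))); first by rewrite lt_min d0 divr_gt0.
move=> y; rewrite lt_min => /andP[yd ye].
have := H y yd; have := le_normcD (h y - h x - l * (y - x)) (l * (y - x)).
rewrite subrK normcM mul1r => h1 h2; apply: (le_trans h1).
rewrite ltr_pdivlMr// in ye; apply: (le_trans _ (ltW ye)); lra.
Qed.

(** In logarithmic coordinates (s, t) the circles around 0 are the vertical
    segments, and s -> -oo is the center. *)
Lemma cdiff_cauchy_riemann h (x : R[i]) s t : cdiff h (x * cexp s t) ->
  cauchy_riemann (fun s t => Re (h (x * cexp s t))) (fun s t => Im (h (x * cexp s t))) s t.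
Proof.
set y := x * cexp s t; move=> [l H].
exists (Re (l * y)), (Im (l * y)) => e e0.
pose N := normc y + 1; pose M := normc l + 1.
have N0 : 0 < N by rewrite ltr_wpDl// normc_ge0.
have M0 : 0 < M by rewrite ltr_wpDl// normc_ge0.
have [d1 d10 H1] := H (e / (4 * N)) (divr_gt0 e0 (mulr_gt0 (ltr0n _ 4) N0)).
have eM : 0 < Num.min 1 (e / (2 * M * N)).
  by rewrite lt_min ltr01 divr_gt0// !mulr_gt0.
have [d2 d20 H2] := cexp_expansion eM.
have dN : 0 < d1 / (4 * N) by rewrite divr_gt0// mulr_gt0.
exists (Num.min d2 (d1 / (4 * N))); first by rewrite lt_min d20.
move=> s' t'; rewrite !lt_min => /andP[s1 s2] /andP[t1 t2].
set S := `|s' - s| + `|t' - t|.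
have S0 : 0 <= S by rewrite addr_ge0.
have K := H2 _ _ s1 t1; rewrite -/S in K.
set E := cexp (s' - s) (t' - t) in K.
set y' := x * cexp s' t'.
have y'E : y' = y * E.
  by rewrite /y' /y /E -mulrA -cexpD; congr (_ * cexp _ _); ring.
set sg := Complex (s' - s) (t' - t).
have nsg : normc sg <= S by exact: normc_le_ReIm.
have [m1 m2] : Num.min 1 (e / (2 * M * N)) <= 1 /\ Num.min 1 (e / (2 * M * N)) <= e / (2 * M * N).
  by rewrite !ge_min !lexx orbT.
have E1 : normc (E - 1) <= 2 * S.
  rewrite -(subrK sg (E - 1)); apply: (le_trans (le_normcD _ _)).
  have : Num.min 1 (e / (2 * M * N)) * S <= 1 * S by rewrite ler_wpM2r.
  by move: K; rewrite -/sg; lra.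
have yy : normc (y' - y) <= N * (2 * S).
  rewrite y'E -{2}(mulr1 y) -mulrBr normcM; apply: ler_pM => //; rewrite ?normc_ge0//.
  by rewrite lerDl.
have yd : normc (y' - y) < d1.
  apply: (le_lt_trans yy); rewrite !ltr_pdivlMr ?mulr_gt0// in s2 t2.
  by rewrite /S; lra.
have T1 : normc (h y' - h y - l * (y' - y)) <= e / 2 * S.
  apply: (le_trans (H1 _ yd)).
  apply: (@le_trans _ _ (e / (4 * N) * (N * (2 * S)))).
    by rewrite ler_wpM2l// divr_ge0 ?(ltW e0)// mulr_ge0// ltW.
  rewrite le_eqVlt; apply/orP; left; apply/eqP; field; by rewrite gt_eqF.
have T2 : normc (l * (y' - y) - l * y * sg) <= e / 2 * S.
  have -> : l * (y' - y) - l * y * sg = l * y * (E - 1 - sg) by rewrite y'E; ring.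
  rewrite (normcM (l * y)) (normcM l y); apply: (@le_trans _ _ (M * N * (e / (2 * M * N) * S))).
    apply: ler_pM; rewrite ?mulr_ge0 ?normc_ge0//.
      by apply: ler_pM; rewrite ?normc_ge0// lerDl.
    by apply: (le_trans K); rewrite ler_wpM2r.
  rewrite le_eqVlt; apply/orP; left; apply/eqP; field; by rewrite !gt_eqF.
have T : normc (h y' - h y - l * y * sg) <= e * S.
  have -> : h y' - h y - l * y * sg = (h y' - h y - l * (y' - y)) + (l * (y' - y) - l * y * sg) by ring.
  apply: (le_trans (le_normcD _ _)); lra.
have -> : Re (h y') - Re (h y) - (Re (l * y) * (s' - s) - Im (l * y) * (t' - t))
   = Re (h y' - h y - l * y * sg).
  by rewrite /sg; case: (h y') => ? ?; case: (h y) => ? ?; case: (l * y).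
have -> : Im (h y') - Im (h y) - (Im (l * y) * (s' - s) + Re (l * y) * (t' - t))
   = Im (h y' - h y - l * y * sg).
  rewrite /sg; case: (h y') => ? ?; case: (h y) => ? ?; case: (l * y) => ? ? /=; ring.
by split; [exact: le_trans (Re_le_normc _) T|exact: le_trans (Im_le_normc _) T].
Qed.

Notation circle_integral f := (itv_integral f 0 (pi *+ 2)).

(** The circle means of a function holomorphic near a closed disk do not
    depend on the radius, by the vanishing of a circulation in logarithmic
    coordinates, so they equal the value at the center. *)
Lemma Re_circle_mean (h : R[i] -> R[i]) (x : R[i]) :
  (forall y, normc y <= normc x -> cdiff h y) ->
  circle_integral (fun t => Re (h (x * cis t))) = Re (h 0) * (pi *+ 2).
Proof.
move=> Hh.
pose u s t := Re (h (x * cexp s t)); pose v s t := Im (h (x * cexp s t)).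
have xs s t : s <= 0 -> normc (x * cexp s t) <= normc x.
  move=> s0; rewrite normcM normc_cexp ler_piMr ?normc_ge0//.
  by rewrite -[leRHS]expR0 ler_expR.
have CR s t : s <= 0 -> cauchy_riemann u v s t.
  by move=> s0; apply: cdiff_cauchy_riemann; apply: Hh; exact: xs.
have CRu s t : s <= 0 -> forall e, 0 < e -> exists2 d, 0 < d & forall s' t',
    `|s' - s| < d -> `|t' - t| < d -> `|u s' t' - u s t| <= e /\ `|v s' t' - v s t| <= e.
  move=> s0 e e0; have [al [be H]] := CR s t s0.
  have [d d0 {}H] := H 1 ltr01.
  pose K := `|al| + `|be| + 1.
  have K0 : 0 < K by rewrite ltr_wpDl// addr_ge0.
  have eK : 0 < e / (2 * K) by rewrite divr_gt0// mulr_gt0.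
  exists (Num.min d (e / (2 * K))); first by rewrite lt_min d0.
  move=> s' t'; rewrite !lt_min => /andP[sd se] /andP[td te].
  have [H1 H2] := H _ _ sd td.
  set a := s' - s in sd se H1 H2; set b := t' - t in td te H1 H2.
  have A1 : `|al * a - be * b| <= `|al| * `|a| + `|be| * `|b|.
    by rewrite -!normrM; apply: ler_normB.
  have A2 : `|be * a + al * b| <= `|be| * `|a| + `|al| * `|b|.
    by rewrite -!normrM; apply: ler_normD.
  have E1 : K * `|a| <= e / 2.
    rewrite ltr_pdivlMr ?mulr_gt0// in se; lra.
  have E2 : K * `|b| <= e / 2.
    rewrite ltr_pdivlMr ?mulr_gt0// in te; lra.
  have := ler_normD (u s' t' - u s t - (al * a - be * b)) (al * a - be * b).
  have := ler_normD (v s' t' - v s t - (be * a + al * b)) (be * a + al * b).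
  rewrite !subrK => B1 B2; rewrite /K in E1 E2.
  have N1 := mulr_ge0 (normr_ge0 be) (normr_ge0 a).
  have N2 := mulr_ge0 (normr_ge0 al) (normr_ge0 b).
  have N3 := mulr_ge0 (normr_ge0 be) (normr_ge0 b).
  have N4 := mulr_ge0 (normr_ge0 al) (normr_ge0 a).
  split; lra.
have pi2 : 0 <= pi *+ 2 :> R by rewrite mulrn_wge0// pi_ge0.
have cu s : s <= 0 -> continuous (u s).
  move=> s0 t; apply/cvgrPdist_le => e e0; have [d d0 H] := CRu s t s0 e e0.
  apply/nbhs_ballP; exists d => //= t'; rewrite /ball/= => tt'.
  have ss : `|s - s| < d by rewrite subrr normr0.
  have st : `|t' - t| < d by rewrite distrC.
  by have [+ _] := H _ _ ss st; rewrite distrC.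
have cv t s0 : {within `[s0, 0], continuous (v ^~ t)}.
  apply: continuous_in_subspaceT => s; rewrite inE/= in_itv/= => /andP[_ ss0].
  apply/cvgrPdist_le => e e0; have [d d0 H] := CRu s t ss0 e e0.
  apply/nbhs_ballP; exists d => //= s'; rewrite /ball/= => ss'.
  have tt : `|t - t| < d by rewrite subrr normr0.
  have st : `|s' - s| < d by rewrite distrC.
  by have [_] := H _ _ st tt; rewrite distrC.
have step s0 : s0 <= 0 -> circle_integral (u 0) = circle_integral (u s0).
  move=> s00.
  have := @goursat u v s0 0 0 (pi *+ 2) s00 pi2.
  have -> : v ^~ (pi *+ 2) = v ^~ 0.
    by apply/funext => s; rewrite /v -[pi *+ 2]add0r cexp_periodic.
  rewrite subrr subr0 => H; apply/eqP; rewrite -subr_eq0; apply/eqP; apply: H.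
  - move=> s /andP[_ ss]; apply: continuous_itv_integrable.
    exact/continuous_subspaceT/cu.
  - by move=> t _; exact: continuous_itv_integrable.
  - by move=> s t /andP[_ ss] _; exact: CR.
rewrite (_ : (fun t => Re (h (x * cis t))) = u 0); last first.
  apply/funext => t; rewrite /u; congr (Re (h (_ * _))).
  by rewrite /cexp expR0 !mul1r.
apply/eqP; rewrite -subr_eq0 -normr_le0; apply/ler_addgt0Pl => e e0; rewrite addr0.
have e' : 0 < e / (pi *+ 2 + 1) by rewrite divr_gt0// ltr_wpDl.
have h0 : cdiff h 0 by apply: Hh; rewrite ComplexField.Normc.normc0 normc_ge0.
have [d d0 H] := cdiff_continuous h0 e'.
have [s0 [s00 sd]] : exists s0 : R, s0 <= 0 /\ normc x * expR s0 < d.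
  pose k := Num.min 1 (d / (normc x + 1)).
  have x1 : 0 < normc x + 1 by rewrite ltr_wpDl// normc_ge0.
  have k0 : 0 < k by rewrite lt_min ltr01 divr_gt0.
  exists (ln k); split; first by rewrite ln_le0// ge_min lexx.
  rewrite lnK ?posrE//.
  have : k <= d / (normc x + 1) by rewrite ge_min lexx orbT.
  by rewrite ler_pdivlMr//; nra.
rewrite (step _ s00).
have := @itv_integral_approx (u s0) 0 (pi *+ 2) (Re (h 0)) (e / (pi *+ 2 + 1)).
rewrite subr0 => A; apply: (le_trans (A _ pi2 _)).
- exact/continuous_itv_integrable/continuous_subspaceT/cu.
- move=> t _; have := H (x * cexp s0 t); rewrite subr0 normcM normc_cexp => /(_ sd).
  apply: le_trans; have := Re_le_normc (h (x * cexp s0 t) - h 0).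
  by rewrite /u; case: (h (x * _)) => ? ?; case: (h 0).
rewrite -mulrA ler_piMr ?(ltW e0)// mulrC ler_pdivrMr ?mul1r ?lerDl//.
by rewrite ltr_wpDl.
Qed.

End goursat.

(** * Mean values over the disk *)

Section disk_functions.
Context {R : realType}.
Notation mu := (@lebesgue_measure R).
Notation D := (@disk R).

(** Needed for the theorem of Fubini over products of disks. *)
Lemma dA_sigma_finite : sigma_finite [set: R[i]] (@dA R).
Proof.
pose B n : set R := `[- n%:R, n%:R]%classic.
pose F n : set R[i] := [set z | B n (Re z) /\ B n (Im z)].
have mF n : measurable (F n).
  rewrite (_ : F n = (@complex.Re R @^-1` B n) `&` (@complex.Im R @^-1` B n)); last by apply/seteqP; split.
  have mB : measurable (B n) by exact: measurable_itv.
  apply: measurableI.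
    by have := @measurable_Re R measurableT _ mB; rewrite setTI.
  by have := @measurable_Im R measurableT _ mB; rewrite setTI.
exists F.
  apply/seteqP; split => // z _.
  exists (Num.bound (`|Re z| + `|Im z|)) => //.
  have h : `|Re z| + `|Im z| < (Num.bound (`|Re z| + `|Im z|))%:R by apply: archi_boundP; rewrite addr_ge0.
  have := normr_ge0 (Re z); have := normr_ge0 (Im z) => i0 r0.
  split; rewrite /B/= in_itv/= -ler_norml; lra.
move=> n; split; first exact: mF.
rewrite /dA /mscale/= lte_mul_pinfty//; first by rewrite lee_fin invr_ge0 pi_ge0.
rewrite /area /pushforward.
have -> : complex_of_pair (R:=R) @^-1` F n = B n `*` B n by apply/seteqP; split => -[].
rewrite product_measure1E//; try exact: measurable_itv.
rewrite lte_mul_pinfty//=.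
  by rewrite ge0_fin_numE//= lebesgue_measure_itv/=; case: ifP => _; rewrite -?EFinB ltry.
by rewrite lebesgue_measure_itv/=; case: ifP => _; rewrite -?EFinB ltry.
Qed.

HB.instance Definition _ :=
  Measure_isSigmaFinite.Build _ _ _ (@dA R) dA_sigma_finite.

(** Functions continuous at every point of the disk are limits of functions
    of the rounded coordinates. *)
Lemma continuous_disk_measurable (f : R[i] -> R) :
  (forall x, D x -> forall e, 0 < e -> exists2 d, 0 < d & forall y,
     normc (y - x) < d -> `|f y - f x| <= e) -> measurable_fun D f.
Proof.
move=> cf.
have mk : measurable_fun [set: R] (fun y : R => Num.truncn y).
  have nd : {homo (fun y : R => (Num.truncn y)%:R : R) : x y / x <= y}.
    by move=> x y xy; rewrite ler_nat; exact: le_truncn.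
  move=> _ A mA; rewrite setTI.
  rewrite (_ : _ @^-1` A = \bigcup_(n in A) [set y : R | (Num.truncn y)%:R = n%:R :> R]).
    apply: bigcup_measurable => n _.
    have := nondecreasing_measurable measurableT nd measurableT (measurable_set1 (n%:R : R)).
    by rewrite setTI.
  apply/seteqP; split => [y /= Ay|y [n /= An /eqP]]; first by exists (Num.truncn y).
  by rewrite eqr_nat => /eqP ->.
pose k n (y : R) := Num.truncn (n.+1%:R * (y + 1)).
pose g n (p : nat * nat) := f (Complex (p.1%:R / n.+1%:R - 1) (p.2%:R / n.+1%:R - 1)).
have mg n : measurable_fun setT (g n).
  move=> _ A mA; rewrite setTI; apply: countable_measurable.
    move=> [a b]; rewrite (_ : [set (a, b)] = [set a] `*` [set b]).
      exact: measurableX.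
    by apply/seteqP; split => [[? ?] /= [-> ->]|[? ?] /= [/= -> ->]].
  exact: countableP.
apply: (@measurable_fun_cvg _ _ _ _ (fun n x => g n (k n (Re x), k n (Im x)))).
  move=> n; apply: measurable_funTS; apply: (measurableT_comp (mg n)).
  apply: measurable_fun_pair; apply: (measurableT_comp mk).
    by apply: measurable_funM; [meas|apply: measurable_funD; [exact: measurable_Re|meas]].
  by apply: measurable_funM; [meas|apply: measurable_funD; [exact: measurable_Im|meas]].
move=> x Dx; apply/cvgrPdist_le => e e0.
have [d d0 H] := cf x Dx e e0.
have D1 : `|Re x| < 1 by apply: le_lt_trans Dx; exact: Re_le_normc.
have D2 : `|Im x| < 1 by apply: le_lt_trans Dx; exact: Im_le_normc.
have approx (y : R) n : `|y| < 1 -> `|(k n y)%:R / n.+1%:R - 1 - y| <= n.+1%:R^-1.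
  move=> y1; have n0 : 0 < n.+1%:R :> R by rewrite ltr0n.
  have : 0 <= n.+1%:R * (y + 1).
    by rewrite mulr_ge0//; move: y1; rewrite ltr_norml; lra.
  move=> /truncn_itv/andP[]; rewrite -/(k n y) => h1.
  rewrite -[X in _ < X]natr1 => h2.
  rewrite -(ler_pM2r n0) mulVf ?gt_eqF// -[X in _ * X](gtr0_norm n0) -normrM.
  have -> : ((k n y)%:R / n.+1%:R - 1 - y) * n.+1%:R = (k n y)%:R - n.+1%:R * (y + 1).
    by field; rewrite gt_eqF.
  by rewrite ler_norml; apply/andP; split; lra.
near=> n; rewrite distrC; apply: H.
apply: (le_lt_trans (normc_le_ReIm _)).
have := approx _ n D1; have := approx _ n D2.
have : n.+1%:R^-1 < d / 2 :> R.
  rewrite invf_plt ?posrE ?divr_gt0//.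
  apply: (@lt_trans _ _ n%:R); last by rewrite ltr_nat.
  near: n; exact: nbhs_infty_gtr.
move=> h0 h1 h2; case: (x) h1 h2 => a b h1 h2.
by apply: (le_lt_trans (lerD h2 h1)); rewrite [ltRHS]splitr ltrD.
Unshelve. all: by end_near. Qed.

Lemma ge0_integral_rotation (e : R[i]) (g : R[i] -> \bar R) : normc e = 1 ->
  measurable_fun D g -> (forall x, D x -> 0 <= g x)%E ->
  (\int[dA]_(x in D) g (e * x)%R = \int[dA]_(x in D) g x)%E.
Proof.
move=> e1 mg g0; have e0 : e != 0 by rewrite -normc_eq0 e1 oner_eq0.
rewrite -[RHS](ge0_integral_disk_substitution (area_multiplication e0) _ mg g0); last first.
  by move=> x _; rewrite /disk/= normcM e1 mul1r.
by apply: eq_integral => x _; rewrite /= e1 expr1n mule1.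
Qed.

Lemma integrable_disk_bounded (f : R[i] -> R) M : measurable_fun D f ->
  (forall x, D x -> `|f x| <= M) -> dA.-integrable D (EFin \o f).
Proof.
move=> mf fM; apply: measurable_bounded_integrable => //.
- exact: measurable_disk.
- by rewrite [X in (X < _)%E]dA_disk ltry.
- exists M; split; first exact: num_real.
  by move=> y My x Dx; apply: (le_trans (fM x Dx)); exact: ltW.
Qed.

Lemma dint_cst (c : R) : \int[dA]_(x in D) c = c.
Proof.
by rewrite Rintegral_cst ?[X in fine X]dA_disk ?mulr1//; exact: measurable_disk.
Qed.

(** Rotation invariance turns the area mean of W h into an average of circle
    means. *)
Lemma disk_mean (W : R[i] -> R) (h : R[i] -> R[i]) :
  (forall x y, D x -> D y -> normc x = normc y -> W x = W y) ->
  dA.-integrable D (EFin \o W) ->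
  (forall y, D y -> cdiff h y) ->
  dA.-integrable D (fun x => (W x * Re (h x))%:E) ->
  \int[dA]_(x in D) (W x * Re (h x)) = Re (h 0) * \int[dA]_(x in D) W x.
Proof.
move=> Wrad iW ch iWh; have mD := @measurable_disk R.
pose f x := W x * Re (h x).
pose g := f \_ D.
pose I : set R := `[0, pi *+ 2]%classic.
have pi2 : 0 < pi *+ 2 :> R by rewrite mulrn_wgt0// pi_gt0.
have mI : measurable (I : set (measurableTypeR R)) by exact: measurable_itv.
have muI : mu I = (pi *+ 2)%:E by rewrite lebesgue_measure_itv/= lte_fin pi2 -EFinB subr0.
have mf : measurable_fun D f by have /integrableP[/measurable_EFinP] := iWh.
have mg : measurable_fun setT g by apply/(measurable_restrictT _ mD).
have mcis : measurable_fun [set: R] (@cis R).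
  apply: measurable_fun_Complex; apply: continuous_measurable_fun.
    exact: continuous_cos.
  exact: continuous_sin.
pose F (p : R * R[i]) : R := \1_I p.1 * g (cis p.1 * p.2).
have mF : measurable_fun setT F.
  apply: measurable_funM.
    by apply: (measurableT_comp (measurable_indic mI)); meas.
  apply: (measurableT_comp mg); apply: measurable_funcM; last by meas.
  by apply: (measurableT_comp mcis); meas.
have Dcis t x : D (cis t * x) <-> D x by rewrite /disk/= normcM normc_cis mul1r.
have gcis t : (fun x => g (cis t * x)) = (fun x => f (cis t * x)) \_ D.
  apply/funext => x; rewrite /g !patchE; congr (if _ then _ else _).
  by apply/idP/idP; rewrite !inE => /Dcis.
pose C := (\int[dA]_(x in D) `|(f x)%:E|)%E.
have Clty : (C < +oo)%E by have /integrableP[] := iWh.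
have absg t : (\int[dA]_x `|(g (cis t * x))%:E| = C)%E.
  rewrite /C -(@ge0_integral_rotation (cis t) (fun x => `|(f x)%:E|)%E (normc_cis t))//.
    rewrite [RHS]integral_mkcond; apply: eq_integral => x _.
    have /(congr1 (@^~ x)) -> := gcis t; rewrite !patchE; case: ifP => // _.
    exact: abse0.
  by apply: measurableT_comp => //; exact/measurable_EFinP.
have i1 : mu.-integrable setT (fun t : R => (\1_I t)%:E).
  apply/integrableP; split; first exact/measurable_EFinP/measurable_indic.
  under eq_integral do rewrite gee0_abs ?lee_fin//.
  by rewrite integral_indic// setIT -[X in (X < _)%E]/(mu I) muI ltry.
have iI k : (\int[mu]_t ((\1_I t)%:E * k%:E) = (k * (pi *+ 2))%:E)%E.
  under eq_integral do rewrite muleC.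
  rewrite integralZl//.
  by rewrite integral_indic// setIT -[X in (_ * X)%E]/(mu I) muI.
have iF : (mu \x @dA R)%E.-integrable setT (EFin \o F).
  apply/integrable12ltyP; first exact/measurable_EFinP.
  have -> : (\int[mu]_t \int[dA]_x `|(EFin \o F) (t, x)| = \int[mu]_t ((\1_I t)%:E * (fine C)%:E))%E.
    apply: eq_integral => t _.
    rewrite fineK ?ge0_fin_numE ?integral_ge0// -(absg t) -ge0_integralZl//.
    - by apply: eq_integral => x _; rewrite /F /= normrM EFinM ger0_norm.
    - apply: measurableT_comp => //; apply/measurable_EFinP; apply: (measurableT_comp mg); meas.
  by rewrite iI ltry.
have iDf t := integrable_rotation (normc_cis t) iWh.
have L : (\int[mu]_t \int[dA]_x (EFin \o F) (t, x) =
   (\int[dA]_(x in D) f x * (pi *+ 2))%:E)%E.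
  rewrite -iI; apply: eq_integral => t _.
  have [i2 <-] := iDf t.
  rewrite /Rintegral fineK; last exact: integrable_fin_num.
  rewrite -integralZl//.
  rewrite [RHS]integral_mkcond; apply: eq_integral => x _.
  rewrite /F /=; have /(congr1 (@^~ x)) -> := gcis t; rewrite !patchE; case: ifP => // _.
  by rewrite mulr0.
have ccirc x : D x -> continuous (fun t => Re (h (x * cis t))).
  move=> Dx t; apply/cvgrPdist_le => e e0.
  have Dxt : D (x * cis t) by rewrite mulrC; exact/Dcis.
  have [d d0 H] := cdiff_continuous (ch _ Dxt) e0.
  have d2 : 0 < d / 2 by rewrite divr_gt0.
  have /cvgrPdist_lt/(_ _ d2)/nbhs_ballP[r1 r10 H1] := @continuous_cos R t.
  have /cvgrPdist_lt/(_ _ d2)/nbhs_ballP[r2 r20 H2] := @continuous_sin R t.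
  apply/nbhs_ballP; exists (Num.min r1 r2); first by rewrite /= lt_min; apply/andP.
  move=> t'; rewrite /ball/= lt_min => /andP[tt1 tt2]; rewrite distrC.
  have -> : Re (h (x * cis t')) - Re (h (x * cis t)) = Re (h (x * cis t') - h (x * cis t)).
    by case: (h (x * cis t')); case: (h (x * cis t)).
  apply: (le_trans (Re_le_normc _)); apply: H.
  rewrite -mulrBr normcM; apply: (@le_lt_trans _ _ (normc (cis t' - cis t))).
    by rewrite ler_piMl ?normc_ge0// ltW.
  apply: (le_lt_trans (normc_le_ReIm _)) => /=.
  have -> : d = d / 2 + d / 2 by field.
  by apply: ltrD; rewrite distrC; [exact: H1|exact: H2].
have Rr : (\int[dA]_x \int[mu]_t (EFin \o F) (t, x) =
   (Re (h 0) * (pi *+ 2) * \int[dA]_(x in D) W x)%:E)%E.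
  rewrite /Rintegral EFinM fineK; last exact: integrable_fin_num.
  rewrite -integralZl// [RHS]integral_mkcond; apply: eq_integral => x _.
  rewrite patchE; case: ifPn => xD; last first.
    rewrite integral0_eq// => t _; rewrite /F /=.
    by have /(congr1 (@^~ x)) -> := gcis t; rewrite patchE (negbTE xD) mulr0.
  have Dx : D x by rewrite inE in xD.
  rewrite -(@Re_circle_mean _ h x); last first.
    by move=> y yx; apply: ch; exact: le_lt_trans Dx.
  have ic := @continuous_itv_integrable _ _ 0 (pi *+ 2) (continuous_subspaceT (ccirc x Dx)).
  rewrite /itv_integral /Rintegral fineK; last exact: integrable_fin_num.
  rewrite muleC -integralZl//.
  rewrite [RHS]integral_mkcond; apply: eq_integral => t _.
  rewrite patchE /F /=; have /(congr1 (@^~ x)) -> := gcis t; rewrite patchE xD indicE.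
  case: ifP => _; last by rewrite mul0r.
  rewrite mul1r /f (Wrad (cis t * x) x) ?normcM ?normc_cis ?mul1r//; last exact/Dcis.
  by rewrite (mulrC (cis t)).
have := Fubini iF; rewrite L Rr => -[].
by rewrite -mulrA (mulrC (pi *+ 2)) mulrA => /(mulIf (lt0r_neq0 pi2)).
Qed.

End disk_functions.

(** * The Bergman space and its reproducing kernel *)

Section bergman.
Context {R : realType}.
Notation D := (@disk R).
Implicit Types (g h : R[i] -> R[i]).

Definition holomorphic h := forall x, D x -> derivable (h : R[i]^o -> R[i]^o) x 1.

Lemma holomorphic_cst (c : R[i]) : holomorphic (fun=> c).
Proof. by move=> x _; exact: (@derivable_cst R[i] R[i]^o R[i]^o c). Qed.

Lemma holomorphic_id : holomorphic id.
Proof. by move=> x _; exact: (@derivable_id R[i] R[i]^o). Qed.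

Lemma holomorphicD g h : holomorphic g -> holomorphic h ->
  holomorphic (fun x => g x + h x).
Proof.
by move=> dg dh x Dx; exact: (@derivableD R[i] R[i]^o R[i]^o g h x 1 (dg x Dx) (dh x Dx)).
Qed.

Lemma holomorphicN h : holomorphic h -> holomorphic (fun x => - h x).
Proof. by move=> dh x Dx; exact: (@derivableN R[i] R[i]^o R[i]^o h x 1 (dh x Dx)). Qed.

Lemma holomorphicM g h : holomorphic g -> holomorphic h ->
  holomorphic (fun x => g x * h x).
Proof.
by move=> dg dh x Dx; exact: (@derivableM R[i] R[i]^o g h x 1 (dg x Dx) (dh x Dx)).
Qed.

Lemma holomorphicX h n : holomorphic h -> holomorphic (fun x => h x ^+ n).
Proof.
move=> dh; elim: n => [|n IH].
  by under eq_fun do rewrite expr0; exact: holomorphic_cst.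
by under eq_fun do rewrite exprS; exact: holomorphicM.
Qed.

Lemma holomorphicV h : holomorphic h -> (forall x, D x -> h x != 0) ->
  holomorphic (fun x => (h x)^-1).
Proof.
move=> dh h0 x Dx.
exact: (@derivableV R[i] R[i]^o h x 1 (h0 x Dx) (dh x Dx)).
Qed.

Lemma holomorphic_comp g h : holomorphic g -> holomorphic h ->
  (forall x, D x -> D (h x)) -> holomorphic (fun x => g (h x)).
Proof.
move=> dg dh Dh x Dx.
have dgx := dg _ (Dh x Dx); have dhx := dh x Dx.
apply/(@derivable1_diffP R[i] R[i]^o (g \o h : R[i]^o -> R[i]^o) x).
have dh1 := (@derivable1_diffP R[i] R[i]^o (h : R[i]^o -> R[i]^o) x).1 dhx.
have dg1 := (@derivable1_diffP R[i] R[i]^o (g : R[i]^o -> R[i]^o) (h x)).1 dgx.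
exact: (@differentiable_comp R[i] R[i]^o R[i]^o R[i]^o h g x dh1 dg1).
Qed.

Lemma holomorphic_cdiff h : holomorphic h -> forall x, D x -> cdiff h x.
Proof. by move=> dh x Dx; apply: derivable_cdiff; exact: dh. Qed.

Lemma holomorphic_measurable h : holomorphic h -> measurable_fun D h.
Proof.
move=> dh; have c x : D x -> forall e, 0 < e -> exists2 d, 0 < d & forall y,
     normc (y - x) < d -> normc (h y - h x) <= e.
  by move=> Dx; exact: cdiff_continuous (holomorphic_cdiff dh Dx).
apply: measurable_fun_ReIm; apply: continuous_disk_measurable => x Dx e e0;
  have [d d0 H] := c x Dx e e0; exists d => // y /H; apply: le_trans.
  rewrite (_ : _ - _ = Re (h y - h x)); first exact: Re_le_normc.
  by case: (h y); case: (h x).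
rewrite (_ : _ - _ = Im (h y - h x)); first exact: Im_le_normc.
by case: (h y); case: (h x).
Qed.

Lemma holomorphic_mobius z : D z -> holomorphic (mobius z).
Proof.
move=> Dz; apply: holomorphicM.
  apply: holomorphicD; first exact: holomorphic_cst.
  by apply: holomorphicN; exact: holomorphic_id.
apply: holomorphicV; last by move=> x Dx; exact: disk_denom.
apply: holomorphicD; [exact: holomorphic_cst|apply: holomorphicN; apply: holomorphicM].
  exact: holomorphic_cst.
exact: holomorphic_id.
Qed.

Lemma holomorphic_1B (c : R[i]) : holomorphic (fun x => 1 - c * x).
Proof.
apply: holomorphicD; [exact: holomorphic_cst|apply: holomorphicN; apply: holomorphicM].
  exact: holomorphic_cst.
exact: holomorphic_id.
Qed.

Lemma bergman_holomorphic h : bergman_space h -> holomorphic h.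
Proof. by case. Qed.

Lemma le_integrable_disk (f G : R[i] -> R) : measurable_fun D f ->
  (forall x, D x -> `|f x| <= G x) -> dA.-integrable D (EFin \o G) ->
  dA.-integrable D (EFin \o f).
Proof.
move=> mf fG; apply: le_integrable; [exact: measurable_disk|exact/measurable_EFinP|].
move=> x Dx /=; rewrite lee_fin (le_trans (fG x Dx))// ler_norm//.
Qed.

Lemma bergman_sq_integrable h : bergman_space h ->
  dA.-integrable D (fun x => (normc (h x) ^+ 2)%:E).
Proof.
move=> [hh hs]; have mh := holomorphic_measurable hh.
apply/integrableP; split; first by apply/measurable_EFinP; meas.
move: hs; rewrite /sqnorm; under [X in (X < _)%E -> _]eq_integral => x _.
  rewrite -(@gee0_abs _ (normc (h x) ^+ 2)%:E) ?lee_fin ?sqr_ge0//; over.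
by [].
Qed.

(** Stated for P so as to serve both the real and the imaginary part. *)
Lemma bergman_inner_integrable g h (P : R[i] -> R) :
  bergman_space g -> bergman_space h ->
  measurable_fun setT P -> (forall z, `|P z| <= normc z) ->
  dA.-integrable D (fun x => (P (g x * conjc (h x)))%:E).
Proof.
move=> gg hh mP Pn.
have mg := holomorphic_measurable (bergman_holomorphic gg).
have mh := holomorphic_measurable (bergman_holomorphic hh).
apply: (@le_integrable_disk _ (fun x => normc (g x) ^+ 2 + normc (h x) ^+ 2)).
- by apply: (measurableT_comp mP); meas.
- move=> x _; apply: (le_trans (Pn _)); rewrite normcM normc_conj.
  have := normc_ge0 (g x); have := normc_ge0 (h x); nra.
- have := integrableD (@measurable_disk R) (bergman_sq_integrable gg) (bergman_sq_integrable hh).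
  by apply: eq_integrable; [exact: measurable_disk|move=> x _].
Qed.

Lemma bergman_Re_integrable g h : bergman_space g -> bergman_space h ->
  dA.-integrable D (fun x => (Re (g x * conjc (h x)))%:E).
Proof.
by move=> gg hh; apply: bergman_inner_integrable => //; [exact: measurable_Re|exact: Re_le_normc].
Qed.

Lemma bergman_Im_integrable g h : bergman_space g -> bergman_space h ->
  dA.-integrable D (fun x => (Im (g x * conjc (h x)))%:E).
Proof.
by move=> gg hh; apply: bergman_inner_integrable => //; [exact: measurable_Im|exact: Im_le_normc].
Qed.

Lemma sqnorm_lty (f : R[i] -> R[i]) (G : R[i] -> R) : measurable_fun D f ->
  (forall x, D x -> normc (f x) ^+ 2 <= G x) -> dA.-integrable D (EFin \o G) ->
  (sqnorm f < +oo)%E.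
Proof.
move=> mf fG iG.
have /integrableP[_] : dA.-integrable D (fun x => (normc (f x) ^+ 2)%:E).
  apply: (le_integrable_disk _ _ iG); first by meas.
  by move=> x Dx; rewrite ger0_norm ?sqr_ge0// fG.
apply: le_lt_trans; rewrite /sqnorm le_eqVlt; apply/orP; left; apply/eqP.
by apply: eq_integral => x _; rewrite gee0_abs// lee_fin sqr_ge0.
Qed.

Lemma bergmanD g h : bergman_space g -> bergman_space h ->
  bergman_space (fun x => g x + h x).
Proof.
move=> gg hh; have hg := bergman_holomorphic gg; have hh' := bergman_holomorphic hh.
split; first exact: holomorphicD.
have iS := integrableD (@measurable_disk R) (bergman_sq_integrable gg) (bergman_sq_integrable hh).
apply: (@sqnorm_lty _ (fun x => 2 * (normc (g x) ^+ 2 + normc (h x) ^+ 2))).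
- by apply: holomorphic_measurable; exact: holomorphicD.
- move=> x _; have := le_normcD (g x) (h x); have := normc_ge0 (g x + h x).
  have := normc_ge0 (g x); have := normc_ge0 (h x).
  set a := normc (g x); set b := normc (h x); set c := normc _ => a0 b0 c0 cab.
  have : c ^+ 2 <= (a + b) ^+ 2 by rewrite ler_sqr ?nnegrE ?addr_ge0.
  have := sqr_ge0 (a - b); rewrite sqrrB sqrrD; lra.
- have := integrableZl (@measurable_disk R) 2 iS.
  by apply: eq_integrable; [exact: measurable_disk|move=> x _].
Qed.

Lemma bergmanZ (c : R[i]) h : bergman_space h -> bergman_space (fun x => c * h x).
Proof.
move=> hh; have hh' := bergman_holomorphic hh.
have hc : holomorphic (fun x => c * h x) by exact: (holomorphicM (@holomorphic_cst c) hh').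
split => //.
apply: (@sqnorm_lty _ (fun x => normc c ^+ 2 * (normc (h x) ^+ 2))).
- exact: holomorphic_measurable.
- by move=> x _; rewrite normcM exprMn.
- have := integrableZl (@measurable_disk R) (normc c ^+ 2) (bergman_sq_integrable hh).
  by apply: eq_integrable; [exact: measurable_disk|move=> x _].
Qed.

Lemma bounded_bergman h M : holomorphic h -> (forall x, D x -> normc (h x) <= M) ->
  bergman_space h.
Proof.
move=> hh hM; split => //; apply: (@sqnorm_lty _ (fun=> M ^+ 2)).
- exact: holomorphic_measurable.
- by move=> x Dx; rewrite ler_sqr ?nnegrE ?normc_ge0 ?hM// (le_trans _ (hM x Dx)) ?normc_ge0.
- by apply: (@integrable_disk_bounded _ _ (M ^+ 2)) => // x _; rewrite ger0_norm ?sqr_ge0.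
Qed.

Lemma bergman0 : bergman_space (fun=> 0 : R[i]).
Proof.
apply: (@bounded_bergman _ 0); first exact: holomorphic_cst.
by move=> x _; rewrite ComplexField.Normc.normc0.
Qed.

Lemma disk_denomC x y : D x -> D y -> 1 - y * conjc x != 0.
Proof. by move=> Dx Dy; rewrite mulrC; exact: disk_denom. Qed.

Lemma bergman_F_space x : D x -> bergman_space (bergman_F x).
Proof.
move=> Dx; apply: (@bounded_bergman _ ((1 - normc x) ^- 2)).
  apply: holomorphicV.
    apply: holomorphicX; have := @holomorphic_1B (conjc x).
    by under eq_fun do rewrite mulrC.
  by move=> y Dy; rewrite expf_neq0// disk_denomC.
move=> y Dy; rewrite /bergman_F /bergman_kernel normcV normcX.
have x1 : 0 < 1 - normc x by rewrite subr_gt0.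
have h : 1 - normc x <= normc (1 - y * conjc x).
  apply: le_trans (normc1B_ge _); rewrite lerD2l lerN2 normcM normc_conj.
  by rewrite ler_piMl ?normc_ge0// ltW.
rewrite lef_pV2 ?posrE ?exprn_gt0//; last exact: lt_le_trans h.
by rewrite ler_sqr ?nnegrE ?normc_ge0// ltW.
Qed.

Lemma Re_conj (u : R[i]) : Re (conjc u) = Re u. Proof. by case: u. Qed.

Lemma one_sub_normcE (x : R[i]) : ((1 - normc x ^+ 2)%:C)%C = 1 - x * conjc x.
Proof. by rewrite mulc_conj; apply/eqP; rewrite eq_complex/= subr0 !eqxx. Qed.

(** The Moebius change of variables centered at x turns the inner product with
    the kernel into the area mean of y -> h (phi y) (1 - conj x y)^-2, whose
    value at 0 is h x. *)
Lemma reproducing_Re h x : bergman_space h -> D x ->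
  \int[dA]_(y in D) Re (bergman_F x y * conjc (h y)) = Re (h x).
Proof.
move=> hh Dx; have hol := bergman_holomorphic hh.
have [i1 <-] := integrable_mobius Dx (bergman_Re_integrable (bergman_F_space Dx) hh).
have k0 : 0 < 1 - normc x ^+ 2 by exact: one_sub_sq_gt0.
pose H y := h (mobius x y) * (1 - conjc x * y) ^- 2.
have E y : D y -> Re (bergman_F x (mobius x y) * conjc (h (mobius x y))) * mobius_jacobian x y
   = Re (H y).
  move=> Dy; have d0 := disk_denom Dy Dx; have dc0 := disk_denomC Dy Dx.
  have K : bergman_F x (mobius x y) * ((mobius_jacobian x y)%:C)%C = conjc ((1 - conjc x * y) ^- 2).
    rewrite /bergman_F /bergman_kernel /mobius_jacobian.
    have -> : 1 - mobius x y * conjc x = (((1 - normc x ^+ 2)%:C)%C) / (1 - conjc x * y).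
      rewrite one_sub_normcE /mobius; field; exact: d0.
    have -> : (((1 - normc x ^+ 2) ^+ 2 / normc (1 - conjc x * y) ^+ 4)%:C)%C =
       (((1 - normc x ^+ 2)%:C)%C) ^+ 2 / ((1 - conjc x * y) * conjc (1 - conjc x * y)) ^+ 2.
      by rewrite mulc_conj rmorphM fmorphV !rmorphXn/= -exprM.
    have k0C : ((1 - normc x ^+ 2)%:C)%C != 0 :> R[i].
      by rewrite eq_complex/= negb_and gt_eqF.
    have dcc : conjc (1 - conjc x * y) != 0 by rewrite conjc_eq0.
    rewrite conjc_inv rmorphXn/=.
    move: k0C dcc d0; move: (conjc (1 - conjc x * y)) (1 - conjc x * y).
    move: (((1 - normc x ^+ 2)%:C)%C) => a b c a0 b0 c0.
    by field; rewrite a0 b0 c0.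
  rewrite /H -[RHS]Re_conj conjc_mul -K.
  by rewrite mulrA !ReE_mul /=; ring.
have hH : holomorphic H.
  apply: holomorphicM.
    apply: (holomorphic_comp hol (holomorphic_mobius Dx)).
    by move=> y Dy; apply: (disk_mobius Dx (disk_denom Dy Dx)).2.
  apply: holomorphicV; first by apply: holomorphicX; exact: holomorphic_1B.
  by move=> y Dy; rewrite expf_neq0// disk_denom.
transitivity (\int[dA]_(y in D) (cst 1 y * Re (H y))).
  by apply: eq_Rintegral => y; rewrite inE => Dy; rewrite E// mul1r.
rewrite disk_mean//.
- by rewrite dint_cst mulr1 /H mobius0 mulr0 subr0 expr1n invr1 mulr1.
- by apply: (@integrable_disk_bounded _ _ 1) => // y _; rewrite normr1.
- exact: holomorphic_cdiff.
- move: i1; apply: eq_integrable; first exact: measurable_disk.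
  by move=> y; rewrite inE => Dy; rewrite E// mul1r.
Qed.

(** The imaginary part is the real part for i h. *)
Lemma reproducing h x : bergman_space h -> D x ->
  inner (bergman_F x) h = conjc (h x).
Proof.
move=> hh Dx; rewrite /inner reproducing_Re//.
have := reproducing_Re (bergmanZ (Complex 0 1) hh) Dx => E.
have -> : \int[dA]_(y in D) Im (bergman_F x y * conjc (h y)) =
   \int[dA]_(y in D) Re (bergman_F x y * conjc (Complex 0 1 * h y)).
  apply: eq_Rintegral => y _.
  by case: (bergman_F x y) => a b; case: (h y) => c d /=; ring.
by rewrite E; case: (h x) => a b /=; congr Complex; ring.
Qed.

End bergman.

(** * Measurability of random finite sums *)

Section random_list.
Context d (Omega : measurableType d) d' (T : measurableType d') (R : realType).
Variable s : Omega -> seq T.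
Implicit Types (g : T -> R).

Definition lsum g omega : R := \sum_(x <- s omega) g x.

Lemma cvg_seq_sum (I : Type) (l : seq I) (h : nat -> I -> R) (g : I -> R) :
  (forall x, h n x @[n --> \oo] --> g x) ->
  \sum_(x <- l) h n x @[n --> \oo] --> \sum_(x <- l) g x.
Proof.
move=> hg; elim: l => [|x l IH].
  by under eq_fun do rewrite big_nil; rewrite big_nil; exact: cvg_cst.
by under eq_fun do rewrite big_cons; rewrite big_cons; exact: cvgD.
Qed.

Lemma measurable_lsum_lim (h : nat -> T -> R) g :
  (forall n, measurable_fun setT (lsum (h n))) ->
  (forall x, h n x @[n --> \oo] --> g x) -> measurable_fun setT (lsum g).
Proof.
move=> mh hg; apply: (measurable_fun_cvg (h := fun n => lsum (h n))) => // omega _.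
exact: cvg_seq_sum.
Qed.

Lemma measurable_lsumD g h : measurable_fun setT (lsum g) ->
  measurable_fun setT (lsum h) -> measurable_fun setT (lsum (fun x => g x + h x)).
Proof.
move=> mg mh; rewrite (_ : lsum _ = lsum g \+ lsum h); first exact: measurable_funD.
by apply/funext => omega; rewrite /lsum big_split.
Qed.

Lemma measurable_lsumZ (c : R) g : measurable_fun setT (lsum g) ->
  measurable_fun setT (lsum (fun x => c * g x)).
Proof.
move=> mg; rewrite (_ : lsum _ = (fun omega => c * lsum g omega)); first exact: measurable_funM.
by apply/funext => omega; rewrite /lsum mulr_sumr.
Qed.

Lemma measurable_lsum_sum (I : Type) (r : seq I) (h : I -> T -> R) :
  (forall i, measurable_fun setT (lsum (h i))) ->
  measurable_fun setT (lsum (fun x => \sum_(i <- r) h i x)).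
Proof.
move=> mh; elim: r => [|i r IH].
  rewrite (_ : lsum _ = cst 0) //; apply/funext => omega.
  by rewrite /lsum big1// => x _; rewrite big_nil.
rewrite (_ : lsum _ = lsum (fun x => h i x + \sum_(i <- r) h i x)).
  exact: measurable_lsumD.
by apply/funext => omega; apply: eq_bigr => x _; rewrite big_cons.
Qed.

Variable G : set (set T).
Hypotheses (GE : @measurable _ T = <<s G >>) (GI : setI_closed G).
Hypothesis mG : forall B, G B -> measurable_fun setT (lsum (\1_B : T -> R)).
Hypothesis mT : measurable_fun setT (lsum (\1_setT : T -> R)).

Let measurable_lsum_indic B : measurable B -> measurable_fun setT (lsum (\1_B : T -> R)).
Proof.
rewrite GE; apply: (dynkin_induction GE GI mT mG).
- move=> S mS IS; rewrite (_ : \1_(~` S) = (fun x => (\1_setT : T -> R) x + (-1) * \1_S x)).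
    by apply: measurable_lsumD => //; exact: measurable_lsumZ.
  by apply/funext => x; rewrite !indicE in_setC in_setT; case: (x \in S) => /=; lra.
- move=> F mF tF IF.
  apply: (@measurable_lsum_lim (fun n x => \sum_(i <- iota 0 n) (\1_(F i) : T -> R) x)).
    by move=> n; apply: measurable_lsum_sum.
  move=> x; rewrite indicE; case: (pselect ((\bigcup_k F k) x)) => [Fx|nFx].
    rewrite mem_set//=; case: Fx => k _ Fk.
    apply: cvg_near_cst; exists k.+1 => // n /= kn.
    rewrite (bigD1_seq k)/= ?mem_iota ?iota_uniq// indicE mem_set//= big1 ?addr0// => i ik.
    rewrite indicE memNset// => Fi; move/eqP: ik; apply.
    by apply: (tF i k) => //; exists x.
  rewrite memNset//=.
  rewrite (_ : (fun n => _) = cst 0); first exact: cvg_cst.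
  apply/funext => n; rewrite big1// => i _; rewrite indicE memNset// => Fi.
  by apply: nFx; exists i.
Qed.

Import HBNNSimple.

Let ge0_measurable_lsum g : measurable_fun setT g -> (forall x, 0 <= g x) ->
  measurable_fun setT (lsum g).
Proof.
move=> mg g0.
have mg' : measurable_fun setT (EFin \o g) by exact/measurable_EFinP.
have g0' x : setT x -> (0 <= (EFin \o g) x)%E by rewrite /= lee_fin.
pose h := nnsfun_approx measurableT mg'.
apply: (@measurable_lsum_lim (fun n => h n)); last first.
  move=> x; have := cvg_nnsfun_approx measurableT mg' g0' (x := x) I.
  by move/fine_cvg.
move=> n; rewrite (funext (fimfunEord (h n))).
by apply: measurable_lsum_sum => i; apply: measurable_lsumZ; exact: measurable_lsum_indic.
Qed.

(** Indicators are covered by Dynkin's theorem, then simple functions by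
    linearity and all others by approximation, since a finite sum commutes with
    pointwise limits. *)
Lemma measurable_lsum g : measurable_fun setT g -> measurable_fun setT (lsum g).
Proof.
move=> mg; have mn : measurable_fun setT (fun x => `|g x|) by exact: measurableT_comp.
rewrite (_ : g = (fun x => 2^-1 * (`|g x| + g x) + (-1) * (2^-1 * (`|g x| - g x)))).
  apply: measurable_lsumD; last apply: measurable_lsumZ.
    apply: ge0_measurable_lsum => [|x].
      by apply: measurable_funM => //; exact: measurable_funD.
    by have := ler_norm (- g x); rewrite normrN; lra.
  apply: ge0_measurable_lsum => [|x]; last by have := ler_norm (g x); lra.
  by apply: measurable_funM => //; exact: measurable_funB.
by apply/funext => x; lra.
Qed.

End random_list.

(** * Configurations in compact subdisks *)

Section points.
Context {R : realType}.
Notation D := (@disk R).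
Implicit Types (r : R) (f g : R[i] -> R).

Lemma lipschitz_continuous f (C : R) :
  (forall x y, `|f x - f y| <= C * normc (x - y)) -> continuous (f : R[i]^o -> R).
Proof.
move=> fC x A /nbhs_ballP[e /= e0 eA].
have C1 : 0 < `|C| + 1 by rewrite ltr_wpDl.
have d0 : 0 < ((e / (`|C| + 1))%:C)%C :> R[i] by rewrite ltcR divr_gt0.
apply/(@nbhs_ballP R[i] R[i]^o); exists (((e / (`|C| + 1))%:C)%C) => //= y.
rewrite -ball_normE /= ltcR => xy; apply: eA; apply: (le_lt_trans (fC x y)).
rewrite ltr_pdivlMr// in xy; apply: (le_lt_trans _ xy).
rewrite mulrC ler_wpM2l ?normc_ge0// (le_trans (ler_norm _))// lerDl//.
Qed.

Lemma continuous_Re : continuous ((fun x => Re x) : R[i]^o -> R).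
Proof.
apply: (@lipschitz_continuous _ 1) => x y; rewrite mul1r.
by rewrite (_ : Re x - Re y = Re (x - y)) ?Re_le_normc//; case: x; case: y.
Qed.

Lemma continuous_Im : continuous ((fun x => Im x) : R[i]^o -> R).
Proof.
apply: (@lipschitz_continuous _ 1) => x y; rewrite mul1r.
by rewrite (_ : Im x - Im y = Im (x - y)) ?Im_le_normc//; case: x; case: y.
Qed.

Lemma continuous_normc : continuous ((fun x => normc x) : R[i]^o -> R).
Proof.
apply: (@lipschitz_continuous _ 1) => x y; rewrite mul1r ler_norml.
have := normcB_ge x y; have := normcB_ge y x.
have -> : normc (y - x) = normc (x - y) by rewrite -opprB normcN.
by move=> *; apply/andP; split; lra.
Qed.

Definition cdisk r : set R[i] := [set z | normc z <= r].

Lemma cdisk_disk r : r < 1 -> cdisk r `<=` D.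
Proof. by move=> r1 z /le_lt_trans; exact. Qed.

Lemma continuous_complex_of_pair :
  continuous (@complex_of_pair R : R * R -> R[i]^o).
Proof.
move=> p A /(@nbhs_ballP R[i] R[i]^o)[e /= e0 eA].
have eE : e = ((Re e)%:C)%C by rewrite RRe_real// gtr0_real.
rewrite eE in e0 eA; move: (Re e) e0 eA => d; rewrite ltcR => d0 eA.
apply/nbhs_ballP; exists (d / 2) => /=; first by rewrite divr_gt0.
move=> q [/= h1 h2]; apply: eA; rewrite -ball_normE /= ltcR.
rewrite /ball /= in h1 h2; apply: (le_lt_trans (normc_le_ReIm _)) => /=.
by rewrite (splitr d); apply: ltrD.
Qed.

Lemma compact_cdisk r : compact (cdisk r : set R[i]^o).
Proof.
pose A : set (R * R) := [set p | normc (complex_of_pair p) <= r].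
have -> : cdisk r = @complex_of_pair R @` A.
  apply/seteqP; split => [z rz|_ [p Ap <-]//].
  by exists (Re z, Im z); rewrite /A /= /complex_of_pair /=; case: z rz.
apply: continuous_compact; first by apply: continuous_subspaceT; exact: continuous_complex_of_pair.
apply: (@subclosed_compact _ _ (`[- r, r]%classic `*` `[- r, r]%classic)).
- have -> : A = ((fun z => normc z) \o @complex_of_pair R) @^-1` [set x | x <= r] by [].
  apply: closed_comp; last exact: closed_le.
  move=> p _; apply: (@continuous_comp _ R[i]^o R); first exact: continuous_complex_of_pair.
  exact: continuous_normc.
- by apply: compact_setX; exact: segment_compact.
- move=> p /= Ap; rewrite !in_itv/= -!ler_norml.
  have h1 := Re_le_normc (complex_of_pair p); have h2 := Im_le_normc (complex_of_pair p).
  by split; [apply: le_trans h1 _|apply: le_trans h2 _].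
Qed.

(** A list, so that sums over the points are finite sums with no side
    condition. *)
Definition inner_points r (X : configuration R) : seq R[i] :=
  finmap.enum_fset (fset_set (points X `&` cdisk r)).

Lemma finite_inner_points r (X : configuration R) : r < 1 ->
  finite_set (points X `&` cdisk r).
Proof.
by move=> r1; apply: (points_locally_finite X); [exact: compact_cdisk|exact: cdisk_disk].
Qed.

Lemma mem_inner_points r (X : configuration R) x : r < 1 ->
  (x \in inner_points r X) = (x \in points X `&` cdisk r).
Proof. by move=> r1; rewrite in_fset_set//; exact: finite_inner_points. Qed.

Lemma inner_pointsP r (X : configuration R) x : r < 1 ->
  x \in inner_points r X -> points X x /\ normc x <= r.
Proof. by move=> r1; rewrite mem_inner_points// inE. Qed.

Lemma inner_points_uniq r (X : configuration R) : uniq (inner_points r X).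
Proof. exact: finmap.fset_uniq. Qed.

(** With values in any V: this covers sums of real numbers and of functions. *)
Lemma sum_points (V : nmodType) r (X : configuration R) (f : R[i] -> V) : r < 1 ->
  (forall x, D x -> r < normc x -> f x = 0) ->
  \sum_(x \in points X) f x = \sum_(x <- inner_points r X) f x.
Proof.
move=> r1 f0; rewrite (fsbigE (inner_points r X)).
- by rewrite big_seq_cond [RHS]big_seq_cond; apply: eq_bigl => x;
    case: (boolP (x \in inner_points r X)) => //= /(inner_pointsP r1)[Xx _]; rewrite mem_set.
- exact: inner_points_uniq.
- by move=> x /= /(inner_pointsP r1)[].
- move=> x Xx; rewrite mem_inner_points// => xX; apply: f0; first exact: (points_disk Xx).
  by rewrite ltNge; apply: contra xX => xr; rewrite inE.
Qed.

Lemma evaluation_continuous (I : Type) (i : I) :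
  continuous (fun p : prod_topology (fun _ : I => R) => p i).
Proof.
move=> p; have /cvg_sup/(_ i)/cvg_image : p --> p by apply: cvg_id.
move=> h; apply: cvg_trans (h _) => {h}.
  by move=> Q /= [W nbdW <-]; apply: filterS nbdW; exact: preimage_image.
by rewrite eqEsubset; split => y //; exists (fun=> y).
Qed.

(** Linear statistics of test functions are continuous for the vague topology,
    hence Borel. *)
Lemma measurable_linear_statistic (f : test_fun R) :
  measurable_fun setT (fun X : configuration R => \sum_(x \in points X) sval f x).
Proof.
apply: (measurability _ (RGenOInfty.measurableE R)).
move=> _ [_ [a ->] <-]; rewrite setTI; apply: sub_sigma_algebra.
exists ((fun p : prod_topology (fun _ : test_fun R => R) => p f) @^-1` `]a, +oo[%classic) => //.
apply: open_comp; first by move=> p _; exact: evaluation_continuous.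
by rewrite set_itvoy; exact: open_gt.
Qed.

End points.

(** * Measurability of linear statistics *)

Section continuous_operations.
Context {R : realType} {T : topologicalType}.
Implicit Types f g : T -> R.

Lemma continuous_mul f g : continuous f -> continuous g ->
  continuous (fun x => f x * g x).
Proof. by move=> cf cg x; apply: cvgM; [exact: cf|exact: cg]. Qed.

Lemma continuous_maxl0 f : continuous f -> continuous (fun x => Num.max 0 (f x)).
Proof.
by move=> cf x; apply: (@continuous_max _ _ (fun=> 0) f x); [exact: cvg_cst|exact: cf].
Qed.

Lemma continuous_aff f (a b : R) : continuous f -> continuous (fun x => a * f x + b).
Proof.
move=> cf x; apply: cvgD; last exact: cvg_cst.
by apply: cvgM; [exact: cvg_cst|exact: cf].
Qed.

Lemma continuous_one : continuous (fun _ : T => 1 : R).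
Proof. by move=> x; exact: cvg_cst. Qed.

End continuous_operations.

Section inner_measurability.
Context {R : realType}.
Notation D := (@disk R).
Implicit Types (r : R) (f g : R[i] -> R).

(** Equal to 1 on the closed disk of radius r, supported in the disk of radius
    (1 + r) / 2, and converging to the indicator of the former as n grows. *)
Definition cutoff r (n : nat) (x : R[i]) : R :=
  Num.max 0 (1 - n.+1%:R * (2 / (1 - r)) * Num.max 0 (normc x - r)).

Lemma continuous_cutoff r n : continuous (cutoff r n : R[i]^o -> R).
Proof.
rewrite (_ : cutoff r n = (fun x => Num.max 0 (- (n.+1%:R * (2 / (1 - r))) * Num.max 0 (1 * normc x + - r) + 1))).
  apply: (@continuous_maxl0 _ R[i]^o); apply: (@continuous_aff _ R[i]^o); apply: (@continuous_maxl0 _ R[i]^o).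
  by apply: (@continuous_aff _ R[i]^o); exact: continuous_normc.
by apply/funext => x; rewrite /cutoff mul1r addrC mulNr.
Qed.

Lemma cutoff_out r n x : r < 1 -> (1 + r) / 2 <= normc x -> cutoff r n x = 0.
Proof.
move=> r1 xr; rewrite /cutoff (_ : Num.max 0 (normc x - r) = normc x - r); last by apply: max_r; lra.
have r0 : 0 < 1 - r by lra.
apply: max_l; rewrite subr_le0 -mulrA -[X in X <= _]mulr1 -{1}[1]mulr1 ler_pM//.
  by rewrite mul1r ler1n.
by rewrite mulrAC ler_pdivlMr//; lra.
Qed.

Lemma cutoff_cvg r x : r < 1 -> cutoff r n x @[n --> \oo] --> (\1_(cdisk r) x : R).
Proof.
move=> r1; have r0 : 0 < 1 - r by lra.
rewrite indicE; have [xr|xr] := leP (normc x) r.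
  rewrite mem_set//= (_ : (fun n => _) = cst 1); first exact: cvg_cst.
  apply/funext => n; rewrite /cutoff (_ : Num.max 0 (normc x - r) = 0); last by apply: max_l; lra.
  by rewrite mulr0 subr0; apply: max_r.
rewrite memNset/=; last by rewrite /cdisk /=; lra.
pose d := 2 / (1 - r) * (normc x - r).
have d0 : 0 < d by rewrite mulr_gt0 ?divr_gt0// subr_gt0.
apply: cvg_near_cst; exists (Num.trunc d^-1) => // n /= nd.
rewrite /cutoff (_ : Num.max 0 (normc x - r) = normc x - r); last by apply: max_r; lra.
apply: max_l; rewrite subr_le0 -mulrA -/d -ler_pdivrMr// mul1r.
apply: (le_trans (ltW (truncnS_gt _))); rewrite ler_nat ltnS//.
Qed.

(** A generating pi-system adapted to the vague topology, for which statistics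
    of continuous functions are the measurable ones to start from. *)
Definition continuity_limit_set : set (set R[i]) :=
  [set B | measurable B /\ exists2 h : nat -> R[i] -> R,
     (forall n, continuous (h n : R[i]^o -> R)) &
     forall x, h n x @[n --> \oo] --> (\1_B x : R)].

Lemma continuity_limit_setI : setI_closed continuity_limit_set.
Proof.
move=> A B [mA [h ch hA]] [mB [k ck kB]]; split; first exact: measurableI.
exists (fun n x => h n x * k n x); first by move=> n; exact: (@continuous_mul _ R[i]^o).
move=> x; rewrite indicI /=; exact: cvgM.
Qed.

Lemma continuity_limit_setT : continuity_limit_set setT.
Proof.
split => //; exists (fun _ _ => 1); first by move=> n; exact: (@continuous_one _ R[i]^o).
by move=> x; rewrite indicE in_setT; exact: cvg_cst.
Qed.

Lemma continuity_limit_half f (a : R) : measurable_fun setT f ->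
  continuous (f : R[i]^o -> R) -> continuity_limit_set (f @^-1` `]a, +oo[).
Proof.
move=> mf cf; split; first by rewrite -[X in measurable X]setTI; apply: mf => //.
exists (fun n x => 1 - Num.max 0 (1 - n%:R * Num.max 0 (f x - a))).
  move=> n; rewrite (_ : (fun x => _) = (fun x => -1 * Num.max 0 (- n%:R * Num.max 0 (1 * f x + - a) + 1) + 1)).
    apply: (@continuous_aff _ R[i]^o); apply: (@continuous_maxl0 _ R[i]^o); apply: (@continuous_aff _ R[i]^o).
    by apply: (@continuous_maxl0 _ R[i]^o); exact: (@continuous_aff _ R[i]^o).
  by apply/funext => x; rewrite mulN1r mulNr mul1r addrC; congr (- Num.max _ _ + _); rewrite addrC.
move=> x; rewrite indicE; have [fa|fa] := leP (f x) a.
  rewrite memNset/=; last by rewrite in_itv/= andbT; lra.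
  rewrite (_ : (fun n => _) = cst 0); first exact: cvg_cst.
  apply/funext => n; rewrite (_ : Num.max 0 (f x - a) = 0); last by apply: max_l; lra.
  by rewrite mulr0 subr0 (_ : Num.max 0 1 = 1) ?subrr//; apply: max_r.
rewrite mem_set/=; last by rewrite in_itv/= andbT.
have d0 : 0 < f x - a by lra.
apply: cvg_near_cst; exists (Num.trunc (f x - a)^-1).+1 => // n /= nd.
rewrite (_ : Num.max 0 (f x - a) = f x - a); last by apply: max_r; lra.
rewrite (_ : Num.max 0 _ = 0) ?subr0//; apply: max_l; rewrite subr_le0 -ler_pdivrMr// mul1r.
by apply: (le_trans (ltW (truncnS_gt _))); rewrite ler_nat.
Qed.

Lemma continuity_limit_generate : @measurable _ R[i] = <<s continuity_limit_set >>.
Proof.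
apply/seteqP; split; last first.
  by apply: smallest_sub; [exact: sigma_algebra_measurable|move=> B []].
move=> B mB.
have mr : measurable_fun [set: g_sigma_algebraType continuity_limit_set] (fun x => Re x : R).
  apply: (measurability _ (RGenOInfty.measurableE R)) => _ [_ [a ->] <-].
  rewrite setTI; apply: sub_sigma_algebra; apply: continuity_limit_half.
    exact: measurable_Re.
  exact: continuous_Re.
have mi : measurable_fun [set: g_sigma_algebraType continuity_limit_set] (fun x => Im x : R).
  apply: (measurability _ (RGenOInfty.measurableE R)) => _ [_ [a ->] <-].
  rewrite setTI; apply: sub_sigma_algebra; apply: continuity_limit_half.
    exact: measurable_Im.
  exact: continuous_Im.
have := measurable_fun_pair mr mi measurableT mB.
by rewrite setTI; congr (measurable _ -> _) || (rewrite (_ : _ @^-1` _ = B)//; apply/seteqP; split => x; rewrite /preimage /= /complex_of_pair /=; case: x).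
Qed.

(** The cutoffs turn the approximating continuous functions into test
    functions, and the sum over a fixed finite set commutes with the limit. *)
Lemma measurable_inner_lim r (h : nat -> R[i] -> R) g : r < 1 ->
  (forall n, continuous (h n : R[i]^o -> R)) ->
  (forall x, h n x @[n --> \oo] --> g x) ->
  measurable_fun [set: configuration R] (lsum (inner_points r) g).
Proof.
move=> r1 ch hg; pose r' := (1 + r) / 2.
have r'1 : r' < 1 by rewrite /r'; lra.
have out n x : r' <= normc x -> h n x * cutoff r n x = 0.
  by move=> xr; rewrite cutoff_out// mulr0.
have tf n : exists f : test_fun R, sval f = (fun x => h n x * cutoff r n x).
  unshelve eexists (exist _ (fun x => h n x * cutoff r n x) _) => //; split.
    by apply: (@continuous_mul _ R[i]^o) => //; exact: continuous_cutoff.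
  exists (cdisk r'); split; [exact: compact_cdisk|exact: cdisk_disk|].
  move=> x; apply: contraNP => /negP; rewrite -ltNge => xr; apply/eqP.
  exact: out (ltW xr).
apply: (@measurable_fun_cvg _ _ _ _ (fun n (X : configuration R) => \sum_(x \in points X) (h n x * cutoff r n x))).
  by move=> n; have [f fE] := tf n; have := measurable_linear_statistic f; rewrite fE.
move=> X _.
have -> : lsum (inner_points r) g X = \sum_(x <- inner_points r' X) (g x * \1_(cdisk r) x).
  rewrite -sum_points//; last first.
    move=> x _ xr; rewrite indicE memNset ?mulr0//= /cdisk/=; move: xr; rewrite /r'; lra.
  rewrite (@sum_points _ _ r)//; last first.
    by move=> x _ xr; rewrite indicE memNset ?mulr0//= /cdisk/=; lra.
  rewrite /lsum !big_seq; apply: eq_bigr => x /(inner_pointsP r1)[_ xr].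
  by rewrite indicE mem_set// mulr1.
under eq_fun do rewrite (@sum_points _ _ r' X _ r'1 (fun x _ xr => out _ x (ltW xr))).
apply: cvg_seq_sum => x; apply: cvgM => //; exact: cutoff_cvg.
Qed.

Lemma measurable_inner r g : r < 1 -> measurable_fun setT g ->
  measurable_fun [set: configuration R] (lsum (inner_points r) g).
Proof.
move=> r1; apply: (measurable_lsum continuity_limit_generate continuity_limit_setI).
  by move=> B [_ [h ch hB]]; exact: measurable_inner_lim r1 ch hB.
by have [_ [h ch hB]] := continuity_limit_setT; exact: measurable_inner_lim r1 ch hB.
Qed.

Definition inner_pairs r (X : configuration R) : seq (R[i] * R[i]) :=
  [seq (x, y) | x <- inner_points r X, y <- inner_points r X].

Lemma lsum_pairs r (g : R[i] * R[i] -> R) X :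
  lsum (inner_pairs r) g X = \sum_(x <- inner_points r X) \sum_(y <- inner_points r X) g (x, y).
Proof. by rewrite /lsum /inner_pairs big_allpairs_dep. Qed.

(** For a product set, the sum over pairs is the product of two sums over
    points. *)
Lemma measurable_inner_pairs r (g : R[i] * R[i] -> R) : r < 1 -> measurable_fun setT g ->
  measurable_fun [set: configuration R] (lsum (inner_pairs r) g).
Proof.
move=> r1; pose G := [set A `*` B | A in @measurable _ R[i] & B in @measurable _ R[i]].
apply: (@measurable_lsum _ _ _ _ _ _ G).
- by rewrite measurable_prod_measurableType.
- move=> _ _ [A mA [B mB <-]] [A' mA' [B' mB' <-]]; rewrite -setXI.
  by exists (A `&` A'); [exact: measurableI|exists (B `&` B') => //; exact: measurableI].
- move=> _ [A mA [B mB <-]].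
  rewrite (_ : lsum _ _ = (fun X => lsum (inner_points r) (\1_A : R[i] -> R) X * lsum (inner_points r) (\1_B : R[i] -> R) X)).
    by apply: measurable_funM; apply: measurable_inner => //; exact: measurable_indic.
  apply/funext => X; rewrite lsum_pairs /lsum big_distrlr/=.
  apply: eq_bigr => x _; apply: eq_bigr => y _; rewrite !indicE in_setX.
  by case: (x \in A); case: (y \in B); rewrite /= ?mul0r ?mulr0 ?mulr1.
- rewrite (_ : lsum _ _ = (fun X => lsum (inner_points r) (fun=> 1) X * lsum (inner_points r) (fun=> 1) X)).
    by apply: measurable_funM; apply: measurable_inner => //; exact: measurable_cst.
  apply/funext => X; rewrite lsum_pairs /lsum big_distrlr/=.
  by apply: eq_bigr => x _; apply: eq_bigr => y _; rewrite indicE in_setT mulr1.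
Qed.

End inner_measurability.

(** * Correlation formulas for nonnegative functions *)

Section esum_lists.
Context {R : realType} {T : choiceType}.
Implicit Types (A B : set T) (F : T -> \bar R).

Lemma esum_seq (l : seq T) F : uniq l -> (forall x, 0 <= F x)%E ->
  (\esum_(x in [set` l]) F x = \sum_(x <- l) F x)%E.
Proof.
move=> ul F0; rewrite (esum_fset (finite_seq l))//.
by rewrite -fsbig_seq.
Qed.

Lemma esum_support A B F : B `<=` A -> (forall x, A x -> ~ B x -> F x = 0%E) ->
  (\esum_(x in A) F x = \esum_(x in B) F x)%E.
Proof.
move=> BA F0; rewrite esum_mkcond [RHS]esum_mkcond; apply: eq_esum => x _.
case: ifPn; rewrite ?inE ?notin_setE => Ax; case: ifPn; rewrite ?inE ?notin_setE => Bx //.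
  exact: F0.
by have := BA _ Bx.
Qed.

End esum_lists.

Section correlation.
Context {R : realType}.
Notation D := (@disk R).

Definition kernel1 (x : R[i]) : R := Re (bergman_kernel x x).
Definition kernel2 (x y : R[i]) : R :=
  Re (bergman_kernel x x * bergman_kernel y y - bergman_kernel x y * bergman_kernel y x).

(** The second correlation function only describes pairs of distinct points. *)
Definition offdiag (k : R[i] * R[i] -> R) (p : R[i] * R[i]) : R :=
  if p.1 == p.2 then 0 else k p.

Variable r : R.
Hypothesis r1 : r < 1.

Lemma esum_points (g : R[i] -> R) (X : configuration R) : (forall x, 0 <= g x) ->
  (forall x, D x -> r < normc x -> g x = 0) ->
  (\esum_(t in @distinct_tuples R 1 (points X)) (g (tnth t ord0))%:E =
   (lsum (inner_points r) g X)%:E)%E.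
Proof.
move=> g0 gs; pose l : seq (1.-tuple R[i]) := [seq [tuple x] | x <- inner_points r X].
have ul : uniq l.
  rewrite map_inj_uniq ?inner_points_uniq// => x y /(congr1 (fun t : 1.-tuple R[i] => tnth t ord0)).
  by [].
rewrite (@esum_support _ _ _ [set` l]).
- rewrite (esum_seq ul) => [|t]; last by rewrite lee_fin.
  by rewrite /l big_map /lsum sumEFin.
- move=> _ /= /mapP[x /(inner_pointsP r1)[Xx _] ->]; split => // i.
  by rewrite (ord1 i).
- move=> t [_ Xt] /= tl; congr EFin; apply: gs.
    exact: points_disk (Xt ord0).
  rewrite ltNge; apply/negP => tr; apply: tl; apply/mapP; exists (tnth t ord0).
    by rewrite mem_inner_points// inE; split.
  by apply: eq_from_tnth => i; rewrite (ord1 i).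
Qed.

Lemma esum_pairs (k : R[i] * R[i] -> R) (X : configuration R) : (forall p, 0 <= k p) ->
  (forall x y, D x -> D y -> r < normc x \/ r < normc y -> k (x, y) = 0) ->
  (\esum_(t in @distinct_tuples R 2 (points X)) (k (tnth t ord0, tnth t ord_max))%:E =
   (lsum (inner_pairs r) (offdiag k) X)%:E)%E.
Proof.
move=> k0 ks.
pose l : seq (2.-tuple R[i]) := [seq [tuple p.1; p.2] | p <- inner_pairs r X & p.1 != p.2].
have ul : uniq l.
  rewrite map_inj_uniq.
    apply: filter_uniq; apply: allpairs_uniq; [exact: inner_points_uniq|exact: inner_points_uniq|].
    by move=> [? ?] [? ?].
  by move=> [a b] [c d] /(congr1 val) /= [-> ->].
rewrite (@esum_support _ _ _ [set` l]).
- rewrite (esum_seq ul) => [|t]; last by rewrite lee_fin.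
  rewrite /l big_map big_filter /lsum sumEFin; congr EFin.
  rewrite big_mkcond/=; apply: eq_bigr => -[x y] _ /=.
  by rewrite /offdiag /=; case: eqP.
- move=> t /= /mapP[[x y]]; rewrite mem_filter => /andP[/= xy /allpairsP[[a b] /=]].
  move=> [/(inner_pointsP r1)[Xa _] /(inner_pointsP r1)[Xb _] [ea eb]] ->.
  split; first by rewrite /= inE xy.
  by rewrite ea eb; case; case => [|[|]].
- move=> t [ut Xt] /= tl; congr EFin; apply: ks.
  + exact: points_disk (Xt _).
  + exact: points_disk (Xt _).
  case: (leP (normc (tnth t ord0)) r) => [t0|]; last by left.
  case: (leP (normc (tnth t ord_max)) r) => [t1|]; last by right.
  exfalso; apply: tl; apply/mapP; exists (tnth t ord0, tnth t ord_max).
    rewrite mem_filter /=; apply/andP; split.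
      by apply/negP => /eqP /(tuple_uniqP _ ut).
    apply/allpairsP; exists (tnth t ord0, tnth t ord_max); split => //=;
      by rewrite mem_inner_points// inE; split.
  apply: eq_from_tnth => i /=.
  by case: i => -[|[|]]// i; rewrite (tnth_nth 0) [RHS](tnth_nth 0)/= (tnth_nth 0).
Qed.

Variable P : probability (configuration R) R.
Hypothesis P_dpp : determinantal P (@bergman_kernel R).

Lemma ge0_correlation1 (g : R[i] -> R) : measurable_fun setT g -> (forall x, 0 <= g x) ->
  (forall x, D x -> r < normc x -> g x = 0) ->
  (\int[P]_X (lsum (inner_points r) g X)%:E = \int[dA]_(x in D) (g x * kernel1 x)%:E)%E.
Proof.
move=> mg g0 gs; under eq_integral do rewrite -esum_points//.
have -> := (P_dpp (n := 1) isT) (fun t => (g (tnth t ord0))%:E).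
- apply: eq_integral => x _ /=; rewrite -EFinM; congr (_ * _)%:E.
  by rewrite det_mx11 mxE.
- apply/measurable_EFinP; apply: (measurableT_comp mg); exact: measurable_tnth.
- by move=> t; rewrite lee_fin.
Qed.

Lemma ge0_correlation2 (k : R[i] * R[i] -> R) : measurable_fun setT k -> (forall p, 0 <= k p) ->
  (forall x y, D x -> D y -> r < normc x \/ r < normc y -> k (x, y) = 0) ->
  (\int[P]_X (lsum (inner_pairs r) (offdiag k) X)%:E =
   \int[dA]_(x in D) \int[dA]_(y in D) (k (x, y) * kernel2 x y)%:E)%E.
Proof.
move=> mk k0 ks; under eq_integral do rewrite -esum_pairs//.
have -> := (P_dpp (n := 2) isT) (fun t => (k (tnth t ord0, tnth t ord_max))%:E).
- apply: eq_integral => x _ /=; apply: eq_integral => y _ /=; rewrite -EFinM; congr EFin.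
  congr (k (_, _) * _).
  rewrite /kernel2 (expand_det_row _ ord0) !big_ord_recl big_ord0 /cofactor !det_mx11 !mxE/=.
  congr Re; rewrite /bump /=; ring.
- apply/measurable_EFinP; apply: (measurableT_comp mk).
  by apply: measurable_fun_pair; exact: measurable_tnth.
- by move=> t; rewrite lee_fin.
Qed.

End correlation.

(** * Double integrals of bounded functions *)

Section double_integral.
Context {R : realType}.
Notation D := (@disk R).
Notation dA2 := (@dA R \x @dA R)%E.
Implicit Types F G : R[i] * R[i] -> R.

Definition dint2 F : R := \int[dA]_(x in D) \int[dA]_(y in D) F (x, y).

Definition bounded2 F := measurable_fun setT F /\
  exists M : R, forall x y, D x -> D y -> `|F (x, y)| <= M.

Let mD := @measurable_disk R.
Let mDD : measurable (D `*` D). Proof. exact: measurableX. Qed.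

Lemma bounded2_integrable F : bounded2 F -> dA2.-integrable (D `*` D) (EFin \o F).
Proof.
move=> [mF [M FM]]; apply: measurable_bounded_integrable => //.
- have E : dA2 (D `*` D) = 1%E.
    by rewrite product_measure1E// -[LHS]/(dA D * dA D)%E !dA_disk mule1.
  by rewrite [X in (X < _)%E]E ltry.
- exact: measurable_funTS.
- exists M; split; first exact: num_real.
  by move=> y My [a b] [/= Da Db]; apply: (le_trans (FM a b Da Db)); exact: ltW.
Qed.

Lemma bounded2_section F x : bounded2 F -> D x -> dA.-integrable D (fun y => (F (x, y))%:E).
Proof.
move=> [mF [M FM]] Dx; apply: (@integrable_disk_bounded _ (fun y => F (x, y)) M).
  have mp : measurable_fun setT (fun y : R[i] => (x, y)) by apply: measurable_fun_pair; meas.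
  exact: measurable_funTS (measurableT_comp mF mp).
by move=> y Dy; exact: FM.
Qed.

Let patch2 F x y : ((EFin \o F) \_ (D `*` D)) (x, y) =
  if x \in D then ((fun y => (F (x, y))%:E) \_ D) y else 0%E.
Proof. by rewrite !patchE in_setX /=; case: (x \in D) => //=. Qed.

(** Both integrals are values of the integral over the product disk, which
    makes double integrals linear and symmetric. *)
Lemma dint2_prod F : bounded2 F ->
  (\int[dA]_(x in D) \int[dA]_(y in D) (F (x, y))%:E)%E = (dint2 F)%:E /\
  dint2 F = \int[dA2]_(p in D `*` D) F p.
Proof.
move=> bF; have iF := bounded2_integrable bF.
have iF' : dA2.-integrable setT ((EFin \o F) \_ (D `*` D)).
  by apply/(integrable_mkcond _ mDD).
have E : (\int[dA]_(x in D) \int[dA]_(y in D) (F (x, y))%:E =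
    \int[dA2]_(p in D `*` D) (F p)%:E)%E.
  rewrite [RHS]integral_mkcond -(integral12_prod_meas1 iF') [LHS]integral_mkcond.
  apply: eq_integral => x _; rewrite /fubini_F patchE.
  under [RHS]eq_integral do rewrite patch2.
  case: ifPn => xD; last by rewrite integral0.
  by rewrite [LHS]integral_mkcond.
have E2 : dint2 F = \int[dA2]_(p in D `*` D) F p.
  rewrite /dint2 /Rintegral -E; congr fine; apply: eq_integral => x; rewrite inE => Dx.
  by rewrite fineK//; apply: integrable_fin_num => //; exact: bounded2_section.
by split => //; rewrite E E2 /Rintegral fineK//; exact: integrable_fin_num.
Qed.

Lemma bounded2_marginal F : bounded2 F ->
  dA.-integrable D (fun x => (\int[dA]_(y in D) F (x, y))%:E).
Proof.
move=> bF; have iF := bounded2_integrable bF.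
have iF' : dA2.-integrable setT ((EFin \o F) \_ (D `*` D)).
  by apply/(integrable_mkcond _ mDD).
have := integrableS measurableT mD (@subsetT _ D) (integrable_fubini_F iF').
apply: eq_integrable => // x; rewrite inE => Dx; rewrite /fubini_F.
under eq_integral do rewrite patch2 mem_set//.
rewrite -integral_mkcond /Rintegral fineK//.
by apply: integrable_fin_num => //; exact: bounded2_section.
Qed.

(** Fubini's theorem lets the substitution be made in one variable at a time. *)
Lemma dint2_change (T : R[i] -> R[i]) (J : R[i] -> R) F :
  (forall f : R[i] -> R, dA.-integrable D (EFin \o f) ->
     dA.-integrable D (fun x => (f (T x) * J x)%:E) /\
     \int[dA]_(x in D) (f (T x) * J x) = \int[dA]_(x in D) f x) ->
  (forall x, D x -> D (T x)) -> bounded2 F ->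
  dint2 (fun p => F (T p.1, T p.2) * (J p.1 * J p.2)) = dint2 F.
Proof.
move=> TJ DT bF; rewrite /dint2 -(TJ _ (bounded2_marginal bF)).2.
apply: eq_Rintegral => x; rewrite inE => Dx.
have [i1 <-] := TJ _ (bounded2_section bF (DT x Dx)).
rewrite -RintegralZr//; apply: eq_Rintegral => y _ /=.
by rewrite -mulrA (mulrC (J x)).
Qed.

Lemma dint2_swap F : bounded2 F -> dint2 F = \int[dA]_(y in D) \int[dA]_(x in D) F (x, y).
Proof.
move=> bF; have iF := bounded2_integrable bF.
have iF' : dA2.-integrable setT ((EFin \o F) \_ (D `*` D)).
  by apply/(integrable_mkcond _ mDD).
rewrite (dint2_prod bF).2 /Rintegral integral_mkcond -(integral21_prod_meas1 iF').
congr fine; rewrite [RHS]integral_mkcond; apply: eq_integral => y _.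
rewrite /fubini_G patchE; case: ifPn => yD; last first.
  by rewrite integral0_eq// => x _; rewrite patch2 patchE (negbTE yD); case: ifP.
have Dy : D y by rewrite inE in yD.
rewrite fineK; last first.
  apply: integrable_fin_num => //; case: bF => mF [M FM].
  apply: (@integrable_disk_bounded _ (fun x => F (x, y)) M).
    have mp : measurable_fun setT (fun x : R[i] => (x, y)) by apply: measurable_fun_pair; meas.
    exact: measurable_funTS (measurableT_comp mF mp).
  by move=> x Dx; exact: FM.
rewrite [RHS]integral_mkcond; apply: eq_integral => x _.
by rewrite patch2 !patchE yD.
Qed.

Lemma bounded2D F G : bounded2 F -> bounded2 G -> bounded2 (fun p => F p + G p).
Proof.
move=> [mF [M FM]] [mG [N GN]]; split; first exact: measurable_funD.
exists (M + N) => x y Dx Dy; apply: (le_trans (ler_normD _ _)).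
by apply: lerD; [exact: FM|exact: GN].
Qed.

Lemma bounded2Z (c : R) F : bounded2 F -> bounded2 (fun p => c * F p).
Proof.
move=> [mF [M FM]]; split; first exact: measurable_funM.
by exists (`|c| * M) => x y Dx Dy; rewrite normrM ler_wpM2l// FM.
Qed.

Lemma dint2D F G : bounded2 F -> bounded2 G ->
  dint2 (fun p => F p + G p) = dint2 F + dint2 G.
Proof.
move=> bF bG; rewrite (dint2_prod (bounded2D bF bG)).2 (dint2_prod bF).2 (dint2_prod bG).2.
by apply: RintegralD => //; exact: bounded2_integrable.
Qed.

Lemma bounded2B F G : bounded2 F -> bounded2 G -> bounded2 (fun p => F p - G p).
Proof.
move=> [mF [M FM]] [mG [N GN]]; split; first exact: measurable_funB.
exists (M + N) => x y Dx Dy; apply: (le_trans (ler_normB _ _)).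
by apply: lerD; [exact: FM|exact: GN].
Qed.

Lemma dint2B F G : bounded2 F -> bounded2 G ->
  dint2 (fun p => F p - G p) = dint2 F - dint2 G.
Proof.
move=> bF bG; rewrite (dint2_prod (bounded2B bF bG)).2 (dint2_prod bF).2 (dint2_prod bG).2.
by apply: RintegralB => //; exact: bounded2_integrable.
Qed.

Lemma dint2Z (c : R) F : bounded2 F -> dint2 (fun p => c * F p) = c * dint2 F.
Proof.
move=> bF; rewrite (dint2_prod (bounded2Z c bF)).2 (dint2_prod bF).2.
by apply: RintegralZl => //; exact: bounded2_integrable.
Qed.

Lemma eq_dint2 F G : (forall x y, D x -> D y -> F (x, y) = G (x, y)) -> dint2 F = dint2 G.
Proof.
move=> FG; apply: eq_Rintegral => x; rewrite inE => Dx.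
by apply: eq_Rintegral => y; rewrite inE => Dy; exact: FG.
Qed.

End double_integral.

(** * Kernel estimates and signed correlation formulas *)

Section kernel_facts.
Context {R : realType}.
Notation D := (@disk R).
Implicit Types (x y : R[i]) (r : R).

Lemma bergman_kernel_conj x y : conjc (bergman_kernel x y) = bergman_kernel y x.
Proof.
rewrite /bergman_kernel conjc_inv rmorphXn/=; congr (_ ^- 2).
case: x => a b; case: y => c d; apply/eqP; rewrite eq_complex/=.
by apply/andP; split; apply/eqP; ring.
Qed.

Lemma kernel1E x : kernel1 x = (1 - normc x ^+ 2) ^- 2.
Proof.
by rewrite /kernel1 /bergman_kernel -one_sub_normcE -rmorphXn -fmorphV.
Qed.

Lemma kernel1_ge0 x : 0 <= kernel1 x.
Proof. by rewrite kernel1E invr_ge0 sqr_ge0. Qed.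

(** The kernel is Hermitian. *)
Lemma kernel2E x y : kernel2 x y = kernel1 x * kernel1 y - normc (bergman_kernel x y) ^+ 2.
Proof.
rewrite /kernel2 -(bergman_kernel_conj x y) mulc_conj.
have K1 (u : R[i]) : bergman_kernel u u = ((kernel1 u)%:C)%C.
  by rewrite kernel1E /bergman_kernel -one_sub_normcE fmorphV rmorphXn.
by rewrite !K1 -rmorphM -rmorphB.
Qed.

Lemma normc_bergman_kernel r x y : r < 1 -> normc x <= r -> D y ->
  normc (bergman_kernel x y) <= (1 - r) ^- 2.
Proof.
move=> r1 xr Dy; rewrite /bergman_kernel normcV normcX.
have x1 : 0 < 1 - r by rewrite subr_gt0.
have h : 1 - r <= normc (1 - x * conjc y).
  apply: le_trans (normc1B_ge _); rewrite lerD2l lerN2 normcM normc_conj.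
  by apply: le_trans xr; rewrite ler_piMr ?normc_ge0// ltW.
rewrite lef_pV2 ?posrE ?exprn_gt0//; last exact: lt_le_trans h.
by rewrite ler_sqr ?nnegrE ?normc_ge0// ltW.
Qed.

Lemma kernel1_bound r x : r < 1 -> normc x <= r -> kernel1 x <= (1 - r) ^- 2.
Proof.
move=> r1 xr; have Dx : D x by exact: le_lt_trans r1.
apply: le_trans (normc_bergman_kernel r1 xr Dx).
exact: le_trans (ler_norm _) (Re_le_normc _).
Qed.

Lemma measurable_kernel d (T : measurableType d) (E : set T) (f g : T -> R[i]) :
  measurable_fun E f -> measurable_fun E g ->
  measurable_fun E (fun t => bergman_kernel (f t) (g t)).
Proof. by move=> mf mg; rewrite /bergman_kernel; meas. Qed.

Lemma measurable_kernel1 : measurable_fun setT (@kernel1 R).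
Proof.
by apply: (measurableT_comp (@measurable_Re R)); apply: measurable_kernel; exact: measurable_id.
Qed.

Lemma measurable_kernel2 : measurable_fun setT (fun p : R[i] * R[i] => kernel2 p.1 p.2).
Proof.
under eq_fun do rewrite kernel2E.
apply: measurable_funB; first apply: measurable_funM.
- exact: (measurableT_comp measurable_kernel1 measurable_fst).
- exact: (measurableT_comp measurable_kernel1 measurable_snd).
- apply: measurable_funX; apply: measurable_fun_normc.
  by apply: measurable_kernel; [exact: measurable_fst|exact: measurable_snd].
Qed.

Lemma measurable_offdiag (k : R[i] * R[i] -> R) : measurable_fun setT k ->
  measurable_fun setT (offdiag k).
Proof.
move=> mk; apply: measurable_fun_ifT => //.
rewrite (_ : (fun p : R[i] * R[i] => p.1 == p.2) = (fun p => normc (p.1 - p.2) == 0)).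
  apply: measurable_fun_eqr; last exact: measurable_cst.
  by apply: measurable_fun_normc; apply: measurable_funcB; [exact: measurable_fst|exact: measurable_snd].
by apply/funext => p; rewrite normc_eq0 subr_eq0.
Qed.

End kernel_facts.

Section signed_correlation.
Context {R : realType}.
Notation D := (@disk R).
Variables (r : R) (P : probability (configuration R) R).
Hypothesis r1 : r < 1.
Hypothesis P_dpp : determinantal P (@bergman_kernel R).

(** Defined on the whole plane, and carried by a disk of radius r < 1 because
    the kernel blows up at the unit circle. *)
Definition compact_weight (g : R[i] -> R) :=
  [/\ measurable_fun setT g, exists M : R, forall x, `|g x| <= M &
      forall x, r < normc x -> g x = 0].

Definition compact_weight2 (k : R[i] * R[i] -> R) :=
  [/\ measurable_fun setT k, exists M : R, forall p, `|k p| <= M &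
      forall x y, r < normc x \/ r < normc y -> k (x, y) = 0].

Lemma half_parts (a b : R) : a = 2^-1 * (b + a) - 2^-1 * (b - a).
Proof. lra. Qed.

Lemma compact_weight_kernel1 g : compact_weight g ->
  dA.-integrable D (fun x => (g x * kernel1 x)%:E).
Proof.
move=> [mg [M gM] gs]; apply: (@integrable_disk_bounded _ (fun x => g x * kernel1 x) (M * (1 - r) ^- 2)).
  by apply: measurable_funTS; apply: measurable_funM => //; exact: measurable_kernel1.
move=> x Dx; have M0 : 0 <= M by exact: le_trans (gM 0).
have [xr|/gs ->] := leP (normc x) r; last first.
  by rewrite mul0r normr0 mulr_ge0// invr_ge0 sqr_ge0.
rewrite normrM ler_pM// (ger0_norm (kernel1_ge0 x)); exact: kernel1_bound.
Qed.

Lemma compact_weight_kernel2 k : compact_weight2 k ->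
  bounded2 (fun p => k p * kernel2 p.1 p.2).
Proof.
move=> [mk [M kM] ks]; split; first by apply: measurable_funM => //; exact: measurable_kernel2.
have C0 : 0 <= (1 - r) ^- 2 by rewrite invr_ge0 sqr_ge0.
pose C := (1 - r) ^- 2; have M0 : 0 <= M by exact: le_trans (kM (0, 0)).
exists (M * (C ^+ 2 + C ^+ 2)) => x y Dx Dy /=.
have big : 0 <= M * (C ^+ 2 + C ^+ 2) by rewrite mulr_ge0// addr_ge0// sqr_ge0.
have [xr|xr] := leP (normc x) r; last by rewrite ks ?mul0r ?normr0//; left.
have [yr|yr] := leP (normc y) r; last by rewrite ks ?mul0r ?normr0//; right.
rewrite normrM ler_pM//= kernel2E; apply: (le_trans (ler_normB _ _)); apply: lerD.
  by rewrite ger0_norm ?mulr_ge0 ?kernel1_ge0// expr2 ler_pM ?kernel1_ge0// kernel1_bound.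
by rewrite ger0_norm ?sqr_ge0// ler_sqr ?nnegrE ?normc_ge0// normc_bergman_kernel.
Qed.

(** The signed case follows by splitting into positive and negative parts,
    which remain bounded weights. *)
Lemma correlation1 g : compact_weight g ->
  P.-integrable setT (fun X => (lsum (inner_points r) g X)%:E) /\
  \int[P]_X lsum (inner_points r) g X = \int[dA]_(x in D) (g x * kernel1 x).
Proof.
move=> gw; have [mg _ _] := gw.
have pos h : compact_weight h -> (forall x, 0 <= h x) ->
   P.-integrable setT (fun X => (lsum (inner_points r) h X)%:E) /\
   \int[P]_X lsum (inner_points r) h X = \int[dA]_(x in D) (h x * kernel1 x).
  move=> hw h0; have [mh _ hs] := hw.
  have E := ge0_correlation1 r1 P_dpp mh h0 (fun x _ => hs x).
  split; last by rewrite /Rintegral E.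
  apply/integrableP; split; first by apply/measurable_EFinP; exact: measurable_inner.
  under eq_integral do rewrite gee0_abs ?lee_fin ?sumr_ge0//.
  by rewrite E; apply/(integrable_lty (measurable_disk)) /compact_weight_kernel1.
pose g1 x := 2^-1 * (`|g x| + g x); pose g2 x := 2^-1 * (`|g x| - g x).
have w1 : compact_weight g1.
  case: gw => _ [M gM] gs; split.
  - by apply: measurable_funM => //; apply: measurable_funD => //; exact: measurableT_comp.
  - exists M => x; have := gM x; have := ler_norm (g x); have := ler_norm (- g x).
    by rewrite normrN /g1 => h1 h2 h3; rewrite ler_norml; apply/andP; split; lra.
  - by move=> x /gs xr; rewrite /g1 xr normr0 addr0 mulr0.
have w2 : compact_weight g2.
  case: gw => _ [M gM] gs; split.
  - by apply: measurable_funM => //; apply: measurable_funB => //; exact: measurableT_comp.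
  - exists M => x; have := gM x; have := ler_norm (g x); have := ler_norm (- g x).
    by rewrite normrN /g2 => h1 h2 h3; rewrite ler_norml; apply/andP; split; lra.
  - by move=> x /gs xr; rewrite /g2 xr normr0 subr0 mulr0.
have p1 x : 0 <= g1 x by have := ler_norm (- g x); rewrite normrN /g1; lra.
have p2 x : 0 <= g2 x by have := ler_norm (g x); rewrite /g2; lra.
have [i1 e1] := pos g1 w1 p1; have [i2 e2] := pos g2 w2 p2.
have gE : g = (fun x => g1 x - g2 x) by apply/funext => x; exact: half_parts.
have lE : lsum (inner_points r) g = (fun X => lsum (inner_points r) g1 X - lsum (inner_points r) g2 X).
  by apply/funext => X; rewrite /lsum -sumrB gE.
split.
  have := integrableB measurableT i1 i2; apply: eq_integrable => // X _.
  by rewrite lE.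
rewrite lE RintegralB// e1 e2 -RintegralB; [|exact: measurable_disk|exact: compact_weight_kernel1|exact: compact_weight_kernel1].
by apply: eq_Rintegral => x _; rewrite -mulrBl gE.
Qed.

Lemma correlation2 k : compact_weight2 k ->
  P.-integrable setT (fun X => (lsum (inner_pairs r) (offdiag k) X)%:E) /\
  \int[P]_X lsum (inner_pairs r) (offdiag k) X = dint2 (fun p => k p * kernel2 p.1 p.2).
Proof.
move=> gw; have [mk _ _] := gw.
have pos h : compact_weight2 h -> (forall x, 0 <= h x) ->
   P.-integrable setT (fun X => (lsum (inner_pairs r) (offdiag h) X)%:E) /\
   \int[P]_X lsum (inner_pairs r) (offdiag h) X = dint2 (fun p => h p * kernel2 p.1 p.2).
  move=> hw h0; have [mh _ hs] := hw.
  have := ge0_correlation2 r1 P_dpp mh h0 (fun x y _ _ => hs x y).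
  rewrite (dint2_prod (compact_weight_kernel2 hw)).1 => E.
  split; last by rewrite /Rintegral E.
  apply/integrableP; split.
    by apply/measurable_EFinP; apply: measurable_inner_pairs => //; exact: measurable_offdiag.
  have o0 p : 0 <= offdiag h p by rewrite /offdiag; case: ifP.
  by under eq_integral do rewrite gee0_abs ?lee_fin ?sumr_ge0//; rewrite E ltry.
pose g1 x := 2^-1 * (`|k x| + k x); pose g2 x := 2^-1 * (`|k x| - k x).
have w1 : compact_weight2 g1.
  case: gw => _ [M gM] gs; split.
  - by apply: measurable_funM => //; apply: measurable_funD => //; exact: measurableT_comp.
  - exists M => x; have := gM x; have := ler_norm (k x); have := ler_norm (- k x).
    by rewrite normrN /g1 => h1 h2 h3; rewrite ler_norml; apply/andP; split; lra.
  - by move=> x y /gs xr; rewrite /g1 xr normr0 addr0 mulr0.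
have w2 : compact_weight2 g2.
  case: gw => _ [M gM] gs; split.
  - by apply: measurable_funM => //; apply: measurable_funB => //; exact: measurableT_comp.
  - exists M => x; have := gM x; have := ler_norm (k x); have := ler_norm (- k x).
    by rewrite normrN /g2 => h1 h2 h3; rewrite ler_norml; apply/andP; split; lra.
  - by move=> x y /gs xr; rewrite /g2 xr normr0 subr0 mulr0.
have p1 x : 0 <= g1 x by have := ler_norm (- k x); rewrite normrN /g1; lra.
have p2 x : 0 <= g2 x by have := ler_norm (k x); rewrite /g2; lra.
have [i1 e1] := pos g1 w1 p1; have [i2 e2] := pos g2 w2 p2.
have gE x : k x = g1 x - g2 x by exact: half_parts.
have lE : lsum (inner_pairs r) (offdiag k) =
    (fun X => lsum (inner_pairs r) (offdiag g1) X - lsum (inner_pairs r) (offdiag g2) X).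
  apply/funext => X; rewrite /lsum -sumrB; apply: eq_bigr => p _.
  by rewrite /offdiag; case: ifP => _; rewrite ?subr0// gE.
split.
  have := integrableB measurableT i1 i2; apply: eq_integrable => // X _.
  by rewrite lE.
have b1 := compact_weight_kernel2 w1; have b2 := compact_weight_kernel2 w2.
rewrite lE (RintegralB measurableT i1 i2) e1 e2 -(dint2B b1 b2).
by apply: eq_dint2 => x y _ _ /=; rewrite -mulrBl -gE.
Qed.

End signed_correlation.

(** * Real combinations of kernels *)

Section bergman_geometry.
Context {R : realType}.
Notation D := (@disk R).
Implicit Types (f g h : R[i] -> R[i]) (l : seq (R * R[i])).

Let mD := @measurable_disk R.

(** Point evaluations are bounded: by the reproducing formula, and since the
    product of |K| and |h| is at most C^2 + |h|^2. *)
Lemma bergman_bound (r : R) h : r < 1 -> bergman_space h ->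
  exists M : R, forall x, normc x <= r -> normc (h x) <= M.
Proof.
move=> r1 hh; pose C : R := (1 - r) ^- 2.
have i2 := bergman_sq_integrable hh.
have iC : dA.-integrable D (fun=> (C ^+ 2)%:E).
  by apply: (@integrable_disk_bounded _ (fun=> C ^+ 2) (C ^+ 2)) => // x _; rewrite ger0_norm// sqr_ge0.
pose M := \int[dA]_(y in D) (C ^+ 2 + normc (h y) ^+ 2).
have iS : dA.-integrable D (fun y => (C ^+ 2 + normc (h y) ^+ 2)%:E).
  by have := integrableD mD iC i2; apply: eq_integrable => // y _.
have bR g x : bergman_space g -> (forall y, normc (g y) = normc (h y)) -> normc x <= r -> `|Re (g x)| <= M.
  move=> gg gh xr; have Dx : D x by exact: le_lt_trans r1.
  rewrite -(reproducing_Re gg Dx).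
  have ib := bergman_Re_integrable (bergman_F_space Dx) gg.
  apply: (le_trans (le_normr_Rintegral mD ib)); apply: le_Rintegral => //.
    exact: (integrable_abse ib).
  move=> y Dy; apply: (le_trans (Re_le_normc _)); rewrite normcM normc_conj gh.
  have K : normc (bergman_F x y) <= C.
    by rewrite /bergman_F -normc_conj bergman_kernel_conj normc_bergman_kernel.
  have := sqr_ge0 (C - normc (h y)); have := sqr_ge0 C; have := sqr_ge0 (normc (h y)).
  have := ler_wpM2r (normc_ge0 (h y)) K; rewrite sqrrB; lra.
exists (M + M) => x xr; apply: (le_trans (normc_le_ReIm _)); apply: lerD.
  exact: bR.
rewrite -normrN (_ : - Im (h x) = Re (Complex 0 1 * h x)).
  apply: (bR (fun y => Complex 0 1 * h y)) => //; first exact: bergmanZ.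
  by move=> y; rewrite normcM (_ : normc (Complex 0 1) = 1) ?mul1r// /normc/= expr0n/= add0r expr1n sqrtr1.
by case: (h x) => a b /=; ring.
Qed.

Lemma innerD f g h : bergman_space f -> bergman_space g -> bergman_space h ->
  inner (fun x => f x + g x) h = inner f h + inner g h.
Proof.
move=> ff gg hh; rewrite /inner.
rewrite [RHS](_ : _ = Complex
    (\int[dA]_(z in D) Re (f z * conjc (h z)) + \int[dA]_(z in D) Re (g z * conjc (h z)))
    (\int[dA]_(z in D) Im (f z * conjc (h z)) + \int[dA]_(z in D) Im (g z * conjc (h z))))//.
congr Complex; rewrite -RintegralD//; try exact: bergman_Re_integrable; try exact: bergman_Im_integrable.
  by apply: eq_Rintegral => x _; rewrite mulrDl ReE_add.
by apply: eq_Rintegral => x _; rewrite mulrDl ImE_add.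
Qed.

Lemma innerZ (c : R) f h : bergman_space f -> bergman_space h ->
  inner (fun x => (c%:C)%C * f x) h = (c%:C)%C * inner f h.
Proof.
move=> ff hh; rewrite /inner.
rewrite [RHS](_ : _ = Complex
    (c * \int[dA]_(z in D) Re (f z * conjc (h z)))
    (c * \int[dA]_(z in D) Im (f z * conjc (h z)))); last first.
  by rewrite /real_complex_def /= /GRing.mul /= !mul0r subr0 addr0.
congr Complex; rewrite -RintegralZl//; try exact: bergman_Re_integrable; try exact: bergman_Im_integrable.
  by apply: eq_Rintegral => x _; rewrite -mulrA ReE_mul /= mul0r subr0.
by apply: eq_Rintegral => x _; rewrite -mulrA ImE_mul /= mul0r addr0.
Qed.

Lemma sqnorm_inner f : bergman_space f -> sqnorm f = (Re (inner f f))%:E.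
Proof.
move=> ff; rewrite /sqnorm /inner /= /Rintegral fineK.
  by apply: eq_integral => x _; rewrite mulc_conj.
by apply: integrable_fin_num => //; exact: bergman_Re_integrable.
Qed.

Lemma bergmanB f g : bergman_space f -> bergman_space g ->
  bergman_space (fun x => f x - g x).
Proof.
move=> ff gg; have := bergmanD ff (bergmanZ (-1) gg).
by under eq_fun do rewrite mulN1r.
Qed.

Lemma innerB f g h : bergman_space f -> bergman_space g -> bergman_space h ->
  inner (fun x => f x - g x) h = inner f h - inner g h.
Proof.
move=> ff gg hh; rewrite /inner.
rewrite [RHS](_ : _ = Complex
    (\int[dA]_(z in D) Re (f z * conjc (h z)) - \int[dA]_(z in D) Re (g z * conjc (h z)))
    (\int[dA]_(z in D) Im (f z * conjc (h z)) - \int[dA]_(z in D) Im (g z * conjc (h z))))//.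
congr Complex; rewrite -RintegralB//; try exact: bergman_Re_integrable; try exact: bergman_Im_integrable.
  by apply: eq_Rintegral => x _; rewrite mulrBl; case: (f x * _) => a b; case: (g x * _).
by apply: eq_Rintegral => x _; rewrite mulrBl; case: (f x * _) => a b; case: (g x * _).
Qed.

Lemma Re_inner_sym f g : Re (inner f g) = Re (inner g f).
Proof.
rewrite /inner /=; apply: eq_Rintegral => x _.
by rewrite -Re_conj conjc_mul mulrC; case: (g x) => a b; rewrite /= opprK.
Qed.

(** Expands the squares bilinearly. Any choice of the mean gives the same
    variance, because only the functional that it represents matters. *)
Lemma sqnorm_represented y f g : bergman_space y -> bergman_space f -> bergman_space g ->
  (forall h, bergman_space h -> inner f h = inner g h) ->
  sqnorm (fun x => y x - f x) = sqnorm (fun x => y x - g x).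
Proof.
move=> yy ff gg fg; have yf := bergmanB yy ff; have yg := bergmanB yy gg.
rewrite !sqnorm_inner//; congr EFin.
rewrite innerB// fg// -innerB// Re_inner_sym.
by rewrite innerB// fg// -innerB.
Qed.

Definition kcomb l (x : R[i]) : R[i] := \sum_(p <- l) ((p.1)%:C)%C * bergman_F p.2 x.

Lemma kcomb_nil : kcomb [::] = fun=> 0.
Proof. by apply/funext => x; rewrite /kcomb big_nil. Qed.

Lemma kcomb_cons p l : kcomb (p :: l) = fun x => ((p.1)%:C)%C * bergman_F p.2 x + kcomb l x.
Proof. by apply/funext => x; rewrite /kcomb big_cons. Qed.

Lemma kcomb_bergman l : (forall p, p \in l -> D p.2) -> bergman_space (kcomb l).
Proof.
elim: l => [|p l IH] lD; first by rewrite kcomb_nil; exact: bergman0.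
rewrite kcomb_cons; apply: bergmanD.
  by apply: bergmanZ; apply: bergman_F_space; apply: lD; rewrite mem_head.
by apply: IH => q ql; apply: lD; rewrite inE ql orbT.
Qed.

Lemma inner_kcomb l h : (forall p, p \in l -> D p.2) -> bergman_space h ->
  inner (kcomb l) h = \sum_(p <- l) ((p.1)%:C)%C * conjc (h p.2).
Proof.
move=> lD hh; elim: l lD => [|p l IH] lD.
  rewrite kcomb_nil big_nil /inner.
  by congr Complex; rewrite [LHS](@eq_Rintegral _ _ _ _ _ (cst 0)) ?dint_cst// => x _; rewrite mul0r.
have Dp : D p.2 by apply: lD; rewrite mem_head.
have Dl q : q \in l -> D q.2 by move=> ql; apply: lD; rewrite inE ql orbT.
rewrite kcomb_cons big_cons innerD//; [|by apply: bergmanZ; exact: bergman_F_space|exact: kcomb_bergman].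
by rewrite innerZ ?reproducing ?IH//; exact: bergman_F_space.
Qed.

Lemma sqnorm_kcomb l : (forall p, p \in l -> D p.2) ->
  sqnorm (kcomb l) =
  (\sum_(p <- l) \sum_(q <- l) p.1 * q.1 * Re (bergman_kernel p.2 q.2))%:E.
Proof.
move=> lD; rewrite sqnorm_inner ?inner_kcomb//; try exact: kcomb_bergman.
congr EFin; elim: {1 3}l => [|p s IH]; first by rewrite !big_nil.
rewrite !big_cons ReE_add IH; congr (_ + _); rewrite ReE_mul /= mul0r subr0 Re_conj /kcomb.
elim: l {lD IH} => [|q l IH]; first by rewrite !big_nil mulr0.
rewrite !big_cons ReE_add mulrDr IH; congr (_ + _).
by rewrite ReE_mul /= mul0r subr0 mulrA.
Qed.

End bergman_geometry.

(** * The transported weight and its mean *)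

Section weights.
Context {R : realType}.
Notation D := (@disk R).
Implicit Types (r : R) (f g : R[i] -> R) (k B : R[i] * R[i] -> R).

Let mD := @measurable_disk R.

Lemma compact_radius (K : set R[i]^o) : compact K -> K `<=` D ->
  exists2 r : R, 0 <= r < 1 & forall x, K x -> normc x <= r.
Proof.
move=> cK KD; case: (pselect (K !=set0)) => [K0|nK]; last first.
  by exists 0; rewrite ?lexx ?ltr01// => x Kx; exfalso; apply: nK; exists x.
have cn : {within K, continuous ((fun x => normc x) : R[i]^o -> R)}.
  by apply: continuous_subspaceT; exact: continuous_normc.
have [c Kc cmax] := compact_EVT_max K0 cK cn.
exists (normc c); first by rewrite normc_ge0 /=; apply: KD; rewrite inE in Kc.
by move=> x Kx; apply: cmax; rewrite inE.
Qed.

(** The Schwarz-Pick identity at phi x, since phi is an involution. *)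
Lemma mobius_radius z (s : R) : D z -> 0 <= s < 1 ->
  exists2 r : R, s <= r < 1 & forall x, D x -> normc (mobius z x) <= s -> normc x <= r.
Proof.
move=> Dz /andP[s0 s1]; pose d := (1 - normc z ^+ 2) * (1 - s ^+ 2) / 4.
have s2 : s ^+ 2 < 1 by rewrite expr_lt1.
have d0 : 0 < d by rewrite divr_gt0// mulr_gt0// ?one_sub_sq_gt0// subr_gt0.
exists (Num.max s (1 - d / 2)); first by rewrite le_max lexx/= gt_max s1/=; lra.
move=> x Dx xs; rewrite le_max; apply/orP; right.
set y := mobius z x in xs; have d1 := disk_denom Dx Dz.
have Dy : D y by exact/disk_mobius.
have d2 := disk_denom Dy Dz.
have E := mobius_norm d2; rewrite (mobiusK Dz Dx) in E.
(* squared, this is the 4 in d *)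
have n2 : normc (1 - conjc z * y) <= 2.
  apply: (le_trans (le_normcD _ _)); rewrite normc1 normcN normcM normc_conj.
  by have := normcM_lt1 Dz Dy; rewrite normcM; lra.
have dx : d <= 1 - normc x ^+ 2.
  rewrite E /d; apply: ler_pM.
  - by rewrite mulr_ge0// ltW// ?one_sub_sq_gt0// subr_gt0.
  - by rewrite invr_ge0.
  - apply: ler_wpM2l; first by rewrite ltW// one_sub_sq_gt0.
    by rewrite lerD2l lerN2 ler_sqr ?nnegrE ?normc_ge0.
  - rewrite lef_pV2 ?posrE// ?exprn_gt0 ?normc_gt0//.
    by rewrite (_ : 4 = 2 ^+ 2) ?ler_sqr ?nnegrE ?normc_ge0//; ring.
have x0 := normc_ge0 x; rewrite leNgt; apply/negP => h.
have d1' : d <= 1 by have := sqr_ge0 (normc x); lra.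
have : (1 - d / 2) ^+ 2 < normc x ^+ 2 by rewrite ltr_sqr ?nnegrE ?normc_ge0//; lra.
by have := sqr_ge0 (d / 2); rewrite sqrrB; lra.
Qed.

Lemma compact_weightM r f (b : R[i] -> R) : r < 1 -> compact_weight r f -> measurable_fun D b ->
  (exists M : R, forall x, normc x <= r -> `|b x| <= M) ->
  compact_weight r (fun x => f x * b x).
Proof.
move=> r1 [mf [N fN] fs] mb [M bM]; split.
- rewrite (_ : (fun x => _) = (fun x => f x * b x) \_ D).
    by apply/(measurable_restrictT _ mD); apply: measurable_funM => //; exact: measurable_funTS.
  apply/funext => x; rewrite patchE; case: ifPn => // /negP xD.
  rewrite fs ?mul0r// ltNge; apply/negP => xr; apply: xD; rewrite inE.
  exact: le_lt_trans r1.
- exists (N * `|M|) => x; have N0 : 0 <= N by exact: le_trans (fN x).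
  have [xr|xr] := leP (normc x) r; last by rewrite fs// mul0r normr0 mulr_ge0.
  by rewrite normrM ler_pM// (le_trans (bM x xr))// ler_norm.
- by move=> x /fs ->; rewrite mul0r.
Qed.

Lemma compact_weight2M r k B : compact_weight2 r k -> measurable_fun setT B ->
  (exists M : R, forall x y, normc x <= r -> normc y <= r -> `|B (x, y)| <= M) ->
  compact_weight2 r (fun p => k p * B p).
Proof.
move=> [mk [N kN] ks] mB [M BM]; split; first exact: measurable_funM.
- exists (N * `|M|) => -[x y]; have N0 : 0 <= N by exact: le_trans (kN (x, y)).
  have [xr|xr] := leP (normc x) r; last by rewrite ks ?mul0r ?normr0 ?mulr_ge0//; left.
  have [yr|yr] := leP (normc y) r; last by rewrite ks ?mul0r ?normr0 ?mulr_ge0//; right.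
  by rewrite normrM ler_pM// (le_trans (BM x y xr yr))// ler_norm.
- by move=> x y /ks ->; rewrite mul0r.
Qed.

Lemma compact_weight_prod r f g : compact_weight r f -> compact_weight r g ->
  compact_weight2 r (fun p => f p.1 * g p.2).
Proof.
move=> [mf [M fM] fs] [mg [N gN] gs]; split.
- apply: measurable_funM; first exact: (measurableT_comp mf measurable_fst).
  exact: (measurableT_comp mg measurable_snd).
- by exists (M * N) => p; rewrite normrM ler_pM.
- by move=> x y [/fs|/gs] /= ->; rewrite ?mul0r ?mulr0.
Qed.

Lemma compact_weight2_bounded r k : compact_weight2 r k -> bounded2 k.
Proof. by move=> [mk [M kM] _]; split => //; exists M => x y _ _; exact: kM. Qed.

(** The measure K(x, x) dA(x) is invariant under Moebius maps. *)
Lemma kernel1_mobius z x : D z -> D x ->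
  kernel1 (mobius z x) * mobius_jacobian z x = kernel1 x.
Proof.
move=> Dz Dx; have d0 := disk_denom Dx Dz.
rewrite !kernel1E mobius_norm// /mobius_jacobian.
have n0 : normc (1 - conjc z * x) != 0 by rewrite normc_eq0.
have z0 : 1 - normc z ^+ 2 != 0 by rewrite gt_eqF// one_sub_sq_gt0.
have x0 : 1 - normc x ^+ 2 != 0 by rewrite gt_eqF// one_sub_sq_gt0.
move: n0 z0 x0; move: (normc _) (1 - _) (1 - _) => n a b n0 a0 b0.
by field; rewrite n0 a0 b0.
Qed.

Lemma kernel1_radial (x y : R[i]) : normc x = normc y -> kernel1 x = kernel1 y.
Proof. by move=> xy; rewrite !kernel1E xy. Qed.

Section moved.
Variables (w : R[i] -> R) (z : R[i]).
Hypotheses (w_meas : measurable_fun D w) (w_bounded : [bounded w x | x in D]).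
Hypothesis w_supp : exists K : set R[i]^o, [/\ compact K, K `<=` D &
  forall x, D x -> w x != 0 -> K x].
Hypothesis w_radial : forall x y, D x -> D y -> normc x = normc y -> w x = w y.
Hypothesis Dz : D z.

Definition moved : R[i] -> R := (fun x => w (mobius z x)) \_ D.

Lemma movedE x : D x -> moved x = w (mobius z x).
Proof. by move=> Dx; rewrite /moved patchE mem_set. Qed.

Lemma moved_compact_weight :
  exists2 r : R, 0 <= r < 1 & compact_weight r moved /\ compact_weight r (w \_ D).
Proof.
have [K [cK KD Kw]] := w_supp; have [s s01 Ks] := compact_radius cK KD.
have [r /andP[sr r1] rs] := mobius_radius Dz s01.
have [M wM] : exists M : R, forall x, D x -> `|w x| <= M.
  by have [M [_ wM]] := w_bounded; exists (M + 1) => x Dx; apply: wM => //; rewrite ltrDl.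
have Dm x : D x -> D (mobius z x) by move=> Dx; apply/disk_mobius => //; exact: disk_denom.
have M0 : 0 <= M by exact: le_trans (normr_ge0 (w z)) (wM z Dz).
exists r; first by rewrite r1 andbT; case/andP : s01 => s0 _; exact: le_trans sr.
split; split.
- apply/(measurable_restrictT _ mD); apply: (measurable_comp mD) w_meas _.
    by move=> _ [x Dx <-]; exact: Dm.
  exact: measurable_funTS (measurable_mobius z).
- exists M => x; rewrite /moved patchE; case: ifPn => [|_]; last by rewrite normr0.
  by rewrite inE => Dx; apply: wM; exact: Dm.
- move=> x xr; rewrite /moved patchE; case: ifPn => //; rewrite inE => Dx.
  apply/eqP/negPn/negP => w0; have := Ks _ (Kw _ (Dm x Dx) w0) => /(rs x Dx).
  by rewrite leNgt xr.
- exact/(measurable_restrictT _ mD).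
- exists M => x; rewrite patchE; case: ifPn => [|_]; last by rewrite normr0.
  by rewrite inE => Dx; exact: wM.
- move=> x xr; rewrite patchE; case: ifPn => //; rewrite inE => Dx.
  apply/eqP/negPn/negP => w0; have := Ks _ (Kw _ Dx w0).
  by rewrite leNgt (le_lt_trans sr xr).
Qed.

Definition weight_mass : R := \int[dA]_(y in D) (w y * kernel1 y).

(** Moving the weight by a Moebius map turns the mean value property at the
    origin into the evaluation at z. *)
Lemma mean_formula r h : r < 1 -> compact_weight r moved -> compact_weight r (w \_ D) ->
  holomorphic h -> (exists M : R, forall x, normc x <= r -> normc (h x) <= M) ->
  \int[dA]_(x in D) (moved x * kernel1 x * Re (h x)) = weight_mass * Re (h z).
Proof.
move=> r1 fw ww hh [M hM].
have mh := holomorphic_measurable hh.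
have fh : compact_weight r (fun x => moved x * Re (h x)).
  apply: compact_weightM => //; first by meas.
  by exists M => x xr; exact: le_trans (Re_le_normc _) (hM x xr).
have iF : dA.-integrable D (fun x => (moved x * kernel1 x * Re (h x))%:E).
  have := compact_weight_kernel1 r1 fh; apply: eq_integrable => // x _.
  by rewrite mulrAC.
have [i1 <-] := integrable_mobius Dz iF.
have Dm x : D x -> D (mobius z x) by move=> Dx; apply/disk_mobius => //; exact: disk_denom.
have E y : D y -> moved (mobius z y) * kernel1 (mobius z y) * Re (h (mobius z y)) * mobius_jacobian z y
    = (w y * kernel1 y) * Re (h (mobius z y)).
  move=> Dy; rewrite movedE ?mobiusK//; last exact: Dm.
  by rewrite -(kernel1_mobius Dz Dy); ring.
transitivity (\int[dA]_(y in D) ((w y * kernel1 y) * Re (h (mobius z y)))).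
  by apply: eq_Rintegral => y; rewrite inE => /E.
rewrite (@disk_mean _ (fun y => w y * kernel1 y) (fun y => h (mobius z y))).
- by rewrite mobius0 mulrC.
- by move=> x y Dx Dy xy; rewrite (w_radial Dx Dy xy) (kernel1_radial xy).
- have := compact_weight_kernel1 r1 ww; apply: eq_integrable => // x xD.
  by rewrite patchE xD.
- apply: holomorphic_cdiff; apply: (holomorphic_comp hh (holomorphic_mobius Dz)); exact: Dm.
- by move: i1; apply: eq_integrable => // y; rewrite inE => /E ->.
Qed.

End moved.
End weights.

(** * Mean and variance of the random vector *)

Section pairs.
Context {R : realType}.
Implicit Type k : R[i] * R[i] -> R.

Lemma lsum_pairs_diag (r : R) k (X : configuration R) : lsum (inner_pairs r) k X =
  lsum (inner_pairs r) (offdiag k) X + lsum (inner_points r) (fun x => k (x, x)) X.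
Proof.
rewrite !lsum_pairs /lsum -big_split/= !big_seq; apply: eq_bigr => x xX.
rewrite (bigD1_seq x) ?inner_points_uniq//= addrC; congr (_ + _).
rewrite [RHS](bigD1_seq x) ?inner_points_uniq//= /offdiag eqxx add0r.
by apply: eq_bigr => y yx; rewrite /= eq_sym (negbTE yx).
Qed.

End pairs.

Section variance.
Context {R : realType}.
Notation D := (@disk R).
Variables (P : probability (configuration R) R) (w : R[i] -> R) (z : R[i]) (r : R).
Hypothesis P_dpp : determinantal P (@bergman_kernel R).
Hypothesis w_radial : forall x y, D x -> D y -> normc x = normc y -> w x = w y.
Hypothesis Dz : D z.
Hypothesis r1 : r < 1.
Let f := moved w z.
Let c := weight_mass w.
Hypothesis fw : compact_weight r f.
Hypothesis ww : compact_weight r (w \_ D).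

Let mD := @measurable_disk R.

Definition sample (X : configuration R) : seq (R * R[i]) :=
  [seq (f x, x) | x <- inner_points r X].

Lemma sample_disk X p : p \in sample X -> D p.2.
Proof. by move=> /mapP[x /(inner_pointsP r1)[Xx _] ->]; exact: (points_disk Xx). Qed.

Lemma g_sum_kcomb X : g_sum w (@bergman_F R) z X = kcomb (sample X).
Proof.
rewrite /g_sum (@sum_points _ _ r)//; last first.
  move=> x Dx xr; apply/funext => u; case: fw => _ _ fs.
  by rewrite -(movedE w z Dx) -/f fs// mul0r.
apply/funext => u; rewrite fct_sumE /kcomb /sample big_map !big_seq.
apply: eq_bigr => x /(inner_pointsP r1)[Xx _] /=.
by rewrite /f movedE//; exact: (points_disk Xx).
Qed.

Lemma inner_sample X h : bergman_space h -> inner (kcomb (sample X)) h =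
  Complex (lsum (inner_points r) (fun x => f x * Re (h x)) X)
          (- lsum (inner_points r) (fun x => f x * Im (h x)) X).
Proof.
move=> hh; rewrite inner_kcomb//; last exact: sample_disk.
rewrite /sample big_map /lsum.
elim: (inner_points r X) => [|x s IH].
  by rewrite !big_nil oppr0.
rewrite !big_cons IH; case: (h x) => a b; apply/eqP; rewrite eq_complex/=.
by apply/andP; split; apply/eqP; ring.
Qed.

Lemma moment h : bergman_space h ->
  P.-integrable setT (fun X => (lsum (inner_points r) (fun x => f x * Re (h x)) X)%:E) /\
  \int[P]_X lsum (inner_points r) (fun x => f x * Re (h x)) X = c * Re (h z).
Proof.
move=> hh; have hol := bergman_holomorphic hh; have mh := holomorphic_measurable hol.
have [M hM] := bergman_bound r1 hh.
have fh : compact_weight r (fun x => f x * Re (h x)).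
  apply: compact_weightM => //; first by meas.
  by exists M => x xr; exact: le_trans (Re_le_normc _) (hM x xr).
have [i1 ->] := correlation1 r1 P_dpp fh; split => //.
rewrite -(mean_formula w_radial Dz r1 fw ww hol); last by exists M.
by apply: eq_Rintegral => x _; rewrite mulrAC.
Qed.

Lemma moment_Im h : bergman_space h ->
  P.-integrable setT (fun X => (lsum (inner_points r) (fun x => f x * Im (h x)) X)%:E) /\
  \int[P]_X lsum (inner_points r) (fun x => f x * Im (h x)) X = c * Im (h z).
Proof.
move=> hh; have := moment (bergmanZ (Complex 0 (-1)) hh).
have E x : Re (Complex 0 (-1) * h x) = Im (h x) by case: (h x) => a b /=; ring.
have -> : (fun x => f x * Re (Complex 0 (-1) * h x)) = (fun x => f x * Im (h x)).
  by apply/funext => x; rewrite E.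
by rewrite E.
Qed.

Definition mean_kernel : R[i] -> R[i] := kcomb [:: (c, z)].

Lemma mean_kernel_bergman : bergman_space mean_kernel.
Proof. by apply: kcomb_bergman => p; rewrite inE => /eqP ->. Qed.

(** By the reproducing property, the inner product of the random vector with h
    is a linear statistic, whose expectation is given by the mean formula. *)
Lemma is_mean_kernel : is_mean P (g_sum w (@bergman_F R) z) mean_kernel.
Proof.
split; first exact: mean_kernel_bergman.
move=> h hh; have [i1 e1] := moment hh; have [i2 e2] := moment_Im hh.
have E X : inner (g_sum w (@bergman_F R) z X) h =
  Complex (lsum (inner_points r) (fun x => f x * Re (h x)) X)
          (- lsum (inner_points r) (fun x => f x * Im (h x)) X).
  by rewrite g_sum_kcomb inner_sample.
have ER : (fun X => Re (inner (g_sum w (@bergman_F R) z X) h)) =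
   lsum (inner_points r) (fun x => f x * Re (h x)) by apply/funext => X; rewrite E.
have EI : (fun X => Im (inner (g_sum w (@bergman_F R) z X) h)) =
   (fun X => - lsum (inner_points r) (fun x => f x * Im (h x)) X) by apply/funext => X; rewrite E.
split.
  split.
    by move: i1; apply: eq_integrable => // X _; rewrite -(congr1 (@^~ X) ER).
  have := integrableN i2; apply: eq_integrable => // X _.
  by rewrite (congr1 (@^~ X) EI).
rewrite /complex_expectation ER EI /mean_kernel inner_kcomb//; last first.
  by move=> p; rewrite inE => /eqP ->.
rewrite big_seq1 /= e1.
have -> : \int[P]_X (- lsum (inner_points r) (fun x => f x * Im (h x)) X) = - (c * Im (h z)).
  by rewrite -e2 -mulN1r -RintegralZl//; apply: eq_Rintegral => X _; rewrite mulN1r.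
by case: (h z) => a b; apply/eqP; rewrite eq_complex/=; apply/andP; split; apply/eqP; ring.
Qed.

Let k (p : R[i] * R[i]) : R := f p.1 * f p.2 * Re (bergman_kernel p.1 p.2).

(** The difference with the mean is again a real combination of kernels, with
    the extra point z of weight - c. *)
Lemma sqnorm_sample X : sqnorm (fun u => kcomb (sample X) u - mean_kernel u) =
  (lsum (inner_pairs r) k X
   - 2 * c * lsum (inner_points r) (fun x => f x * Re (bergman_F z x)) X
   + c ^+ 2 * kernel1 z)%:E.
Proof.
have -> : (fun u => kcomb (sample X) u - mean_kernel u) = kcomb ((- c, z) :: sample X).
  by apply/funext => u; rewrite kcomb_cons /mean_kernel /kcomb big_seq1 /= rmorphN mulNr addrC.
rewrite sqnorm_kcomb; last first.
  by move=> p; rewrite inE => /orP[/eqP ->//|]; exact: sample_disk.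
congr EFin; rewrite !big_cons/= lsum_pairs.
have Es (g : R[i] -> R) : \sum_(q <- sample X) - c * q.1 * g q.2 =
    - c * \sum_(x <- inner_points r X) f x * g x.
  by rewrite /sample big_map mulr_sumr; apply: eq_bigr => x _ /=; rewrite mulrA.
rewrite (Es (fun y => Re (bergman_kernel z y))).
under [X in _ + X = _]eq_bigr do rewrite big_cons/=.
rewrite big_split/=.
have -> : \sum_(i <- sample X) i.1 * - c * Re (bergman_kernel i.2 z) =
    - c * \sum_(x <- inner_points r X) f x * Re (bergman_kernel x z).
  by rewrite -(Es (fun y => Re (bergman_kernel y z))); apply: eq_bigr => q _; congr (_ * _); rewrite mulrC.
have -> : \sum_(x <- inner_points r X) f x * Re (bergman_kernel z x) =
    \sum_(x <- inner_points r X) f x * Re (bergman_kernel x z).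
  by apply: eq_bigr => x _; rewrite -bergman_kernel_conj Re_conj.
have -> : \sum_(i <- sample X) \sum_(j <- sample X) i.1 * j.1 * Re (bergman_kernel i.2 j.2) =
  \sum_(x <- inner_points r X) \sum_(y <- inner_points r X) k (x, y).
  by rewrite /sample big_map; apply: eq_bigr => x _; rewrite big_map.
by rewrite /lsum /bergman_F /kernel1; ring.
Qed.

Let kernel_bound (x y : R[i]) : normc x <= r -> normc y <= r ->
  normc (bergman_kernel x y) <= (1 - r) ^- 2.
Proof. by move=> xr yr; apply: normc_bergman_kernel => //; exact: le_lt_trans r1. Qed.

Let mK : measurable_fun setT (fun p : R[i] * R[i] => bergman_kernel p.1 p.2).
Proof. by apply: measurable_kernel; [exact: measurable_fst|exact: measurable_snd]. Qed.

Let k_weight : compact_weight2 r k.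
Proof.
apply: compact_weight2M; first exact: compact_weight_prod.
  exact: (measurableT_comp (@measurable_Re R) mK).
by exists ((1 - r) ^- 2) => x y xr yr; exact: le_trans (Re_le_normc _) (kernel_bound xr yr).
Qed.

Let kk_weight : compact_weight2 r (fun p => k p * (kernel1 p.1 * kernel1 p.2)).
Proof.
apply: compact_weight2M => //.
  apply: measurable_funM; first exact: (measurableT_comp measurable_kernel1 measurable_fst).
  exact: (measurableT_comp measurable_kernel1 measurable_snd).
exists ((1 - r) ^- 2 * (1 - r) ^- 2) => x y xr yr /=.
by rewrite ger0_norm ?mulr_ge0 ?kernel1_ge0// ler_pM ?kernel1_ge0// kernel1_bound.
Qed.

Let kK_weight : compact_weight2 r (fun p => k p * normc (bergman_kernel p.1 p.2) ^+ 2).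
Proof.
apply: compact_weight2M => //; first by apply: measurable_funX; exact: measurable_fun_normc.
exists (((1 - r) ^- 2) ^+ 2) => x y xr yr /=.
by rewrite ger0_norm ?sqr_ge0// ler_sqr ?nnegrE ?normc_ge0 ?kernel_bound// invr_ge0 sqr_ge0.
Qed.

Let mean_F x : D x ->
  \int[dA]_(y in D) (f y * kernel1 y * Re (bergman_F x y)) = c * Re (bergman_F x z).
Proof.
move=> Dx; have hF := bergman_F_space Dx.
apply: (mean_formula w_radial Dz r1 fw ww (bergman_holomorphic hF)).
exact: bergman_bound.
Qed.

Let dint2_kernel1 : dint2 (fun p => k p * (kernel1 p.1 * kernel1 p.2)) = c ^+ 2 * kernel1 z.
Proof.
transitivity (\int[dA]_(x in D) (c * (f x * kernel1 x * Re (bergman_F z x)))).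
  apply: eq_Rintegral => x; rewrite inE => Dx.
  have -> : c * (f x * kernel1 x * Re (bergman_F z x)) =
      (f x * kernel1 x) * (c * Re (bergman_F x z)).
    rewrite /bergman_F -(bergman_kernel_conj x z) Re_conj; ring.
  rewrite -mean_F// -RintegralZl//.
    apply: eq_Rintegral => y _; rewrite /k /= /bergman_F -(bergman_kernel_conj y x) Re_conj; ring.
  have hF := bergman_F_space Dx; have [M hM] := bergman_bound r1 hF.
  have fh : compact_weight r (fun y => f y * Re (bergman_F x y)).
    apply: compact_weightM => //.
      by have := holomorphic_measurable (bergman_holomorphic hF) => mF; meas.
    by exists M => y yr; exact: le_trans (Re_le_normc _) (hM y yr).
  have := compact_weight_kernel1 r1 fh; apply: eq_integrable => // y _.
  by rewrite mulrAC.
have hF := bergman_F_space Dz; have [M hM] := bergman_bound r1 hF.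
have fh : compact_weight r (fun y => f y * Re (bergman_F z y)).
  apply: compact_weightM => //.
    by have := holomorphic_measurable (bergman_holomorphic hF) => mF; meas.
  by exists M => y yr; exact: le_trans (Re_le_normc _) (hM y yr).
have ifh : dA.-integrable D (fun x => (f x * kernel1 x * Re (bergman_F z x))%:E).
  have := compact_weight_kernel1 r1 fh; apply: eq_integrable => // y _.
  by rewrite mulrAC.
by rewrite RintegralZl// mean_F// expr2 mulrA.
Qed.

(** The pairs of distinct points contribute K(x,x) K(y,y) - |K(x,y)|^2, and
    the part with K(x,x) K(y,y) cancels against the square of the mean. *)
Lemma variance_moments : hilbert_variance P (g_sum w (@bergman_F R) z) =
  (\int[dA]_(x in D) (f x ^+ 2 * kernel1 x ^+ 2)
   - dint2 (fun p => k p * normc (bergman_kernel p.1 p.2) ^+ 2))%:E.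
Proof.
set Y := g_sum w (@bergman_F R) z.
have hm : is_mean P Y (hilbert_mean P Y).
  by rewrite /hilbert_mean; apply: xgetPex; exists mean_kernel; exact: is_mean_kernel.
have E X : sqnorm (Y X - hilbert_mean P Y) =
  (lsum (inner_pairs r) k X
   - 2 * c * lsum (inner_points r) (fun x => f x * Re (bergman_F z x)) X
   + c ^+ 2 * kernel1 z)%:E.
  rewrite -sqnorm_sample -g_sum_kcomb.
  apply: (@sqnorm_represented _ (Y X)).
  - by rewrite /Y g_sum_kcomb; apply: kcomb_bergman; exact: sample_disk.
  - by case: hm.
  - exact: mean_kernel_bergman.
  - by move=> h hh; rewrite -(hm.2 h hh).2 -(is_mean_kernel.2 h hh).2.
rewrite /hilbert_variance; under eq_integral do rewrite E.
have dw : compact_weight r (fun x => k (x, x)).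
  have -> : (fun x => k (x, x)) = (fun x => f x * (f x * kernel1 x)).
    by apply/funext => x; rewrite /k /kernel1 /= mulrA.
  case: fw => mf [N fN] _; apply: compact_weightM => //.
    apply: measurable_funTS; apply: measurable_funM => //; exact: measurable_kernel1.
  exists (N * (1 - r) ^- 2) => x xr.
  by rewrite normrM ler_pM// ger0_norm ?kernel1_ge0// kernel1_bound.
have [i2 e2] := correlation2 r1 P_dpp k_weight.
have [i1 e1] := correlation1 r1 P_dpp dw.
have [i0 e0] := moment (bergman_F_space Dz).
have Re0 : Re (bergman_F z z) = kernel1 z by [].
rewrite Re0 in e0.
pose A X := lsum (inner_pairs r) (offdiag k) X; pose B X := lsum (inner_points r) (fun x => k (x, x)) X.
pose C X := lsum (inner_points r) (fun x => f x * Re (bergman_F z x)) X.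
have iAB : P.-integrable setT (fun X => (A X + B X)%:E).
  by have := integrableD measurableT i2 i1; apply: eq_integrable => // X _.
have iC : P.-integrable setT (fun X => (2 * c * C X)%:E).
  by have := integrableZl measurableT (2 * c) i0; apply: eq_integrable => // X _.
have iABC : P.-integrable setT (fun X => (A X + B X - 2 * c * C X)%:E).
  by have := integrableB measurableT iAB iC; apply: eq_integrable => // X _.
have ic : P.-integrable setT (fun X => (c ^+ 2 * kernel1 z)%:E).
  by apply: finite_measure_integrable_cst.
have iT : P.-integrable setT (fun X => (A X + B X - 2 * c * C X + c ^+ 2 * kernel1 z)%:E).
  by have := integrableD measurableT iABC ic; apply: eq_integrable => // X _.
transitivity ((\int[P]_X (A X + B X - 2 * c * C X + c ^+ 2 * kernel1 z))%:E).
  rewrite /Rintegral fineK; last exact: integrable_fin_num.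
  by apply: eq_integral => X _; rewrite lsum_pairs_diag.
congr EFin; rewrite RintegralD// RintegralB// RintegralD// RintegralZl//.
rewrite -[\int[P]_X A X]/(\int[P]_X lsum (inner_pairs r) (offdiag k) X) e2.
rewrite -[\int[P]_X B X]/(\int[P]_X lsum (inner_points r) (fun x => k (x, x)) X) e1.
rewrite -[\int[P]_X C X]/(\int[P]_X lsum (inner_points r) (fun x => f x * Re (bergman_F z x)) X) e0.
rewrite Rintegral_cst// [X in fine X]probability_setT mulr1.
have -> : dint2 (fun p => k p * kernel2 p.1 p.2) =
    dint2 (fun p => k p * (kernel1 p.1 * kernel1 p.2)) -
    dint2 (fun p => k p * normc (bergman_kernel p.1 p.2) ^+ 2).
  rewrite -dint2B; [|exact: compact_weight2_bounded kk_weight|exact: compact_weight2_bounded kK_weight].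
  by apply: eq_dint2 => x y _ _ /=; rewrite kernel2E mulrBr.
rewrite dint2_kernel1.
have -> : \int[dA]_(x in D) (k (x, x) * kernel1 x) = \int[dA]_(x in D) (f x ^+ 2 * kernel1 x ^+ 2).
  by apply: eq_Rintegral => x _; rewrite /k /kernel1 /=; ring.
ring.
Qed.

End variance.

(** * The kernel transported by a Moebius map *)

Section transported_kernel.
Context {R : realType}.
Notation D := (@disk R).
Implicit Types (x y z e : R[i]).

(** Up to the factor (1 - |z|^2)^2, this is K(phi y, phi x)^2 K(phi x, phi y)
    times the Jacobians of phi at x and y, where phi is the Moebius map of z. *)
Definition pulled_kernel z x y : R[i] :=
  (1 - conjc z * y) ^+ 2 * conjc ((1 - conjc z * x) ^+ 2) *
  bergman_kernel y x ^+ 2 * bergman_kernel x y.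

Lemma Re_mulrl (b : R) (u : R[i]) : Re ((b%:C)%C * u) = b * Re u.
Proof. by case: u => c d /=; rewrite mul0r subr0. Qed.

Lemma pulled_kernel_sym z x y : pulled_kernel z y x = conjc (pulled_kernel z x y).
Proof.
rewrite /pulled_kernel -(bergman_kernel_conj y x) !conjc_mul !conjcK.
by ring.
Qed.

Lemma pulled_kernel_mobius z x y : D z -> D x -> D y ->
  Re (bergman_kernel (mobius z x) (mobius z y)) *
  normc (bergman_kernel (mobius z x) (mobius z y)) ^+ 2 *
  (mobius_jacobian z x * mobius_jacobian z y) =
  (1 - normc z ^+ 2) ^- 2 * Re (pulled_kernel z x y).
Proof.
move=> Dz Dx Dy.
have A0 := disk_denom Dx Dz; have B0 := disk_denom Dy Dz; have c0 := disk_denomC Dx Dy.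
have a0 : ((1 - normc z ^+ 2)%:C)%C != 0 :> R[i].
  by rewrite eq_complex/= negb_and gt_eqF// one_sub_sq_gt0.
have A0' : conjc (1 - conjc z * x) != 0 by rewrite conjc_eq0.
have B0' : conjc (1 - conjc z * y) != 0 by rewrite conjc_eq0.
have c0' : conjc (1 - y * conjc x) != 0 by rewrite conjc_eq0.
have k'E : bergman_kernel (mobius z y) (mobius z x) =
   (((1 - normc z ^+ 2)%:C)%C * (1 - y * conjc x) / ((1 - conjc z * y) * conjc (1 - conjc z * x))) ^- 2.
  rewrite /bergman_kernel; congr (_ ^- 2).
  have -> : conjc (mobius z x) = (conjc z - conjc x) / conjc (1 - conjc z * x).
    by rewrite /mobius conjc_mul conjc_inv rmorphB.
  have A0'' : 1 - z * conjc x != 0 by rewrite -[z]conjcK -conjc_mul -(conjc1 R) -rmorphB.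
  have -> : conjc (1 - conjc z * x) = 1 - z * conjc x.
    by case: z {A0 B0 A0' B0' A0'' a0 Dz} => ? ?; case: x {Dx c0 c0'} => ? ?; apply/eqP; rewrite eq_complex/=;
      apply/andP; split; apply/eqP; ring.
  rewrite one_sub_normcE /mobius; field.
  by rewrite B0 A0''.
have -> : Re (bergman_kernel (mobius z x) (mobius z y)) *
  normc (bergman_kernel (mobius z x) (mobius z y)) ^+ 2 *
  (mobius_jacobian z x * mobius_jacobian z y) =
  Re (bergman_kernel (mobius z y) (mobius z x) ^+ 2 *
      conjc (bergman_kernel (mobius z y) (mobius z x)) *
      ((mobius_jacobian z x)%:C)%C * ((mobius_jacobian z y)%:C)%C).
  rewrite -(bergman_kernel_conj (mobius z y) (mobius z x)) normc_conj Re_conj.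
  move: (bergman_kernel _ _) (mobius_jacobian z x) (mobius_jacobian z y) => k j1 j2.
  by rewrite normc_sq !expr2; case: k => a b; rewrite !(ReE_mul, ImE_mul) /=; ring.
have JE u : ((mobius_jacobian z u)%:C)%C =
   (((1 - normc z ^+ 2)%:C)%C) ^+ 2 / ((1 - conjc z * u) * conjc (1 - conjc z * u)) ^+ 2.
  by rewrite mulc_conj /mobius_jacobian rmorphM fmorphV !rmorphXn/= -exprM.
have -> : (1 - normc z ^+ 2) ^- 2 * Re (pulled_kernel z x y) =
   Re ((((1 - normc z ^+ 2)%:C)%C) ^- 2 * pulled_kernel z x y).
  rewrite (_ : _ ^- 2 = (((1 - normc z ^+ 2) ^- 2)%:C)%C); last by rewrite fmorphV rmorphXn.
  by rewrite Re_mulrl.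
congr Re; rewrite !JE k'E /pulled_kernel -(bergman_kernel_conj y x).
have -> : bergman_kernel y x = (1 - y * conjc x) ^- 2 by [].
have cc (u : R[i]) n : conjc (u ^+ n) = conjc u ^+ n by rewrite rmorphXn.
rewrite !(conjc_inv, cc, conjc_mul) conjc_real conjcK.
move: a0 A0 B0 c0 A0' B0' c0'.
move: (((1 - normc z ^+ 2)%:C)%C) (conjc (1 - conjc z * x)) (conjc (1 - conjc z * y)) (conjc (1 - y * conjc x)).
move: (1 - conjc z * x) (1 - conjc z * y) (1 - y * conjc x) => A B c a A' B' c' a0 A0 B0 c0 A0' B0' c0'.
by field; rewrite a0 A0 B0 c0 A0' B0' c0'.
Qed.

(** Up to the same factor, K(phi x, phi x)^2 times the Jacobian of phi at x. *)
Definition diag_density z x : R := normc (1 - conjc z * x) ^+ 4 * kernel1 x ^+ 2.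

Lemma diag_density_mobius z x : D z -> D x ->
  kernel1 (mobius z x) ^+ 2 * mobius_jacobian z x = (1 - normc z ^+ 2) ^- 2 * diag_density z x.
Proof.
move=> Dz Dx; rewrite expr2 -mulrA kernel1_mobius// /diag_density.
have d0 := disk_denom Dx Dz.
have n0 : normc (1 - conjc z * x) != 0 by rewrite normc_eq0.
have z0 : 1 - normc z ^+ 2 != 0 by rewrite gt_eqF// one_sub_sq_gt0.
have x0 : 1 - normc x ^+ 2 != 0 by rewrite gt_eqF// one_sub_sq_gt0.
rewrite !kernel1E mobius_norm//.
move: n0 z0 x0; move: (normc _) (1 - _) (1 - _) => n a b n0 a0 b0.
by field; rewrite n0 a0 b0.
Qed.

(** The reproducing property, applied to the holomorphic part of the kernel. *)
Lemma pulled_kernel_mean z x : D z -> D x ->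
  \int[dA]_(y in D) Re (pulled_kernel z x y) = diag_density z x.
Proof.
move=> Dz Dx.
pose h y := conjc ((1 - conjc z * x) ^+ 2) * ((1 - conjc z * y) ^+ 2 * bergman_F x y ^+ 2).
have hb : bergman_space h.
  apply: bergmanZ; apply: (@bounded_bergman _ _ (2 ^+ 2 * ((1 - normc x) ^- 2) ^+ 2)).
    apply: holomorphicM.
      apply: holomorphicX; exact: holomorphic_1B.
    apply: holomorphicX; apply: bergman_holomorphic; exact: bergman_F_space.
  move=> y Dy; rewrite normcM !normcX ler_pM ?exprn_ge0 ?normc_ge0//.
    rewrite ler_sqr ?nnegrE ?normc_ge0//; apply: (le_trans (le_normcD _ _)).
    by rewrite normc1 normcN normcM normc_conj; have := normcM_lt1 Dz Dy; rewrite normcM; lra.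
  rewrite ler_sqr ?nnegrE ?normc_ge0 ?invr_ge0 ?sqr_ge0// /bergman_F -normc_conj bergman_kernel_conj.
  exact: normc_bergman_kernel.
have := reproducing_Re hb Dx => E.
transitivity (Re (h x)).
  rewrite -E; apply: eq_Rintegral => y _; rewrite -Re_conj; congr Re.
  rewrite /h /pulled_kernel /bergman_F -(bergman_kernel_conj y x) !conjc_mul !conjcK.
  by ring.
have -> : h x = ((normc (1 - conjc z * x) ^+ 4 * kernel1 x ^+ 2)%:C)%C.
  have -> : ((normc (1 - conjc z * x) ^+ 4 * kernel1 x ^+ 2)%:C)%C =
      ((normc (1 - conjc z * x) ^+ 2)%:C)%C ^+ 2 * ((kernel1 x)%:C)%C ^+ 2.
    by rewrite rmorphM !rmorphXn/= -exprM.
  rewrite /h -mulc_conj.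
  have -> : ((kernel1 x)%:C)%C = bergman_F x x.
    by rewrite kernel1E /bergman_F /bergman_kernel -one_sub_normcE fmorphV rmorphXn.
  rewrite rmorphXn /=; move: (conjc _) => A; by ring.
by [].
Qed.

End transported_kernel.

(** * Circle means of powers of a resolvent *)

Section averaging.
Context {R : realType}.
Notation D := (@disk R).
Implicit Types (x y z e : R[i]) (W V : R[i] -> R).

Let mD := @measurable_disk R.

(** The mean of u^m * conj u^n over a circle of points p centered at 0, where
    u = 1 / (1 - p) and t = 1 / (1 - |p|^2). *)
Fixpoint mixed_mean (t : R) (m n : nat) : R :=
  match m with
  | 0 => 1
  | m'.+1 =>
    (fix aux n := match n with
      | 0 => 1
      | n'.+1 => t * (aux n' + mixed_mean t m' n'.+1 - mixed_mean t m' n')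
      end) n
  end.

Lemma mixed_meanS t m n : mixed_mean t m.+1 n.+1 =
  t * (mixed_mean t m.+1 n + mixed_mean t m n.+1 - mixed_mean t m n).
Proof. by []. Qed.

Definition radial_weight W := [/\ measurable_fun D W,
  exists M : R, forall y, D y -> `|W y| <= M &
  forall x y, D x -> D y -> normc x = normc y -> W x = W y].

Lemma radial_weight_integrable W : radial_weight W -> dA.-integrable D (EFin \o W).
Proof. by move=> [mW [M WM] _]; exact: integrable_disk_bounded WM. Qed.

Lemma radial_weightM W V : radial_weight W -> radial_weight V ->
  radial_weight (fun y => W y * V y).
Proof.
move=> [mW [M WM] rW] [mV [N VN] rV]; split; first exact: measurable_funM.
- by exists (M * N) => y Dy; rewrite normrM ler_pM// ?WM ?VN.
- by move=> x y Dx Dy xy; rewrite (rW x y)// (rV x y).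
Qed.

Lemma radial_weightD W V : radial_weight W -> radial_weight V ->
  radial_weight (fun y => W y + V y).
Proof.
move=> [mW [M WM] rW] [mV [N VN] rV]; split; first exact: measurable_funD.
- exists (M + N) => y Dy; apply: (le_trans (ler_normD _ _)).
  by apply: lerD; [exact: WM|exact: VN].
- by move=> x y Dx Dy xy; rewrite (rW x y)// (rV x y).
Qed.

Lemma radial_weightN W : radial_weight W -> radial_weight (fun y => - W y).
Proof.
move=> [mW [M WM] rW]; split; first exact: measurableT_comp.
- by exists M => y Dy; rewrite normrN WM.
- by move=> x y Dx Dy xy; rewrite (rW x y).
Qed.

Section fixed_point.
Variable x : R[i].
Hypothesis Dx : D x.

Let u y := (1 - y * conjc x)^-1.
Let t y := (1 - normc (x * y) ^+ 2)^-1.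

Let u0 y : D y -> 1 - y * conjc x != 0. Proof. exact: disk_denomC. Qed.

Lemma resolvent_mul y : D y ->
  u y * conjc (u y) = ((t y)%:C)%C * (u y + conjc (u y) - 1).
Proof.
move=> Dy; have d0 := u0 Dy.
have d0' : conjc (1 - y * conjc x) != 0 by rewrite conjc_eq0.
have cE : conjc (1 - y * conjc x) = 1 - x * conjc y.
  by case: x => a b; case: y {Dy d0 d0'} => c d; apply/eqP; rewrite eq_complex/=;
    apply/andP; split; apply/eqP; ring.
have tE : ((t y)%:C)%C = (1 - (y * conjc x) * (x * conjc y))^-1.
  rewrite (_ : ((t y)%:C)%C = (((1 - normc (x * y) ^+ 2)%:C)%C)^-1); last by rewrite /t fmorphV.
  by rewrite one_sub_normcE conjc_mul; congr (1 - _)^-1; ring.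
have s0 : 1 - (y * conjc x) * (x * conjc y) != 0.
  have -> : 1 - (y * conjc x) * (x * conjc y) = ((1 - normc (x * y) ^+ 2)%:C)%C.
    by rewrite one_sub_normcE conjc_mul; congr (1 - _); ring.
  rewrite eq_complex/= negb_and gt_eqF// one_sub_sq_gt0//; exact: normcM_lt1.
rewrite tE /u conjc_inv cE; rewrite cE in d0'.
move: d0 d0' s0; move: (y * conjc x) (x * conjc y) => p q p0 q0 s0.
by field; rewrite p0 q0 s0.
Qed.

Lemma radial_weight_t : radial_weight t.
Proof.
split.
- by apply: measurable_funV; apply: measurable_funB => //; apply: measurable_funX; meas.
- exists (1 - normc x ^+ 2)^-1 => y Dy.
  have x2 := one_sub_sq_gt0 Dx; have xy2 : 0 < 1 - normc (x * y) ^+ 2.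
    by apply: one_sub_sq_gt0; exact: normcM_lt1.
  rewrite /t ger0_norm; last by rewrite invr_ge0 ltW.
  rewrite lef_pV2// lerD2l lerN2 normcM exprMn.
  by rewrite ler_piMr ?sqr_ge0// expr_le1 ?normc_ge0// ltW.
- by move=> y y' Dy Dy' yy; rewrite /t !normcM yy.
Qed.

Lemma resolvent_bound y : D y -> normc (u y) <= (1 - normc x)^-1.
Proof.
move=> Dy; rewrite /u normcV.
have x1 : 0 < 1 - normc x by rewrite subr_gt0.
have h : 1 - normc x <= normc (1 - y * conjc x).
  apply: le_trans (normc1B_ge _); rewrite lerD2l lerN2 normcM normc_conj.
  by rewrite ler_piMl ?normc_ge0// ltW.
by rewrite lef_pV2 ?posrE//; exact: lt_le_trans h.
Qed.

Lemma resolvent_integrable W m n : radial_weight W ->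
  dA.-integrable D (fun y => (W y * Re (u y ^+ m * conjc (u y) ^+ n))%:E).
Proof.
move=> [mW [M WM] _].
apply: (@integrable_disk_bounded _ (fun y => W y * Re (u y ^+ m * conjc (u y) ^+ n))
  (M * ((1 - normc x)^-1 ^+ m * (1 - normc x)^-1 ^+ n))).
  by apply: measurable_funM => //; rewrite /u; meas.
move=> y Dy; rewrite normrM ler_pM// ?WM//; apply: (le_trans (Re_le_normc _)).
have b := resolvent_bound Dy; have n0 := normc_ge0 (u y).
by rewrite normcM !normcX normc_conj ler_pM ?exprn_ge0// lerXn2r// nnegrE (le_trans n0).
Qed.

Let pure_mean W n : radial_weight W ->
  \int[dA]_(y in D) (W y * Re (u y ^+ n)) = \int[dA]_(y in D) W y.
Proof.
move=> wW; have [_ _ rW] := wW.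
have hu : holomorphic (fun y => u y ^+ n).
  apply: holomorphicX; apply: holomorphicV; last exact: u0.
  have := @holomorphic_1B R (conjc x).
  by under eq_fun do rewrite mulrC.
rewrite (disk_mean rW (radial_weight_integrable wW) (holomorphic_cdiff hu)).
  by rewrite /u mul0r subr0 invr1 expr1n mul1r.
have := resolvent_integrable n 0 wW; apply: eq_integrable => // y _.
by rewrite expr0 mulr1.
Qed.

(** Since u * conj u = t (u + conj u - 1) with t radial, mixed powers of the
    resolvent reduce to pure ones, whose mean is their value at 0. *)
Lemma resolvent_mean m n W : radial_weight W ->
  radial_weight (fun y => W y * mixed_mean (t y) m n) /\
  \int[dA]_(y in D) (W y * Re (u y ^+ m * conjc (u y) ^+ n)) =
  \int[dA]_(y in D) (W y * mixed_mean (t y) m n).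
Proof.
elim: m n W => [|m IHm] n W wW.
  have E : (fun y => W y * mixed_mean (t y) 0 n) = W by apply/funext => y; rewrite /= mulr1.
  rewrite E; split => //; rewrite -(pure_mean n wW); apply: eq_Rintegral => y _.
  by rewrite expr0 mul1r -rmorphXn Re_conj.
elim: n W wW => [|n IHn] W wW.
  have E : (fun y => W y * mixed_mean (t y) m.+1 0) = W by apply/funext => y; rewrite /= mulr1.
  rewrite E; split => //; rewrite -(pure_mean m.+1 wW); apply: eq_Rintegral => y _.
  by rewrite expr0 mulr1.
have wt := radial_weightM wW radial_weight_t.
have [w1 e1] := IHn _ wt; have [w2 e2] := IHm n.+1 _ wt; have [w3 e3] := IHm n _ wt.
have w12 := radial_weightD w1 w2; have w123 := radial_weightD w12 (radial_weightN w3).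
have E : (fun y => W y * mixed_mean (t y) m.+1 n.+1) =
  (fun y => W y * t y * mixed_mean (t y) m.+1 n + W y * t y * mixed_mean (t y) m n.+1
     - W y * t y * mixed_mean (t y) m n).
  by apply/funext => y; rewrite mixed_meanS -mulrDr -mulrBr mulrA.
rewrite E; split => //.
rewrite [RHS]RintegralB//; [|exact: radial_weight_integrable|exact: radial_weight_integrable].
rewrite [in RHS]RintegralD//; [|exact: radial_weight_integrable|exact: radial_weight_integrable].
rewrite -e1 -e2 -e3 -RintegralD//; [|exact: resolvent_integrable|exact: resolvent_integrable].
rewrite -RintegralB//; last exact: resolvent_integrable; last first.
  have := integrableD mD (resolvent_integrable m.+1 n wt) (resolvent_integrable m n.+1 wt).
  by apply: eq_integrable => // y _.
apply: eq_Rintegral => y; rewrite inE => Dy.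
rewrite -mulrDr -mulrBr -mulrA; congr (_ * _).
have := resolvent_mul Dy; move: (u y) (conjc (u y)) (t y) => a b s H.
rewrite (_ : a ^+ m.+1 * b ^+ n.+1 = (s%:C)%C * (a ^+ m.+1 * b ^+ n + a ^+ m * b ^+ n.+1 - a ^+ m * b ^+ n)).
  rewrite Re_mulrl; congr (_ * _).
  by case: (a ^+ m.+1 * _) => ? ?; case: (a ^+ m * b ^+ n.+1) => ? ?; case: (a ^+ m * _).
transitivity (a ^+ m * b ^+ n * (a * b)); first by rewrite !exprS; ring.
by rewrite H !exprS; ring.
Qed.

End fixed_point.
End averaging.

(** * Averaging over rotations *)

Section rotation_average.
Context {R : realType}.
Notation D := (@disk R).
Implicit Types (x y z e : R[i]) (W : R[i] -> R).

Let mD := @measurable_disk R.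

Lemma bergman_kernel_rotation e x y : conjc e * e = 1 ->
  bergman_kernel (e * x) (e * y) = bergman_kernel x y.
Proof.
move=> e1; rewrite /bergman_kernel conjc_mul; congr ((1 - _) ^- 2).
by rewrite -(mulr1 (x * conjc y)) -e1; ring.
Qed.

Lemma pulled_kernel_rotation e z x y : conjc e * e = 1 ->
  pulled_kernel z (e * x) (e * y) =
  ((1 - e * (conjc z * y)) * (1 - conjc e * (z * conjc x))) ^+ 2 *
  (bergman_kernel y x ^+ 2 * bergman_kernel x y).
Proof.
move=> e1; rewrite /pulled_kernel !bergman_kernel_rotation//.
have -> : conjc ((1 - conjc z * (e * x)) ^+ 2) = (1 - conjc e * (z * conjc x)) ^+ 2.
  rewrite rmorphXn/=; congr (_ ^+ 2).
  case: z => a b; case: x => c d; case: e {e1} => g h; apply/eqP; rewrite eq_complex/=.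
  by apply/andP; split; apply/eqP; ring.
by ring.
Qed.

(** Viewed as a function of the root e, the square is a Laurent polynomial of
    degree at most 2, so that only its constant term survives the mean over
    the fourth roots of unity. *)
Lemma fourth_roots_average (u v : R[i]) (j := Complex 0 1 : R[i]) :
  ((1 - u) * (1 - v)) ^+ 2 + ((1 - j * u) * (1 - conjc j * v)) ^+ 2 +
  ((1 + u) * (1 + v)) ^+ 2 + ((1 + j * u) * (1 + conjc j * v)) ^+ 2 =
  4 * (1 + 4 * (u * v) + (u * v) ^+ 2).
Proof.
have jj : j * j = -1 by apply/eqP; rewrite eq_complex/=; apply/andP; split; apply/eqP; ring.
have -> : conjc j = - j by apply/eqP; rewrite eq_complex/=; apply/andP; split; apply/eqP; ring.
transitivity (2 * (1 + 4 * (u * v) + (u * v) ^+ 2 + (u ^+ 2 + v ^+ 2)) +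
   2 * (1 - 4 * (j * j) * (u * v) + (j * j) ^+ 2 * (u * v) ^+ 2 + (j * j) * (u ^+ 2 + v ^+ 2))).
  by ring.
by rewrite jj; ring.
Qed.

(** The mean of the pulled kernel over joint rotations of x and y; it depends
    on y * conj x only. *)
Definition averaged_kernel z x y : R[i] :=
  let a := z * conjc z in let p := y * conjc x in
  (1 + 4 * a * p + a ^+ 2 * p ^+ 2) * (bergman_kernel y x ^+ 2 * bergman_kernel x y).

Lemma pulled_kernel_average z x y (j := Complex 0 1 : R[i]) :
  pulled_kernel z x y + pulled_kernel z (j * x) (j * y) +
  pulled_kernel z (-1 * x) (-1 * y) + pulled_kernel z (- j * x) (- j * y) =
  4 * averaged_kernel z x y.
Proof.
have j1 : conjc j * j = 1 by apply/eqP; rewrite eq_complex/=; apply/andP; split; apply/eqP; ring.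
have nc e : conjc (- e) = - conjc e by rewrite rmorphN.
have m1 : conjc (-1 : R[i]) = -1 by rewrite rmorphN rmorph1.
have m11 : conjc (-1 : R[i]) * -1 = 1 by rewrite m1; ring.
have nj : conjc (- j) * - j = 1 by rewrite nc mulrNN.
have c1 : conjc (1 : R[i]) * 1 = 1 by rewrite rmorph1 mulr1.
have := pulled_kernel_rotation z x y c1; rewrite rmorph1 !mul1r => ->.
rewrite (pulled_kernel_rotation z x y j1) (pulled_kernel_rotation z x y m11).
rewrite (pulled_kernel_rotation z x y nj) m1 nc !mulN1r !mulNr !opprK.
rewrite -!mulrDl fourth_roots_average /averaged_kernel; ring.
Qed.

(** The numerator is a polynomial in p = 1 - 1 / u, so the averaged kernel is
    a combination of the mixed powers u^m * conj u^2 with m = 4, 3, 2. *)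
Lemma averaged_mean z x W : D x -> radial_weight W ->
  \int[dA]_(y in D) (W y * Re (averaged_kernel z x y)) =
  \int[dA]_(y in D) (W y * (I_factor z x y / (1 - normc (x * y) ^+ 2) ^+ 5)).
Proof.
move=> Dx wW; pose a := normc z ^+ 2.
pose u y := (1 - y * conjc x)^-1; pose t y := (1 - normc (x * y) ^+ 2)^-1.
pose c1 := 1 + 4 * a + a ^+ 2; pose c2 := 4 * a + 2 * a ^+ 2; pose c3 := a ^+ 2.
have [w1 e1] := resolvent_mean Dx 4 2 wW.
have [w2 e2] := resolvent_mean Dx 3 2 wW.
have [w3 e3] := resolvent_mean Dx 2 2 wW.
have i1 := resolvent_integrable Dx 4 2 wW.
have i2 := resolvent_integrable Dx 3 2 wW.
have i3 := resolvent_integrable Dx 2 2 wW.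
have lin (f g h : R[i] -> R) : dA.-integrable D (EFin \o f) -> dA.-integrable D (EFin \o g) ->
    dA.-integrable D (EFin \o h) ->
    \int[dA]_(y in D) (c1 * f y - c2 * g y + c3 * h y) =
    c1 * (\int[dA]_(y in D) f y) - c2 * (\int[dA]_(y in D) g y) + c3 * (\int[dA]_(y in D) h y).
  move=> fi gi hi.
  have fi' : dA.-integrable D (EFin \o (fun y => c1 * f y)).
    by have := integrableZl mD c1 fi; apply: eq_integrable => // y _.
  have gi' : dA.-integrable D (EFin \o (fun y => c2 * g y)).
    by have := integrableZl mD c2 gi; apply: eq_integrable => // y _.
  have hi' : dA.-integrable D (EFin \o (fun y => c3 * h y)).
    by have := integrableZl mD c3 hi; apply: eq_integrable => // y _.
  have fgi : dA.-integrable D (EFin \o (fun y => c1 * f y - c2 * g y)).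
    by have := integrableB mD fi' gi'; apply: eq_integrable => // y _.
  by rewrite RintegralD// RintegralB// !RintegralZl.
transitivity (\int[dA]_(y in D) (c1 * (W y * Re (u y ^+ 4 * conjc (u y) ^+ 2))
   - c2 * (W y * Re (u y ^+ 3 * conjc (u y) ^+ 2)) + c3 * (W y * Re (u y ^+ 2 * conjc (u y) ^+ 2)))).
  apply: eq_Rintegral => y; rewrite inE => Dy.
  have -> : averaged_kernel z x y =
      (c1%:C)%C * (u y ^+ 4 * conjc (u y) ^+ 2) + ((- c2)%:C)%C * (u y ^+ 3 * conjc (u y) ^+ 2)
      + (c3%:C)%C * (u y ^+ 2 * conjc (u y) ^+ 2).
    have d0 : 1 - y * conjc x != 0 by exact: disk_denomC.
    rewrite /averaged_kernel -(bergman_kernel_conj y x) mulc_conj.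
    have -> : (c1%:C)%C = 1 + 4 * ((a)%:C)%C + (a%:C)%C ^+ 2 :> R[i].
      rewrite /c1 rmorphD rmorphXn/=; congr (_ + _); rewrite rmorphD rmorph1; congr (_ + _).
      by rewrite rmorphM rmorph_nat.
    have -> : ((- c2)%:C)%C = - (4 * ((a)%:C)%C + 2 * (a%:C)%C ^+ 2) :> R[i].
      by rewrite /c2 rmorphN rmorphD; congr (- (_ + _)); rewrite rmorphM rmorph_nat ?rmorphXn.
    have -> : (c3%:C)%C = (a%:C)%C ^+ 2 :> R[i] by rewrite /c3 rmorphXn.
    rewrite -/a.
    have -> : bergman_kernel y x = u y ^+ 2 by rewrite /bergman_kernel /u exprVn.
    have -> : conjc (u y ^+ 2) = conjc (u y) ^+ 2 by rewrite rmorphXn.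
    have uE : u y = (1 - y * conjc x)^-1 by [].
    move: (conjc (u y)) uE d0; move: (u y) (y * conjc x) ((a%:C)%C) => U p b v -> d0.
    by field; exact: d0.
  by rewrite !ReE_add !Re_mulrl; ring.
rewrite lin// e1 e2 e3 -lin; [|exact: radial_weight_integrable|exact: radial_weight_integrable|exact: radial_weight_integrable].
apply: eq_Rintegral => y; rewrite inE => Dy.
have s0 : 1 - normc (x * y) ^+ 2 != 0.
  by rewrite gt_eqF// one_sub_sq_gt0//; exact: normcM_lt1.
rewrite !mixed_meanS /= /I_factor -/a /c1 /c2 /c3.
move: s0; move: (normc (x * y) ^+ 2) (W y) => s W0 s0.
by field; exact: s0.
Qed.

End rotation_average.

(** * The variance formula *)

Section near_weights.
Context {R : realType}.
Notation D := (@disk R).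
Implicit Types (x y z e : R[i]) (V B : R[i] * R[i] -> R).

Let mD := @measurable_disk R.

(** The kernel K(x, y) is bounded as long as |x y| stays away from 1, and the
    squared difference of two values of a compactly supported weight vanishes
    when both points are near the unit circle. *)
Definition near_weight (r : R) V := [/\ measurable_fun setT V,
  exists N : R, forall p, `|V p| <= N &
  forall x y, D x -> D y -> r < normc (x * y) -> V (x, y) = 0].

Lemma near_weight_bounded2 r V B : near_weight r V -> measurable_fun setT B ->
  (exists M : R, forall x y, D x -> D y -> normc (x * y) <= r -> `|B (x, y)| <= M) ->
  bounded2 (fun p => V p * B p).
Proof.
move=> [mV [N VN] Vr] mB [M BM]; split; first exact: measurable_funM.
exists (N * `|M|) => x y Dx Dy; have N0 : 0 <= N by exact: le_trans (VN (0, 0)).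
have [xy|xy] := leP (normc (x * y)) r; last by rewrite Vr// mul0r normr0 mulr_ge0.
by rewrite normrM ler_pM// (le_trans (BM x y Dx Dy xy))// ler_norm.
Qed.

Lemma near_weight_prod r g h : compact_weight r g -> (h = cst 1 \/ compact_weight r h) ->
  near_weight r (fun p => g p.1 * h p.2) /\ near_weight r (fun p => h p.1 * g p.2).
Proof.
move=> [mg [M gM] gs] hh.
have [mh [N hN]] : measurable_fun setT h /\ exists N : R, forall x, `|h x| <= N.
  case: hh => [->|[mh hN _]//]; split => //; exists 1 => x; by rewrite normr1.
split; split.
- apply: measurable_funM; first exact: (measurableT_comp mg measurable_fst).
  exact: (measurableT_comp mh measurable_snd).
- by exists (M * N) => p; rewrite normrM ler_pM.
- move=> x y Dx Dy xy; rewrite /= gs ?mul0r//; apply: (lt_le_trans xy).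
  by rewrite normcM ler_piMr ?normc_ge0// ltW.
- apply: measurable_funM; first exact: (measurableT_comp mh measurable_fst).
  exact: (measurableT_comp mg measurable_snd).
- by exists (N * M) => p; rewrite normrM ler_pM.
- move=> x y Dx Dy xy; rewrite /= gs ?mulr0//; apply: (lt_le_trans xy).
  by rewrite normcM ler_piMl ?normc_ge0// ltW.
Qed.

Lemma near_kernel_bound (r : R) x y : r < 1 -> normc (x * y) <= r ->
  normc (bergman_kernel x y) <= (1 - r) ^- 2.
Proof.
move=> r1 xy; rewrite /bergman_kernel normcV normcX.
have x1 : 0 < 1 - r by rewrite subr_gt0.
have h : 1 - r <= normc (1 - x * conjc y).
  by apply: le_trans (normc1B_ge _); rewrite lerD2l lerN2 normcM normc_conj -normcM.
rewrite lef_pV2 ?posrE ?exprn_gt0//; last exact: lt_le_trans h.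
by rewrite ler_sqr ?nnegrE ?normc_ge0// ltW.
Qed.

Lemma measurable_pulled_kernel z :
  measurable_fun setT (fun p : R[i] * R[i] => Re (pulled_kernel z p.1 p.2)).
Proof.
apply: (measurableT_comp (@measurable_Re R)); rewrite /pulled_kernel.
have m1 : measurable_fun setT (fun p : R[i] * R[i] => p.1) by exact: measurable_fst.
have m2 : measurable_fun setT (fun p : R[i] * R[i] => p.2) by exact: measurable_snd.
have mK1 := measurable_kernel m1 m2; have mK2 := measurable_kernel m2 m1.
by meas.
Qed.

Lemma pulled_kernel_bound (r : R) z x y : r < 1 -> D z -> D x -> D y -> normc (x * y) <= r ->
  `|Re (pulled_kernel z x y)| <= 2 ^+ 2 * 2 ^+ 2 * ((1 - r) ^- 2) ^+ 2 * (1 - r) ^- 2.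
Proof.
move=> r1 Dz Dx Dy xy; apply: (le_trans (Re_le_normc _)).
have d2 u : D u -> normc (1 - conjc z * u) <= 2.
  move=> Du; apply: (le_trans (le_normcD _ _)); rewrite normc1 normcN normcM normc_conj.
  by have := normcM_lt1 Dz Du; rewrite normcM; lra.
have yx : normc (y * x) <= r by rewrite mulrC.
have k1 := near_kernel_bound r1 xy; have k2 := near_kernel_bound r1 yx.
rewrite /pulled_kernel 3!normcM normc_conj !normcX.
have sq (a b : R) : 0 <= a -> a <= b -> a ^+ 2 <= b ^+ 2.
  by move=> a0 ab; rewrite lerXn2r// nnegrE// (le_trans a0).
have h1 := sq _ _ (normc_ge0 _) (d2 y Dy); have h2 := sq _ _ (normc_ge0 _) (d2 x Dx).
have h3 := sq _ _ (normc_ge0 _) k2.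
by apply: (ler_pM _ _ (ler_pM _ _ (ler_pM _ _ h1 h2) h3) k1);
  rewrite ?mulr_ge0 ?exprn_ge0 ?normc_ge0.
Qed.

Lemma near_pulled r V z e : r < 1 -> near_weight r V -> D z -> normc e = 1 ->
  bounded2 (fun p => V p * Re (pulled_kernel z (e * p.1) (e * p.2))).
Proof.
move=> r1 nV Dz e1.
apply: (near_weight_bounded2 (B := fun p => Re (pulled_kernel z (e * p.1) (e * p.2))) nV).
  have mp : measurable_fun setT (fun p : R[i] * R[i] => (e * p.1, e * p.2)).
    have m1 : measurable_fun setT (fun p : R[i] * R[i] => p.1) by exact: measurable_fst.
    have m2 : measurable_fun setT (fun p : R[i] * R[i] => p.2) by exact: measurable_snd.
    by apply: measurable_fun_pair; meas.
  exact: (measurableT_comp (measurable_pulled_kernel z) mp).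
exists (2 ^+ 2 * 2 ^+ 2 * ((1 - r) ^- 2) ^+ 2 * (1 - r) ^- 2) => x y Dx Dy xy /=.
by apply: pulled_kernel_bound; rewrite // /disk/= ?normcM e1 ?mul1r -?normcM.
Qed.

Lemma near_pulled1 r V z : r < 1 -> near_weight r V -> D z ->
  bounded2 (fun p => V p * Re (pulled_kernel z p.1 p.2)).
Proof.
move=> r1 nV Dz; have := near_pulled r1 nV Dz (@normc1 R).
by under eq_fun do rewrite !mul1r.
Qed.

End near_weights.

Lemma I_polynomial_bound (R : realDomainType) (a s : R) : 0 <= a -> a <= 1 -> 0 <= s -> s <= 1 ->
  0 <= 1 + (3 + 8 * a) * s + (3 * a ^+ 2 + 8 * a) * s ^+ 2 + a ^+ 2 * s ^+ 3 <= 24.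
Proof.
move=> a0 a1 s0 s1.
have unit (b c : R) : 0 <= b <= 1 -> 0 <= c <= 1 -> 0 <= b * c <= 1.
  by move=> /andP[b0 b1] /andP[c0 c1]; rewrite mulr_ge0//= mulr_ile1.
have a01 : 0 <= a <= 1 by rewrite a0.
have s01 : 0 <= s <= 1 by rewrite s0.
have as1 := unit _ _ a01 s01; have as2 := unit _ _ as1 s01.
have aas2 := unit _ _ as1 as1; have aas3 := unit _ _ aas2 s01.
move: as1 as2 aas2 aas3 => /andP[? ?] /andP[? ?] /andP[? ?] /andP[? ?].
by apply/andP; split; lra.
Qed.

Section final.
Context {R : realType}.
Notation D := (@disk R).
Variables (w : R[i] -> R) (z : R[i]) (r : R).
Hypothesis w_radial : forall x y, D x -> D y -> normc x = normc y -> w x = w y.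
Hypothesis Dz : D z.
Hypothesis r0 : 0 <= r.
Hypothesis r1 : r < 1.
Let w0 := w \_ D.
Let f := moved w z.
Hypothesis fw : compact_weight r f.
Hypothesis ww : compact_weight r w0.
Let mD := @measurable_disk R.
Let a := normc z ^+ 2.

Let w0E x : D x -> w0 x = w x.
Proof. by move=> Dx; rewrite /w0 patchE mem_set. Qed.

Let Dm x : D x -> D (mobius z x).
Proof. by move=> Dx; apply/disk_mobius => //; exact: disk_denom. Qed.

Let fE x : D x -> f (mobius z x) = w0 x.
Proof. by move=> Dx; rewrite /f movedE ?mobiusK ?w0E//; exact: Dm. Qed.

(** The mean of the pulled kernel in y is the diagonal density, so a single
    integral becomes a double one. *)
Lemma diagonal_term : \int[dA]_(x in D) (f x ^+ 2 * kernel1 x ^+ 2) =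
  (1 - a) ^- 2 * dint2 (fun p => w0 p.1 ^+ 2 * Re (pulled_kernel z p.1 p.2)).
Proof.
have [mf [N fN] _] := fw.
have ik : dA.-integrable D (fun x => (f x ^+ 2 * kernel1 x ^+ 2)%:E).
  have h : compact_weight r (fun x => f x * (f x * kernel1 x)).
    apply: compact_weightM => //.
      apply: measurable_funTS; apply: measurable_funM => //; exact: measurable_kernel1.
    exists (N * (1 - r) ^- 2) => x xr.
    by rewrite normrM ler_pM// ger0_norm ?kernel1_ge0// kernel1_bound.
  have := compact_weight_kernel1 r1 h; apply: eq_integrable => // x _.
  by congr EFin; ring.
have [i1 <-] := integrable_mobius Dz ik.
have E x : D x -> f (mobius z x) ^+ 2 * kernel1 (mobius z x) ^+ 2 * mobius_jacobian z x =
   (1 - a) ^- 2 * (w0 x ^+ 2 * diag_density z x).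
  by move=> Dx; rewrite fE// -mulrA diag_density_mobius//; ring.
have a0 : (1 - a) ^+ 2 != 0 by rewrite expf_neq0// gt_eqF// one_sub_sq_gt0.
have i2 : dA.-integrable D (fun x => (w0 x ^+ 2 * diag_density z x)%:E).
  have := integrableZl mD ((1 - a) ^+ 2) i1; apply: eq_integrable => // x; rewrite inE => Dx.
  by rewrite -EFinM E// mulrA divff// mul1r.
transitivity (\int[dA]_(x in D) ((1 - a) ^- 2 * (w0 x ^+ 2 * diag_density z x))).
  by apply: eq_Rintegral => x; rewrite inE => /E.
rewrite RintegralZl//; congr (_ * _); apply: eq_Rintegral => x; rewrite inE => Dx.
rewrite -(pulled_kernel_mean Dz Dx) -RintegralZl//.
apply: (@integrable_disk_bounded _ (fun y => Re (pulled_kernel z x y))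
  (2 ^+ 2 * 2 ^+ 2 * ((1 - normc x) ^- 2) ^+ 2 * (1 - normc x) ^- 2)).
  have mp : measurable_fun setT (fun y : R[i] => (x, y)) by apply: measurable_fun_pair; meas.
  exact: measurable_funTS (measurableT_comp (measurable_pulled_kernel z) mp).
move=> y Dy; apply: pulled_kernel_bound => //.
by rewrite normcM ler_piMr ?normc_ge0// ltW.
Qed.

Let K_weight : bounded2 (fun p => f p.1 * f p.2 * Re (bergman_kernel p.1 p.2) *
  normc (bergman_kernel p.1 p.2) ^+ 2).
Proof.
have mK : measurable_fun setT (fun p : R[i] * R[i] => bergman_kernel p.1 p.2).
  by apply: measurable_kernel; [exact: measurable_fst|exact: measurable_snd].
have b x y : normc x <= r -> normc y <= r -> normc (bergman_kernel x y) <= (1 - r) ^- 2.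
  by move=> xr yr; apply: normc_bergman_kernel => //; exact: le_lt_trans r1.
apply: (@compact_weight2_bounded _ r); apply: compact_weight2M.
- apply: compact_weight2M; first exact: compact_weight_prod.
    exact: (measurableT_comp (@measurable_Re R) mK).
  by exists ((1 - r) ^- 2) => x y xr yr; exact: le_trans (Re_le_normc _) (b _ _ xr yr).
- by apply: measurable_funX; exact: measurable_fun_normc.
- exists (((1 - r) ^- 2) ^+ 2) => x y xr yr /=.
  by rewrite ger0_norm ?sqr_ge0// ler_sqr ?nnegrE ?normc_ge0 ?b// invr_ge0 sqr_ge0.
Qed.

Let near_w : near_weight r (fun p => w0 p.1 * w0 p.2).
Proof. by have [] := near_weight_prod ww (or_intror ww). Qed.

Let w0_sq : compact_weight r (fun x => w0 x ^+ 2).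
Proof.
have [mw [N wN] _] := ww.
have := compact_weightM r1 ww (measurable_funTS mw) (ex_intro _ N (fun x _ => wN x)).
by [].
Qed.

Let near1 : near_weight r (fun p => w0 p.1 ^+ 2).
Proof.
have [h _] := near_weight_prod w0_sq (or_introl (erefl (cst 1 : R[i] -> R))).
by move: h; under eq_fun do rewrite /= mulr1.
Qed.

Let near2 : near_weight r (fun p => w0 p.2 ^+ 2).
Proof.
have [_ h] := near_weight_prod w0_sq (or_introl (erefl (cst 1 : R[i] -> R))).
by move: h; under eq_fun do rewrite /= mul1r.
Qed.

Let Wd (p : R[i] * R[i]) := (w0 p.1 - w0 p.2) ^+ 2.

Let nearW : near_weight r Wd.
Proof.
have [m1 [N1 b1] s1] := near1; have [m2 [N2 b2] s2] := near2; have [m3 [N3 b3] s3] := near_w.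
have WE p : Wd p = w0 p.1 ^+ 2 + w0 p.2 ^+ 2 - 2 * (w0 p.1 * w0 p.2) by rewrite /Wd; ring.
split.
- by rewrite (funext WE); apply: measurable_funB; [exact: measurable_funD|exact: measurable_funM].
- exists (N1 + N2 + 2 * N3) => p; rewrite WE; apply: (le_trans (ler_normB _ _)); apply: lerD.
    by apply: (le_trans (ler_normD _ _)); apply: lerD.
  by rewrite normrM (ger0_norm (ler0n R 2)) ler_wpM2l// ?b3.
- move=> x y Dx Dy xy; rewrite WE.
  have /= -> := s1 x y Dx Dy xy; have /= -> := s2 x y Dx Dy xy; have /= -> := s3 x y Dx Dy xy.
  by rewrite mulr0 subr0 addr0.
Qed.

Lemma offdiagonal_term :
  dint2 (fun p => f p.1 * f p.2 * Re (bergman_kernel p.1 p.2) * normc (bergman_kernel p.1 p.2) ^+ 2) =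
  (1 - a) ^- 2 * dint2 (fun p => w0 p.1 * w0 p.2 * Re (pulled_kernel z p.1 p.2)).
Proof.
rewrite -(dint2_change (fun f => @integrable_mobius _ z f Dz) Dm K_weight).
rewrite -(dint2Z _ (near_pulled1 r1 near_w Dz)).
apply: eq_dint2 => x y Dx Dy /=; rewrite !fE//.
have := pulled_kernel_mobius Dz Dx Dy; rewrite -/a => H.
transitivity (w0 x * w0 y * (Re (bergman_kernel (mobius z x) (mobius z y)) *
  normc (bergman_kernel (mobius z x) (mobius z y)) ^+ 2 *
  (mobius_jacobian z x * mobius_jacobian z y))); first by ring.
by rewrite H; ring.
Qed.

(** The pulled kernel is Hermitian, so its real part is symmetric and the
    square of the weight may be taken at either point. *)
Lemma symmetrized : dint2 (fun p => w0 p.1 ^+ 2 * Re (pulled_kernel z p.1 p.2)) -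
  dint2 (fun p => w0 p.1 * w0 p.2 * Re (pulled_kernel z p.1 p.2)) =
  2^-1 * dint2 (fun p => Wd p * Re (pulled_kernel z p.1 p.2)).
Proof.
have b1 := near_pulled1 r1 near1 Dz; have b2 := near_pulled1 r1 near2 Dz.
have b3 := near_pulled1 r1 near_w Dz.
have -> : dint2 (fun p => Wd p * Re (pulled_kernel z p.1 p.2)) =
  dint2 (fun p => w0 p.1 ^+ 2 * Re (pulled_kernel z p.1 p.2) +
     w0 p.2 ^+ 2 * Re (pulled_kernel z p.1 p.2) -
     2 * (w0 p.1 * w0 p.2 * Re (pulled_kernel z p.1 p.2))).
  by apply: eq_dint2 => x y _ _; rewrite /Wd /=; ring.
rewrite (dint2B (bounded2D b1 b2) (bounded2Z 2 b3)).
rewrite (dint2D b1 b2) (dint2Z _ b3).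
have -> : dint2 (fun p => w0 p.2 ^+ 2 * Re (pulled_kernel z p.1 p.2)) =
   dint2 (fun p => w0 p.1 ^+ 2 * Re (pulled_kernel z p.1 p.2)).
  rewrite (dint2_swap b2); apply: eq_Rintegral => y _; apply: eq_Rintegral => x _.
  by rewrite [pulled_kernel z (x, y).1 (x, y).2]pulled_kernel_sym Re_conj.
by move: (dint2 _) (dint2 _) => I1 I2; field.
Qed.

Let W_rot e x y : D x -> D y -> normc e = 1 -> Wd (e * x, e * y) = Wd (x, y).
Proof.
move=> Dx Dy e1; have De u : D u -> D (e * u) by rewrite /disk/= normcM e1 mul1r.
rewrite /Wd /= !w0E//; try exact: De.
by rewrite (w_radial (De x Dx) Dx) ?(w_radial (De y Dy) Dy)// normcM e1 mul1r.
Qed.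

Lemma rotated e : normc e = 1 ->
  dint2 (fun p => Wd p * Re (pulled_kernel z (e * p.1) (e * p.2))) =
  dint2 (fun p => Wd p * Re (pulled_kernel z p.1 p.2)).
Proof.
move=> e1; have b := near_pulled1 r1 nearW Dz.
rewrite -(@dint2_change _ (fun x => e * x) (fun=> 1) _ _ _ b).
- by apply: eq_dint2 => x y Dx Dy /=; rewrite W_rot// !mulr1.
- move=> g ig; have [i1 e2] := integrable_rotation e1 ig; split.
    by move: i1; apply: eq_integrable => // x _; rewrite mulr1.
  by rewrite -e2; apply: eq_Rintegral => x _; rewrite mulr1.
- by move=> x; rewrite /disk/= normcM e1 mul1r.
Qed.

Let G (p : R[i] * R[i]) := I_factor z p.1 p.2 / (1 - normc (p.1 * p.2) ^+ 2) ^+ 5.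

Let WG_bounded : bounded2 (fun p => Wd p * G p).
Proof.
have a0 : 0 <= a by rewrite sqr_ge0.
have a1 : a <= 1 by rewrite expr_le1 ?normc_ge0// ltW.
have ms : measurable_fun setT (fun p : R[i] * R[i] => normc (p.1 * p.2) ^+ 2).
  have m1 : measurable_fun setT (fun p : R[i] * R[i] => p.1) by exact: measurable_fst.
  have m2 : measurable_fun setT (fun p : R[i] * R[i] => p.2) by exact: measurable_snd.
  by apply: measurable_funX; meas.
apply: (near_weight_bounded2 nearW).
  apply: measurable_funM; last by apply: measurable_funV; apply: measurable_funX; exact: measurable_funB.
  rewrite /I_factor; apply: measurable_funD; last by apply: measurable_funM => //; exact: measurable_funX.
  apply: measurable_funD; last by apply: measurable_funM => //; exact: measurable_funX.
  by apply: measurable_funD => //; exact: measurable_funM.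
have r2 : r ^+ 2 < 1 by rewrite expr_lt1.
exists (24 * (1 - r ^+ 2) ^- 5) => x y Dx Dy xy; rewrite /G /= /I_factor -/a.
have s0 : 0 <= normc (x * y) ^+ 2 by rewrite sqr_ge0.
have sr : normc (x * y) ^+ 2 <= r ^+ 2 by rewrite lerXn2r// nnegrE normc_ge0.
move: (normc (x * y) ^+ 2) s0 sr => s s0 sr.
have s1 : s <= 1 by exact: le_trans (ltW r2).
have /andP[i0 i24] := I_polynomial_bound a0 a1 s0 s1.
have q0 : 0 < (1 - r ^+ 2) ^+ 5 by rewrite exprn_gt0// subr_gt0.
have q1 : (1 - r ^+ 2) ^+ 5 <= (1 - s) ^+ 5.
  by rewrite lerXn2r ?nnegrE ?subr_ge0// ?(ltW r2)// lerD2l lerN2.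
rewrite ger0_norm; last by rewrite divr_ge0// exprn_ge0// subr_ge0.
apply: ler_pM => //; first by rewrite invr_ge0 exprn_ge0// subr_ge0.
by rewrite lef_pV2// posrE (lt_le_trans q0).
Qed.

(** The squared difference of the radial weight is invariant under joint
    rotations. *)
Lemma averaged : dint2 (fun p => Wd p * Re (pulled_kernel z p.1 p.2)) =
  dint2 (fun p => Wd p * G p).
Proof.
pose j : R[i] := Complex 0 1.
have nj : normc j = 1 by rewrite /normc/= expr0n/= add0r expr1n sqrtr1.
have nnj : normc (- j) = 1 by rewrite normcN.
have nm : normc (-1 : R[i]) = 1 by rewrite normcN normc1.
have b0 := near_pulled1 r1 nearW Dz.
have b1 := near_pulled r1 nearW Dz nj.
have b2 := near_pulled r1 nearW Dz nm.
have b3 := near_pulled r1 nearW Dz nnj.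
have E : 4 * dint2 (fun p => Wd p * Re (pulled_kernel z p.1 p.2)) =
  dint2 (fun p => Wd p * Re (pulled_kernel z p.1 p.2)
    + Wd p * Re (pulled_kernel z (j * p.1) (j * p.2))
    + Wd p * Re (pulled_kernel z (-1 * p.1) (-1 * p.2))
    + Wd p * Re (pulled_kernel z (- j * p.1) (- j * p.2))).
  have b01 := bounded2D b0 b1; have b012 := bounded2D b01 b2.
  rewrite (dint2D b012 b3) (dint2D b01 b2) (dint2D b0 b1).
  by rewrite (rotated nj) (rotated nm) (rotated nnj); ring.
have four : (4 : R) != 0 by rewrite pnatr_eq0.
apply: (mulfI four); apply: (eq_trans E); apply: (eq_trans _ (dint2Z 4 WG_bounded)).
apply: eq_Rintegral => x; rewrite inE => Dx.
have wr : radial_weight (fun y => 4 * Wd (x, y)).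
  have [mW [N WN] _] := nearW; split.
  - have mp : measurable_fun setT (fun y : R[i] => (x, y)) by apply: measurable_fun_pair; meas.
    by apply: measurable_funM => //; exact: measurable_funTS (measurableT_comp mW mp).
  - by exists (4 * N) => y _; rewrite normrM (ger0_norm (ler0n R 4)) ler_wpM2l.
  - by move=> y y' Dy Dy' yy; rewrite /Wd /= !w0E// (w_radial Dy Dy' yy).
transitivity (\int[dA]_(y in D) (4 * Wd (x, y) * Re (averaged_kernel z x y))).
  apply: eq_Rintegral => y _; rewrite /= -!mulrDr -!ReE_add pulled_kernel_average.
  have -> : 4 = ((4%:R : R)%:C)%C :> R[i] by rewrite rmorph_nat.
  by rewrite Re_mulrl; ring.
rewrite averaged_mean//; by apply: eq_Rintegral => y _; rewrite -mulrA.
Qed.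

(** The two terms of the variance combine into a squared difference, and the
    kernel is replaced by its average. *)
Lemma variance_double_integral :
  ((\int[dA]_(x in D) (f x ^+ 2 * kernel1 x ^+ 2) -
    dint2 (fun p => f p.1 * f p.2 * Re (bergman_kernel p.1 p.2) *
      normc (bergman_kernel p.1 p.2) ^+ 2))%:E =
  (1 / (2 * (1 - a) ^+ 2))%:E *
   \int[dA]_(x in D) \int[dA]_(y in D)
     (`|w x - w y| ^+ 2 / (1 - normc (x * y) ^+ 2) ^+ 5 * I_factor z x y)%:E)%E.
Proof.
rewrite diagonal_term offdiagonal_term -mulrBr symmetrized averaged.
have -> : (\int[dA]_(x in D) \int[dA]_(y in D)
     (`|w x - w y| ^+ 2 / (1 - normc (x * y) ^+ 2) ^+ 5 * I_factor z x y)%:E =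
   (dint2 (fun p => Wd p * G p))%:E)%E.
  rewrite -(dint2_prod WG_bounded).1; apply: eq_integral => x; rewrite inE => Dx.
  apply: eq_integral => y; rewrite inE => Dy; congr EFin.
  by rewrite real_normK ?num_real// /Wd /G /= !w0E// mulrAC mulrA.
rewrite -EFinM; congr EFin; rewrite mulrA; congr (_ * _).
by rewrite div1r [LHS]mulrC -invfM.
Qed.

End final.

Unset Implicit Arguments.

Theorem proposition6p6 (R : realType)
    (P : probability (configuration R) R)
    (P_dpp : determinantal P (@bergman_kernel R))
    (w : R[i] -> R)
    (w_ge0 : forall x, disk x -> 0 <= w x)
    (w_meas : measurable_fun disk w)
    (w_bounded : [bounded w x | x in disk])
    (w_supp : exists K : set R[i]^o, [/\ compact K, K `<=` disk &
                forall x, disk x -> w x != 0 -> K x])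
    (w_radial : forall x y, disk x -> disk y -> normc x = normc y -> w x = w y)
    (z : R[i]) (z_disk : disk z) :
  hilbert_variance P (g_sum w (@bergman_F R) z) =
  ((1 / (2 * (1 - normc z ^+ 2) ^+ 2))%:E *
   \int[dA]_(x in disk) \int[dA]_(y in disk)
     (`|w x - w y| ^+ 2 / (1 - normc (x * y) ^+ 2) ^+ 5 * I_factor z x y)%:E)%E.
Proof.
have [r /andP[r0 r1] [fw ww]] := moved_compact_weight w_meas w_bounded w_supp z_disk.
rewrite (variance_moments P_dpp w_radial z_disk r1 fw ww).
exact: (variance_double_integral w_radial z_disk r0 r1 fw ww).
Qed.
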